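(* Let $n$ be a positive integer, $0<q<p<\infty$, let $\mathbf{u}=(u_0,u_1,\dots,u_n)$ with each $u_k\in H(\mathbb{D})$, and let $\mu$ be a positive Borel measure on $\mathbb{D}$. The following are equivalent: (a) $\mu$ is a $(\mathbf{u},p,q)$-Sobolev Carleson measure; (b) $\mu$ is a vanishing $(\mathbf{u},p,q)$-Sobolev Carleson measure; (c) for each $0\leq k\leq n$, $|u_k|^q\,d\mu$ is a $(k,p,q)$-Carleson measure; (d) for each $0\leq k\leq n$, $|u_k|^q\,d\mu$ is a vanishing $(k,p,q)$-Carleson measure.
   Context: $\mathbb{D}$ is the open unit disc, $H(\mathbb{D})$ the space of analytic functions on $\mathbb{D}$, $dA=\frac{dx\,dy}{\pi}$ normalized area measure. For $0<p<\infty$, the Bergman space $A^p$ consists of $f\in H(\mathbb{D})$ with $\|f\|_p^p=\int_{\mathbb{D}}|f|^p\,dA<\infty$. For an integer $k\geq0$, a positive Borel measure $\nu$ on $\mathbb{D}$ is a $(k,p,q)$-Carleson measure if there is $C>0$ with $\int_{\mathbb{D}}|f^{(k)}|^q\,d\nu\leq C\|f\|_p^q$ for all $f\in A^p$; it is a vanishing $(k,p,q)$-Carleson measure if $\int_{\mathbb{D}}|f_j^{(k)}|^q\,d\nu\to0$ whenever $\{f_j\}$ is a bounded sequence in $A^p$ converging to $0$ uniformly on compact subsets of $\mathbb{D}$. Writing $\langle\mathbf{u},\mathcal{D}f\rangle=u_0f+u_1f'+\cdots+u_nf^{(n)}$, $\mu$ is a $(\mathbf{u},p,q)$-Sobolev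 Carleson measure if there is $C>0$ with $\int_{\mathbb{D}}|\langle\mathbf{u}(z),\mathcal{D}f(z)\rangle|^q\,d\mu(z)\leq C\|f\|_p^q$ for all $f\in A^p$, and a vanishing $(\mathbf{u},p,q)$-Sobolev Carleson measure if $\int_{\mathbb{D}}|\langle\mathbf{u},\mathcal{D}f_j\rangle|^q\,d\mu\to0$ whenever $\{f_j\}$ is bounded in $A^p$ and converges to $0$ uniformly on compact subsets of $\mathbb{D}$. *)

(* Defs.v *)
From HB Require Import structures.
From mathcomp Require Import all_boot all_order all_algebra.
From mathcomp Require Import all_classical all_reals all_analysis.
From mathcomp Require Import complex.
Import Order.TTheory GRing.Theory Num.Theory.
Import numFieldNormedType.Exports.
Local Open Scope ring_scope.
Local Open Scope classical_set_scope.

Set Implicit Arguments.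
Unset Strict Implicit.
Unset Printing Implicit Defensive.

Section Bergman.
Variable R : realType.

Definition cabs (z : R[i]) : R := Normc.normc z.

Definition toC (x : R * R) : R[i] := Complex x.1 x.2.

Definition disc : set R[i] := [set z | cabs z < 1].
Definition discR2 : set (R * R) := [set x | cabs (toC x) < 1].

Definition holo (f : R[i] -> R[i]) : Prop :=
  forall z, disc z -> derivable (f : R[i]^o -> R[i]^o) z 1.

Definition cderiv (k : nat) (f : R[i] -> R[i]) : R[i] -> R[i] :=
  iter k (fun g : R[i] -> R[i] => derive1 (g : R[i]^o -> R[i]^o)) f.

Definition leb2 := ((@lebesgue_measure R) \x (@lebesgue_measure R))%E.

Definition bergman_int (p : R) (f : R[i] -> R[i]) : \bar R :=
  ((pi^-1)%:E * \int[leb2]_(x in discR2) ((cabs (f (toC x))) `^ p)%:E)%E.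

Definition inAp (p : R) (f : R[i] -> R[i]) : Prop :=
  holo f /\ (bergman_int p f < +oo)%E.

Definition normAp (p : R) (f : R[i] -> R[i]) : R :=
  (fine (bergman_int p f)) `^ (p^-1).

Definition ucc0 (fs : nat -> R[i] -> R[i]) : Prop :=
  forall K : set R[i], compact (K : set R[i]^o) -> K `<=` disc ->
  forall eps : R, 0 < eps ->
  \forall j \near \oo, forall z, K z -> cabs (fs j z) < eps.

Definition bounded_Ap (p : R) (fs : nat -> R[i] -> R[i]) : Prop :=
  (forall j, inAp p (fs j)) /\ exists M : R, forall j, normAp p (fs j) <= M.


(* The measure  w d(mu)  (w >= 0) is a (k,p,q)-Carleson measure:
   int |f^(k)|^q d(w mu) = int |f^(k)|^q w d mu. *)
Definition carleson (k : nat) (p q : R)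
    (mu : {measure set (R * R) -> \bar R}) (w : R * R -> R) : Prop :=
  exists C : R, 0 < C /\ forall f, inAp p f ->
    (\int[mu]_(x in discR2) ((cabs (cderiv k f (toC x))) `^ q * w x)%:E
      <= (C * (normAp p f) `^ q)%:E)%E.

Definition vanishing_carleson (k : nat) (p q : R)
    (mu : {measure set (R * R) -> \bar R}) (w : R * R -> R) : Prop :=
  forall fs : nat -> R[i] -> R[i], bounded_Ap p fs -> ucc0 fs ->
    (\int[mu]_(x in discR2) ((cabs (cderiv k (fs j) (toC x))) `^ q * w x)%:E)%E
      @[j --> \oo] --> 0%E.

Definition uDf (n : nat) (u : nat -> R[i] -> R[i]) (f : R[i] -> R[i])
    (z : R[i]) : R[i] :=
  \sum_(k < n.+1) u k z * cderiv k f z.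

Definition sobolev_carleson (n : nat) (u : nat -> R[i] -> R[i]) (p q : R)
    (mu : {measure set (R * R) -> \bar R}) : Prop :=
  exists C : R, 0 < C /\ forall f, inAp p f ->
    (\int[mu]_(x in discR2) ((cabs (uDf n u f (toC x))) `^ q)%:E
      <= (C * (normAp p f) `^ q)%:E)%E.

Definition vanishing_sobolev_carleson (n : nat) (u : nat -> R[i] -> R[i])
    (p q : R) (mu : {measure set (R * R) -> \bar R}) : Prop :=
  forall fs : nat -> R[i] -> R[i], bounded_Ap p fs -> ucc0 fs ->
    (\int[mu]_(x in discR2) ((cabs (uDf n u (fs j) (toC x))) `^ q)%:E)%E
      @[j --> \oo] --> 0%E.

End Bergman.

(* Main.v *)
(* Write D for the size of a Whitney box of the disc and b for a point near it.
   The core is (a) => (d).  The normalized kernels (D / (1 - conj(b) z))^B, one per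
   box, satisfy ||sum_j H_j a_j||_p^p <= K sum_j H_j^p D_j^2.  Applying (a) to
   combinations with random signs and averaging over the signs decouples the boxes:
   if c_j is the integral over box j of |<u, D a_j>|^q, then
   sum_j H_j^q c_j <= K (sum_j H_j^p D_j^2)^(q/p), and the optimal choice of H gives
   sum_j D_j^2 (c_j / D_j^2)^(p/(p-q)) < oo.  Doing this for the n + 1 exponents
   B, ..., B + n separates the coefficients u_k, because the k-th derivative of the
   kernel carries the factor B (B+1) ... (B+k-1) and these rising factorials form an
   invertible matrix.  Combined with the mean value estimate for f^(k) on a box and
   with Young's inequality for the exponents p/q and p/(p-q), the convergence of the
   sum makes the contribution of all but finitely many boxes uniformly small, while
   the remaining boxes lie in a compact set; this is (d).
   The triangle inequality gives (c) => (a) and (d) => (b), and a vanishing condition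
   implies the corresponding bound by homogeneity. *)
Require Import Defs.
From HB Require Import structures.
From mathcomp Require Import all_boot all_order all_algebra.
From mathcomp Require Import all_classical all_reals all_analysis.
From mathcomp Require Import complex.
From mathcomp Require Import measurable_realfun zify ring lra.
Import Order.TTheory GRing.Theory Num.Theory.
Import numFieldNormedType.Exports.
Local Open Scope ring_scope.
Local Open Scope classical_set_scope.

Local Notation Re := (@complex.Re _).
Local Notation Im := (@complex.Im _).

Set Implicit Arguments.
Unset Strict Implicit.
Unset Printing Implicit Defensive.

(** * Modulus and complex differentiability with real epsilons *)

Section ComplexModulus.
Variable R : realType.
Local Notation C := R[i].
Implicit Types (z w h : C).

(** The obstacle in (a) is cancellation: a bound for [<u, Df>] says nothing about a single term
    [u_k f^(k)]. That (a) already yields vanishing is an effect of [q < p]: the freedom in [H] turns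
    (a) into a convergent series over the boxes instead of a mere supremum. All [p > 0] are treated
    together. For sums of kernels, a Schur test in which an l^p sum dominates a supremum takes the
    place of duality and of the triangle inequality; its price is the largeness of [B]. Only the
    mean value estimate distinguishes [p >= 1] from [p < 1]. Function theory is built from pointwise
    complex differentiability, with rectangles as contours. The integral of [1 / (w - z)] is carried
    along as a factor that is bounded below, and the sides of the contours are chosen by Fubini, so
    that area integrals control boundary integrals. The boxes are cut in Cartesian coordinates: the
    smaller coordinate runs along the arc, and the modulus and a sign determine the other one. The
    numerical constants record crude comparisons between these shapes and the kernels. *)

Lemma cabs_ge0 z : 0 <= cabs z.
Proof. by case: z => a b; rewrite /cabs /= sqrtr_ge0. Qed.

Lemma cabs0 : cabs (0 : C) = 0.
Proof. by rewrite /cabs Normc.normc0. Qed.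

Lemma cabs1 : cabs (1 : C) = 1.
Proof. by rewrite /cabs Normc.normc1. Qed.

Lemma cabs_eq0 z : (cabs z == 0) = (z == 0).
Proof.
apply/idP/idP => [/eqP/Normc.eq0_normc -> //|/eqP ->]; by rewrite cabs0.
Qed.

Lemma cabs_gt0 z : (0 < cabs z) = (z != 0).
Proof. by rewrite lt_def cabs_eq0 cabs_ge0 andbT. Qed.

Lemma cabsM z w : cabs (z * w) = cabs z * cabs w.
Proof. exact: Normc.normcM. Qed.

Lemma cabsV z : cabs z^-1 = (cabs z)^-1.
Proof. exact: Normc.normcV. Qed.

Lemma cabsN z : cabs (- z) = cabs z.
Proof. exact: normcN. Qed.

Lemma cabsD z w : cabs (z + w) <= cabs z + cabs w.
Proof. exact: le_normcD. Qed.

Lemma cabsX z n : cabs (z ^+ n) = cabs z ^+ n.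
Proof. by elim: n => [|n IH]; rewrite ?cabs1 // !exprS cabsM IH. Qed.

Lemma cabsB z w : cabs (z - w) = cabs (w - z).
Proof. by rewrite -cabsN opprB. Qed.

Lemma cabs_le_sub z w : cabs z <= cabs w + cabs (z - w).
Proof. by have := cabsD w (z - w); rewrite addrC subrK. Qed.

Lemma cabs_real (a : R) : cabs (Complex a 0) = `|a|.
Proof. by rewrite /cabs /= expr0n /= addr0 sqrtr_sqr. Qed.

Lemma cabs_sqr z : cabs z ^+ 2 = Re z ^+ 2 + Im z ^+ 2.
Proof. by case: z => a b /=; rewrite /cabs /= sqr_sqrtr // addr_ge0 ?sqr_ge0. Qed.

Lemma cabs_Re z : `|Re z| <= cabs z.
Proof.
rewrite -(ler_pXn2r (n := 2)) ?nnegrE ?cabs_ge0 //.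
by rewrite cabs_sqr real_normK ?num_real // lerDl sqr_ge0.
Qed.

Lemma cabs_Im z : `|Im z| <= cabs z.
Proof.
rewrite -(ler_pXn2r (n := 2)) ?nnegrE ?cabs_ge0 //.
by rewrite cabs_sqr real_normK ?num_real // lerDr sqr_ge0.
Qed.

Lemma cabs_le_ReIm z : cabs z <= `|Re z| + `|Im z|.
Proof.
rewrite -(ler_pXn2r (n := 2)) ?nnegrE ?cabs_ge0 ?addr_ge0 //.
rewrite cabs_sqr sqrrD !real_normK ?num_real //.
by rewrite -addrA lerD2l lerDr mulrn_wge0 // mulr_ge0.
Qed.

Lemma normC_cabs z : `|z| = (cabs z)%:C%C.
Proof. by rewrite normc_def; case: z. Qed.

Lemma cabs_sum (I : Type) (s : seq I) (P : pred I) (F : I -> C) :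
  cabs (\sum_(i <- s | P i) F i) <= \sum_(i <- s | P i) cabs (F i).
Proof.
elim/big_ind2: _ => [|x1 x2 y1 y2 h1 h2|i _]; rewrite ?cabs0 //.
exact: (le_trans (cabsD _ _) (lerD h1 h2)).
Qed.

(** Differentiability with derivative [l], free of division by [h] and with real epsilons. The norm
    of [R[i]] takes values in [R[i]], which is awkward for real estimates; all analysis below goes
    through this form. *)
Definition cdiff (f : C -> C) (z l : C) := forall e : R, 0 < e ->
  exists2 d : R, 0 < d &
    forall h, cabs h < d -> cabs (f (z + h) - f z - l * h) <= e * cabs h.

Lemma derivable_cdiff (f : C -> C) z :
  derivable (f : C^o -> C^o) z 1 ->
  cdiff f z (derive1 (f : C^o -> C^o) z).
Proof.
move=> df e e0; have : (fun h : C^o => h^-1 *: ((f : C^o -> C^o) (h + z) - f z))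
    @ 0^' --> derive1 (f : C^o -> C^o) z.
  have := df; rewrite /derivable /derive1.
  by under eq_fun do rewrite /GRing.scale /= mulr1.
move/cvgrPdist_le => /(_ (e%:C)%C); rewrite ltcR => /(_ e0).
(* A positive element of [R[i]] is real, so [Re d] is the radius itself. *)
case => d /= d0 H; exists (Re d).
  by move: d0; rewrite ltcE => /andP[].
move=> h hd; have [->|h0] := eqVneq h 0.
  by rewrite addr0 subrr mulr0 subr0 cabs0 mulr0.
have := H h; rewrite /= sub0r normrN => /(_ _ h0).
rewrite normC_cabs => H1.
have : ((cabs h)%:C < d)%C.
  by rewrite ltcE /=; move: d0; rewrite ltcE /= => /andP[/eqP -> _]; rewrite eqxx.
move/H1; rewrite normC_cabs lecR => H2.
rewrite -ler_pdivrMr ?cabs_gt0 // -cabsV -cabsM; apply: le_trans H2.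
rewrite le_eqVlt; apply/orP; left; apply/eqP; rewrite -[RHS]cabsN; congr (cabs _).
by rewrite [h + z]addrC -[h^-1 *: _]/(h^-1 * _); field.
Qed.

Lemma cdiff_cvg (f : C -> C) z l : cdiff f z l ->
  (fun h : C^o => h^-1 *: ((f : C^o -> C^o) (h + z) - f z)) @ 0^' --> (l : C^o).
Proof.
move=> df; apply/cvgrPdist_le => e e0.
have [e1 he] : exists e1 : R, e = (e1%:C)%C.
  by exists (Re e); move: e0; rewrite ltcE /= => /andP[/eqP h _]; case: e h => a b /= ->.
move: e0; rewrite he ltcR => e10.
have [d d0 H] := df _ e10.
exists (d%:C)%C => /=; first by rewrite ltcR.
move=> h; rewrite /= sub0r normrN normC_cabs ltcR => hd h0.
rewrite normC_cabs lecR -[h^-1 *: _]/(h^-1 * _).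
have := H _ hd; rewrite -ler_pdivrMr ?cabs_gt0 // -cabsV -cabsM.
congr (_ <= _); rewrite -cabsN; congr cabs; rewrite [h + z]addrC; field.
exact: h0.
Qed.

Lemma cdiff_derivable (f : C -> C) z l : cdiff f z l ->
  derivable (f : C^o -> C^o) z 1 /\ derive1 (f : C^o -> C^o) z = l.
Proof.
move=> /cdiff_cvg H; split; last exact: (cvg_lim (@norm_hausdorff _ C^o) H).
apply/cvg_ex; exists l.
by under eq_fun do rewrite /GRing.scale /= mulr1.
Qed.

End ComplexModulus.

(** * Calculus of [cdiff] and pointwise continuity *)

Section ComplexCalculus.
Variable R : realType.
Local Notation C := R[i].
Implicit Types (z w h l : C) (f g : C -> C).

Lemma cdiffE f z l :
  cdiff f z l <-> is_derive (z : C^o) (1 : C^o) (f : C^o -> C^o) (l : C^o).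
Proof.
split=> [/cdiff_derivable[df dl]|[df dl]].
  by apply: (DeriveDef df); rewrite -derive1E; exact: dl.
by rewrite -dl -derive1E; exact: derivable_cdiff.
Qed.

Lemma cdiffD f g z l m : cdiff f z l -> cdiff g z m ->
  cdiff (fun w => f w + g w) z (l + m).
Proof. by rewrite !cdiffE => df dg; exact: (is_deriveD df dg). Qed.

Lemma cdiffB f g z l m : cdiff f z l -> cdiff g z m ->
  cdiff (fun w => f w - g w) z (l - m).
Proof. by rewrite !cdiffE => df dg; exact: (is_deriveB df dg). Qed.

Lemma cdiffM f g z l m : cdiff f z l -> cdiff g z m ->
  cdiff (fun w => f w * g w) z (f z * m + g z * l).
Proof. by rewrite !cdiffE => df dg; exact: (is_deriveM df dg). Qed.

Lemma cdiff_cst k z : cdiff (fun=> k) z 0.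
Proof. by rewrite cdiffE; exact: (is_derive_cst (k : C^o)). Qed.

Lemma cdiff_id z : cdiff id z 1.
Proof. by rewrite cdiffE; exact: is_derive_id. Qed.

Lemma cdiffV f z l : f z != 0 -> cdiff f z l ->
  cdiff (fun w => (f w)^-1) z (- l / f z ^+ 2).
Proof.
rewrite !cdiffE => f0 [df dl].
apply: (DeriveDef (derivableV f0 df)); rewrite (deriveV f0 df) dl /GRing.scale /=.
by rewrite mulNr mulrC mulNr.
Qed.

Lemma cdiffX f z l n : cdiff f z l ->
  cdiff (fun w => f w ^+ n) z (n%:R * f z ^+ n.-1 * l).
Proof.
move=> df; elim: n => [|n IH]; first by rewrite !mul0r; exact: cdiff_cst.
under eq_fun do rewrite exprS.
have -> : n.+1%:R * f z ^+ n.+1.-1 * l = f z * (n%:R * f z ^+ n.-1 * l) + f z ^+ n * l;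
  last exact: (cdiffM df IH).
(* At exponent 0 the truncated [n.-1] is multiplied by 0. *)
case: n {IH} => [|n]; first by rewrite /= !expr0; ring.
by rewrite /= exprS -!natr1; ring.
Qed.

Lemma cdiff_near f g z l (d : R) : 0 < d ->
  (forall h, cabs h < d -> f (z + h) = g (z + h)) -> cdiff f z l -> cdiff g z l.
Proof.
move=> d0 fg df e e0; have [d1 d10 H] := df _ e0.
exists (Num.min d d1); first by rewrite lt_min d0.
move=> h; rewrite lt_min => /andP[hd hd1].
by rewrite -fg // -[g z](_ : f z = _) ?H // -[z]addr0 fg // cabs0.
Qed.

Definition ccont f z := forall e : R, 0 < e ->
  exists2 d : R, 0 < d & forall h, cabs h < d -> cabs (f (z + h) - f z) < e.

Lemma cdiff_ccont f z l : cdiff f z l -> ccont f z.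
Proof.
move=> df e e0; have [d d0 H] := df _ ltr01.
have c0 : 0 < 1 + cabs l by rewrite ltr_pwDl // cabs_ge0.
exists (Num.min d (e / (1 + cabs l))); first by rewrite lt_min d0 divr_gt0.
move=> h; rewrite lt_min ltr_pdivlMr // => /andP[hd he].
apply: le_lt_trans he.
have -> : f (z + h) - f z = (f (z + h) - f z - l * h) + l * h by ring.
apply: le_trans (cabsD _ _) _; rewrite mulrDr mulr1 cabsM [cabs h * _]mulrC.
by rewrite lerD2r -[leRHS]mul1r H.
Qed.

Lemma ccont_bounded f z : ccont f z ->
  exists2 d : R, 0 < d & forall h, cabs h < d -> cabs (f (z + h)) < cabs (f z) + 1.
Proof.
move=> /(_ _ ltr01)[d d0 H]; exists d => // h /H h1.
by apply: le_lt_trans (cabs_le_sub _ (f z)) _; rewrite ltrD2l.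
Qed.

Lemma ccont_neq0 f z : ccont f z -> f z != 0 ->
  exists2 d : R, 0 < d & forall h, cabs h < d -> f (z + h) != 0.
Proof.
move=> cf; rewrite -cabs_gt0 => f0; have [d d0 H] := cf _ f0.
exists d => // h /H; apply: contraTneq => ->.
by rewrite sub0r cabsN ltxx.
Qed.

End ComplexCalculus.

(** * Integrals of complex functions over a segment *)

Section IntervalIntegral.
Variable R : realType.
Local Notation C := R[i].
Local Notation mu := (@lebesgue_measure R).
Implicit Types (a b c t : R) (g : R -> C).

(** Continuity at the points of the segment within the whole line, end points included, as inherited
    from functions that are continuous around a contour. *)
Definition icont a b g := forall t, a <= t -> t <= b -> forall e : R, 0 < e ->
  exists2 d : R, 0 < d & forall s, `|s| < d -> cabs (g (t + s) - g t) < e.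

Definition cint a b g : C :=
  Complex (\int[mu]_(t in `[a, b]) Re (g t)) (\int[mu]_(t in `[a, b]) Im (g t)).

Lemma icontS a b a' b' g : a <= a' -> b' <= b -> icont a b g -> icont a' b' g.
Proof.
by move=> aa bb H t ta tb; apply: H; [exact: le_trans ta | exact: le_trans bb].
Qed.

Lemma icont_lip (phi : C -> R) a b g : (forall z w, `|phi z - phi w| <= cabs (z - w)) ->
  icont a b g -> mu.-integrable `[a, b] (EFin \o (phi \o g)).
Proof.
move=> lip cg; apply: continuous_compact_integrable; first exact: segment_compact.
apply: continuous_in_subspaceT => t; rewrite inE /= in_itv /= => /andP[ta tb].
apply/cvgrPdist_lt => e e0.
have [d d0 H] := cg _ ta tb _ e0.
exists d => //= s sd; have := H (s - t); rewrite [t + _]addrC subrK distrC => /(_ sd) h.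
by rewrite distrC; apply: le_lt_trans h; exact: lip.
Qed.

Lemma icont_Re a b g : icont a b g ->
  mu.-integrable `[a, b] (EFin \o (fun t => Re (g t))).
Proof.
apply: (@icont_lip (@complex.Re R)) => z w.
by apply: le_trans (cabs_Re _); case: z w => [? ?] [? ?].
Qed.

Lemma icont_Im a b g : icont a b g ->
  mu.-integrable `[a, b] (EFin \o (fun t => Im (g t))).
Proof.
apply: (@icont_lip (@complex.Im R)) => z w.
by apply: le_trans (cabs_Im _); case: z w => [? ?] [? ?].
Qed.

Lemma cabs_lip (z w : C) : `|cabs z - cabs w| <= cabs (z - w).
Proof.
rewrite ler_norml lerNl opprB !lerBlDr ![cabs (z - w) + _]addrC cabs_le_sub.
by rewrite [X in X && _](_ : _ = true) // cabsB cabs_le_sub.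
Qed.

Lemma icont_cabs a b g : icont a b g ->
  mu.-integrable `[a, b] (EFin \o (fun t => cabs (g t))).
Proof. by apply: icont_lip; exact: cabs_lip. Qed.

Lemma Rint_split a b c (f : R -> R) : a <= b -> b <= c ->
  mu.-integrable `[a, c] (EFin \o f) ->
  \int[mu]_(t in `[a, c]) f t =
  \int[mu]_(t in `[a, b]) f t + \int[mu]_(t in `[b, c]) f t.
Proof.
move=> ab bc fi.
have H : mu.-integrable `[b, c] (EFin \o f).
  by apply: integrableS fi => //; apply: subset_itvr; rewrite bnd_simp.
rewrite -(Rintegral_itv_obnd_cbnd (r := b)); last first.
  by apply: integrableS H => //; apply: subset_itvr; rewrite bnd_simp.
by rewrite -(Rintegral_itvB (x := b) fi) ?bnd_simp // addrC subrK.
Qed.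

Lemma cint_split a b c g : a <= b -> b <= c -> icont a c g ->
  cint a c g = cint a b g + cint b c g.
Proof.
move=> ab bc cg; rewrite /cint.
rewrite (Rint_split ab bc (icont_Re cg)) (Rint_split ab bc (icont_Im cg)).
by [].
Qed.

Lemma icontD a b g1 g2 : icont a b g1 -> icont a b g2 ->
  icont a b (fun t => g1 t + g2 t).
Proof.
move=> c1 c2 t ta tb e e0; have e2 : 0 < e / 2 by rewrite divr_gt0.
have [d1 d10 H1] := c1 _ ta tb _ e2; have [d2 d20 H2] := c2 _ ta tb _ e2.
exists (Num.min d1 d2); first by rewrite lt_min d10.
move=> s; rewrite lt_min => /andP[/H1 h1 /H2 h2].
rewrite opprD addrACA [e]splitr; apply: le_lt_trans (cabsD _ _) _.
exact: ltrD.
Qed.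

Lemma icontZ a b (k : C) g : icont a b g -> icont a b (fun t => k * g t).
Proof.
move=> cg t ta tb e e0.
have k0 : 0 < cabs k + 1 by rewrite ltr_wpDl // cabs_ge0.
have e2 : 0 < e / (cabs k + 1) by rewrite divr_gt0.
have [d d0 H] := cg _ ta tb _ e2; exists d => // s /H.
rewrite ltr_pdivlMr // => h; rewrite -mulrBr cabsM mulrC.
by apply: le_lt_trans h; rewrite ler_wpM2l ?cabs_ge0 // lerDl.
Qed.

Lemma icontN a b g : icont a b g -> icont a b (fun t => - g t).
Proof.
move=> cg t ta tb e e0; have [d d0 H] := cg _ ta tb _ e0; exists d => // s /H.
by rewrite -cabsN opprB opprK addrC.
Qed.

Lemma icontB a b g1 g2 : icont a b g1 -> icont a b g2 ->
  icont a b (fun t => g1 t - g2 t).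
Proof. by move=> c1 c2; apply: icontD => //; apply: icontN. Qed.

Lemma cintD a b g1 g2 : icont a b g1 -> icont a b g2 ->
  cint a b (fun t => g1 t + g2 t) = cint a b g1 + cint a b g2.
Proof.
move=> c1 c2; rewrite /cint.
have -> : Complex (\int[mu]_(t in `[a, b]) Re (g1 t)) (\int[mu]_(t in `[a, b]) Im (g1 t))
  + Complex (\int[mu]_(t in `[a, b]) Re (g2 t)) (\int[mu]_(t in `[a, b]) Im (g2 t)) =
  Complex (\int[mu]_(t in `[a, b]) Re (g1 t) + \int[mu]_(t in `[a, b]) Re (g2 t))
  (\int[mu]_(t in `[a, b]) Im (g1 t) + \int[mu]_(t in `[a, b]) Im (g2 t)) by [].
rewrite -!RintegralD //; try exact: icont_Re; try exact: icont_Im.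
by congr Complex; apply: eq_Rintegral => t _; case: (g1 t) (g2 t) => [? ?] [? ?].
Qed.

Lemma cintZ a b (k : C) g : icont a b g ->
  cint a b (fun t => k * g t) = k * cint a b g.
Proof.
move=> cg; rewrite /cint; case: k => x y.
have iR := icont_Re cg; have iI := icont_Im cg.
rewrite [RHS](_ : _ = Complex (x * \int[mu]_(t in `[a, b]) Re (g t) -
  y * \int[mu]_(t in `[a, b]) Im (g t)) (x * \int[mu]_(t in `[a, b]) Im (g t) +
  y * \int[mu]_(t in `[a, b]) Re (g t))) //.
have iZ (f : R -> R) (r : R) : mu.-integrable `[a, b] (EFin \o f) ->
  mu.-integrable `[a, b] (EFin \o (fun t => r * f t)).
  by move=> fi; apply: (integrableZl (mu := mu) _ r fi); exact: measurable_itv.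
rewrite -!RintegralZl // -RintegralB // -?RintegralD //; try exact: iZ.
by congr Complex; apply: eq_Rintegral => t _; case: (g t).
Qed.

Lemma eq_cint a b g1 g2 : (forall t, a <= t -> t <= b -> g1 t = g2 t) ->
  cint a b g1 = cint a b g2.
Proof.
move=> H; congr Complex; apply: eq_Rintegral => t;
  by rewrite inE /= in_itv /= => /andP[ta tb]; rewrite H.
Qed.

Lemma fine_lebesgue_itv a b : a <= b -> fine (mu `[a, b]%classic) = b - a.
Proof.
move=> ab; rewrite lebesgue_measure_itv /= lte_fin; case: ltP => // ba.
by apply/eqP; rewrite eq_sym subr_eq0 eq_le ab ba.
Qed.

Lemma cint_cst a b k : a <= b -> cint a b (fun=> k) = Complex (b - a) 0 * k.
Proof.
move=> ab; rewrite /cint !Rintegral_cst // !fine_lebesgue_itv //.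
case: k => x y /=; rewrite [RHS](_ : _ = Complex ((b - a) * x - 0 * y) ((b - a) * y + 0 * x)) //.
by rewrite !mul0r subr0 addr0 ![_ * (b - a)]mulrC.
Qed.

(** The factor 2 is the price of bounding the real and the imaginary part separately. *)
Lemma cabs_cint a b g : icont a b g ->
  cabs (cint a b g) <= 2 * \int[mu]_(t in `[a, b]) cabs (g t).
Proof.
move=> cg; apply: le_trans (cabs_le_ReIm _) _ => /=.
have ic := icont_cabs cg.
have iR := icont_Re cg; have iI := icont_Im cg.
rewrite mulrDl mul1r; apply: lerD.
- apply: le_trans (le_normr_Rintegral _ iR) _ => //.
  apply: le_Rintegral => //; last by move=> t _; exact: cabs_Re.
  exact: integrable_norm iR.
- apply: le_trans (le_normr_Rintegral _ iI) _ => //.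
  apply: le_Rintegral => //; last by move=> t _; exact: cabs_Im.
  exact: integrable_norm iI.
Qed.

Lemma Rint_le a b (f : R -> R) (M : R) : a <= b ->
  mu.-integrable `[a, b] (EFin \o f) ->
  (forall t, a <= t -> t <= b -> f t <= M) -> \int[mu]_(t in `[a, b]) f t <= M * (b - a).
Proof.
move=> ab fi H; rewrite -fine_lebesgue_itv // -Rintegral_cst //.
apply: le_Rintegral => //; last first.
  by move=> t /=; rewrite in_itv /= => /andP[ta tb]; exact: H.
by apply: continuous_compact_integrable; [exact: segment_compact
  | apply: continuous_subspaceT => x; exact: cvg_cst].
Qed.

Lemma Rint_ge a b (f : R -> R) (M : R) : a <= b ->
  mu.-integrable `[a, b] (EFin \o f) ->
  (forall t, a <= t -> t <= b -> M <= f t) -> M * (b - a) <= \int[mu]_(t in `[a, b]) f t.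
Proof.
move=> ab fi H; rewrite -fine_lebesgue_itv // -Rintegral_cst //.
apply: le_Rintegral => //; last first.
  by move=> t /=; rewrite in_itv /= => /andP[ta tb]; exact: H.
by apply: continuous_compact_integrable; [exact: segment_compact
  | apply: continuous_subspaceT => x; exact: cvg_cst].
Qed.

Lemma cabs_cint_le a b g M : a <= b -> icont a b g ->
  (forall t, a <= t -> t <= b -> cabs (g t) <= M) ->
  cabs (cint a b g) <= 2 * (M * (b - a)).
Proof.
move=> ab cg H; apply: le_trans (cabs_cint cg) _; rewrite ler_pM2l //.
exact: (Rint_le ab (icont_cabs cg)).
Qed.

End IntervalIntegral.

(** * Compactness of rectangles by repeated quartering *)

Section Bisection.
Variable R : realType.

Lemma half_powS (L : R) n : L / 2 ^+ n.+1 = L / 2 ^+ n / 2.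
Proof. by rewrite exprS invfM mulrCA mulrC. Qed.

Lemma nested_point (a : nat -> R) (L : R) : 0 <= L ->
  (forall n, a n <= a n.+1) ->
  (forall n, a n.+1 <= a n + L / 2 ^+ n.+1) ->
  exists x, forall n, a n <= x <= a n + L / 2 ^+ n.
Proof.
move=> L0 up lo.
have down n : a n.+1 + L / 2 ^+ n.+1 <= a n + L / 2 ^+ n.
  have -> : L / 2 ^+ n = L / 2 ^+ n.+1 + L / 2 ^+ n.+1.
    by rewrite half_powS -splitr.
  by rewrite addrA lerD2r.
have mono m n : (m <= n)%N -> a m <= a n.
  by have /nondecreasing_seqP := up; apply.
have anti m n : (m <= n)%N -> a n + L / 2 ^+ n <= a m + L / 2 ^+ m.
  by have /nonincreasing_seqP := down; apply.
have pos n : 0 <= L / 2 ^+ n by rewrite divr_ge0 // exprn_ge0.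
have cross m n : a m <= a n + L / 2 ^+ n.
  have [mn|nm] := leqP m n.
    by apply: le_trans (mono _ _ mn) _; rewrite lerDl.
  by apply: le_trans (anti _ _ (ltnW nm)); rewrite lerDl.
have hs : has_sup (range a).
  by split; [exists (a 0%N); exists 0%N | exists (a 0%N + L / 2 ^+ 0) => _ [m _ <-]].
exists (sup (range a)) => n; apply/andP; split.
  by apply: sup_upper_bound => //; exists n.
apply: ge_sup; first by exists (a 0%N); exists 0%N.
by move=> _ [m _ <-].
Qed.

(** If [P] failed, it would fail on one of the four quarters, again and again; the nested bad
    rectangles shrink to a point at which the local hypothesis is contradicted. Both Goursat's lemma
    and the boundedness of continuous functions on squares rest on this. *)
Lemma bisection (P : R -> R -> R -> R -> Prop) (a b c d : R) :
  a <= b -> c <= d ->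
  (forall a' b' c' d', a' <= b' -> c' <= d' ->
     let m := (a' + b') / 2 in let k := (c' + d') / 2 in
     a <= a' -> b' <= b -> c <= c' -> d' <= d ->
     P a' m c' k -> P m b' c' k -> P a' m k d' -> P m b' k d' -> P a' b' c' d') ->
  (forall x y, a <= x -> x <= b -> c <= y -> y <= d ->
     exists2 e : R, 0 < e & forall a' b' c' d', a <= a' -> b' <= b -> c <= c' -> d' <= d ->
       a' <= x -> x <= b' -> c' <= y -> y <= d' -> (b' - a') + (d' - c') < e ->
       P a' b' c' d') ->
  P a b c d.
Proof.
move=> ab cd Hadd Hloc; apply: contrapT => notP.
pose L := b - a; pose H := d - c.
have L0 : 0 <= L by rewrite subr_ge0.
have H0 : 0 <= H by rewrite subr_ge0.
have pw n : 0 <= L / 2 ^+ n by rewrite divr_ge0 // exprn_ge0.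
have pw' n : 0 <= H / 2 ^+ n by rewrite divr_ge0 // exprn_ge0.
pose bad n (p : R * R) := [/\ a <= p.1, p.1 + L / 2 ^+ n <= b, c <= p.2,
  p.2 + H / 2 ^+ n <= d & ~ P p.1 (p.1 + L / 2 ^+ n) p.2 (p.2 + H / 2 ^+ n)].
(* The implication stands inside the existential so that choice yields a total function; away from
   bad rectangles its value is arbitrary. *)
have step (np : nat * (R * R)) : exists p' : R * R, bad np.1 np.2 ->
  [/\ bad np.1.+1 p', np.2.1 <= p'.1 <= np.2.1 + L / 2 ^+ np.1.+1 &
      np.2.2 <= p'.2 <= np.2.2 + H / 2 ^+ np.1.+1].
  case: np => n p /=.
  have [[h1 h2 h3 h4 nP]|nb] := pselect (bad n p); last by exists p => /nb.
  apply: contrapT => /forallNP all; apply: nP.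
  set l := L / 2 ^+ n.+1; set h := H / 2 ^+ n.+1.
  have l0 : 0 <= l := pw n.+1.
  have h0 : 0 <= h := pw' n.+1.
  have el : L / 2 ^+ n = l + l by rewrite /l half_powS -splitr.
  have eh : H / 2 ^+ n = h + h by rewrite /h half_powS -splitr.
  rewrite el in h2 *; rewrite eh in h4 *.
  have sub x y : p.1 <= x <= p.1 + l -> p.2 <= y <= p.2 + h -> P x (x + l) y (y + h).
    move=> xx yy; apply: contrapT => nP; apply: (all (x, y)) => _; split => //=.
    move: xx yy => /andP[? ?] /andP[? ?].
    by split => //=; rewrite -?/l -?/h; lra.
  have e1 : (p.1 + (p.1 + (l + l))) / 2 = p.1 + l by field.
  have e2 : (p.2 + (p.2 + (h + h))) / 2 = p.2 + h by field.
  apply: Hadd => //; rewrite ?e1 ?e2; try lra.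
  - by apply: sub; rewrite !lexx lerDl ?l0 ?h0.
  - by rewrite addrA; apply: sub; rewrite !lexx lerDl ?l0 ?h0.
  - by rewrite [p.2 + (h + h)]addrA; apply: sub; rewrite !lexx lerDl ?l0 ?h0.
  - by rewrite !addrA; apply: sub; rewrite !lexx lerDl ?l0 ?h0.
have /choice[F HF] := step.
pose q := fix q n := if n is m.+1 then F (m, q m) else (a, c).
have badq n : bad n (q n).
  elim: n => [|n IH]; last by have [] := HF (n, q n) IH.
  by rewrite /bad /= !expr0 !divr1 /L /H !subrKC; split.
have sq n := HF (n, q n) (badq n).
have [x Hx] : exists x, forall n, (q n).1 <= x <= (q n).1 + L / 2 ^+ n.
  by apply: (nested_point (a := fun n => (q n).1)) => // n;
    have [_ /andP[]] := sq n.
have [y Hy] : exists y, forall n, (q n).2 <= y <= (q n).2 + H / 2 ^+ n.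
  by apply: (nested_point (a := fun n => (q n).2)) => // n;
    have [_ _ /andP[]] := sq n.
have [e e0 He] : exists2 e : R, 0 < e & forall a' b' c' d', a <= a' -> b' <= b -> c <= c' -> d' <= d ->
       a' <= x -> x <= b' -> c' <= y -> y <= d' -> (b' - a') + (d' - c') < e ->
       P a' b' c' d'.
  have := Hx 0%N; have := Hy 0%N; rewrite /= !expr0 !divr1 /L /H !subrKC.
  by move=> /andP[? ?] /andP[? ?]; apply: Hloc.
have LH0 : 0 <= (L + H) / e by apply: divr_ge0; [exact: addr_ge0 | exact: ltW].
have [n nL] : exists n : nat, (L + H) / 2 ^+ n < e.
  exists (Num.bound ((L + H) / e)); rewrite ltr_pdivrMr ?exprn_gt0 // mulrC.
  rewrite -ltr_pdivrMr //; apply: lt_trans (archi_boundP LH0) _.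
  by rewrite -natrX ltr_nat ltn_expl.
have [h1 h2 h3 h4 nP] := badq n.
have /andP[x1 x2] := Hx n; have /andP[y1 y2] := Hy n.
apply: nP; apply: He => //.
by rewrite ![_ + _ - _]addrAC !subrr !add0r -mulrDl.
Qed.

End Bisection.

(** * Contour integrals over rectangles and Goursat's lemma *)

Section Rectangles.
Variable R : realType.
Local Notation C := R[i].
Implicit Types (f g : C -> C) (a b c d : R).

(** The counterclockwise contour integral: bottom minus top, plus i times right minus left. *)
Definition rint f a b c d : C :=
  cint a b (fun x => f (Complex x c) - f (Complex x d)) +
  Complex 0 1 * cint c d (fun y => f (Complex b y) - f (Complex a y)).

Definition bcont f a b c d := [/\ icont a b (fun x => f (Complex x c)),
  icont a b (fun x => f (Complex x d)), icont c d (fun y => f (Complex a y)) &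
  icont c d (fun y => f (Complex b y))].

Definition rcont f a b c d := forall x y, a <= x -> x <= b -> c <= y -> y <= d ->
  ccont f (Complex x y).

Lemma ccont_icontx f a b y :
  (forall x, a <= x -> x <= b -> ccont f (Complex x y)) ->
  icont a b (fun x => f (Complex x y)).
Proof.
move=> H x xa xb e e0; have [d d0 Hd] := H _ xa xb _ e0; exists d => // s sd.
by have := Hd (Complex s 0); rewrite cabs_real => /(_ sd);
  rewrite [_ + Complex s 0](_ : _ = Complex (x + s) (y + 0)) // addr0.
Qed.

Lemma cabs_imag (s : R) : cabs (Complex 0 s) = `|s|.
Proof. by rewrite /cabs /= expr0n /= add0r sqrtr_sqr. Qed.

Lemma ccont_iconty f c d x :
  (forall y, c <= y -> y <= d -> ccont f (Complex x y)) ->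
  icont c d (fun y => f (Complex x y)).
Proof.
move=> H y yc yd e e0; have [r r0 Hr] := H _ yc yd _ e0; exists r => // s sd.
by have := Hr (Complex 0 s); rewrite cabs_imag => /(_ sd);
  rewrite [_ + Complex 0 s](_ : _ = Complex (x + 0) (y + s)) // addr0.
Qed.

Lemma rcont_bcont f a b c d : a <= b -> c <= d -> rcont f a b c d -> bcont f a b c d.
Proof.
move=> ab cd H; split; [apply: ccont_icontx| apply: ccont_icontx | apply: ccont_iconty
  | apply: ccont_iconty] => x x1 x2; exact: H.
Qed.

Lemma rcontS f a b c d a' b' c' d' : a <= a' -> b' <= b -> c <= c' -> d' <= d ->
  rcont f a b c d -> rcont f a' b' c' d'.
Proof.
move=> aa bb cc dd H x y x1 x2 y1 y2; apply: H.
- exact: le_trans x1.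
- exact: le_trans bb.
- exact: le_trans y1.
- exact: le_trans dd.
Qed.

Lemma rint_splitx f a m b c d : a <= m -> m <= b -> c <= d -> bcont f a b c d ->
  icont c d (fun y => f (Complex m y)) ->
  rint f a b c d = rint f a m c d + rint f m b c d.
Proof.
move=> am mb cd [h1 h2 h3 h4] hm.
rewrite /rint (cint_split am mb (icontB h1 h2)).
rewrite addrACA; congr (_ + _); rewrite -mulrDr; congr (_ * _).
rewrite -cintD; try exact: icontB.
by apply: eq_cint => t _ _; ring.
Qed.

Lemma rint_splity f a b c m d : a <= b -> c <= m -> m <= d -> bcont f a b c d ->
  icont a b (fun x => f (Complex x m)) ->
  rint f a b c d = rint f a b c m + rint f a b m d.
Proof.
move=> ab cm md [h1 h2 h3 h4] hm.
rewrite /rint (cint_split cm md (icontB h4 h3)).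
rewrite addrACA mulrDr; congr (_ + _).
rewrite -cintD; try exact: icontB.
by apply: eq_cint => t _ _; ring.
Qed.

Lemma rintD f g a b c d : bcont f a b c d -> bcont g a b c d ->
  rint (fun z => f z + g z) a b c d = rint f a b c d + rint g a b c d.
Proof.
move=> [f1 f2 f3 f4] [g1 g2 g3 g4]; rewrite /rint.
rewrite addrACA -cintD -?mulrDr -?cintD; try exact: icontB.
by congr (_ + _ * _); apply: eq_cint => t _ _; ring.
Qed.

Lemma rintZ f (k : C) a b c d : bcont f a b c d ->
  rint (fun z => k * f z) a b c d = k * rint f a b c d.
Proof.
move=> [f1 f2 f3 f4]; rewrite /rint mulrDr [k * (Complex 0 1 * _)]mulrCA.
rewrite -[k * cint a b _]cintZ -?[k * cint c d _]cintZ; try exact: icontB.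
by congr (_ + _ * _); apply: eq_cint => t _ _; rewrite mulrBr.
Qed.

Lemma bcontD f g a b c d : bcont f a b c d -> bcont g a b c d ->
  bcont (fun z => f z + g z) a b c d.
Proof. by move=> [? ? ? ?] [? ? ? ?]; split; exact: icontD. Qed.

Lemma bcontZ k f a b c d : bcont f a b c d -> bcont (fun z => k * f z) a b c d.
Proof. by move=> [? ? ? ?]; split; exact: icontZ. Qed.

Lemma rintB f g a b c d : bcont f a b c d -> bcont g a b c d ->
  rint (fun z => f z - g z) a b c d = rint f a b c d - rint g a b c d.
Proof.
move=> bf bg; rewrite -[- rint g a b c d]mulN1r -rintZ // -rintD //; last exact: bcontZ.
by congr (rint _ a b c d); apply/funext => z; rewrite mulN1r.
Qed.

Definition onbd a b c d (z : C) := [/\ a <= Re z, Re z <= b, c <= Im z, Im z <= d &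
  (Re z = a \/ Re z = b) \/ (Im z = c \/ Im z = d)].

(** Opposite sides are paired, so each integrand is at most [2 * M]; [cabs_cint_le] contributes the
    other factor 2. *)
Lemma rint_le f a b c d (M : R) : a <= b -> c <= d -> bcont f a b c d ->
  (forall z, onbd a b c d z -> cabs (f z) <= M) ->
  cabs (rint f a b c d) <= 4 * (M * ((b - a) + (d - c))).
Proof.
move=> ab cd [h1 h2 h3 h4] H; rewrite /rint.
apply: le_trans (cabsD _ _) _; rewrite cabsM cabs_imag normr1 mul1r [M * (_ + _)]mulrDr [4 * _]mulrDr.
have h x y : cabs x <= M -> cabs y <= M -> cabs (x - y) <= M * 2.
  by move=> hx hy; apply: le_trans (cabsD _ _) _; rewrite cabsN mulrDr mulr1 lerD.
have e r : 4 * (M * r) = 2 * (M * 2 * r) by ring.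
rewrite !e.
by apply: lerD; apply: cabs_cint_le => //; try exact: icontB; move=> t t1 t2;
  apply: h; apply: H; split => //=; auto.
Qed.

Lemma rint_affine (k l : C) a b c d : a <= b -> c <= d ->
  rint (fun z => k + l * z) a b c d = 0.
Proof.
move=> ab cd; rewrite /rint.
rewrite (eq_cint (g2 := fun=> l * Complex 0 (c - d))); last first.
  move=> t _ _; rewrite [k + _]addrC addrKA -mulrBr.
  by rewrite [_ - _](_ : _ = Complex (t - t) (c - d)) // subrr.
rewrite [X in _ + _ * X](eq_cint (g2 := fun=> l * Complex (b - a) 0)); last first.
  move=> t _ _; rewrite [k + _]addrC addrKA -mulrBr.
  by rewrite [_ - _](_ : _ = Complex (b - a) (t - t)) // subrr.
rewrite !cint_cst //; case: l => x y.
apply/eqP; rewrite eq_complex /=; apply/andP; split; apply/eqP; ring.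
Qed.

(** Subtracting the affine tangent at [z], whose contour integral vanishes, leaves an integrand of
    size at most [e / 4] times the half-perimeter. The constant 4 of [rint_le] and the length of the
    contour do the rest. *)
Lemma goursat_local f (z l : C) a b c d (e : R) :
  0 < e -> rcont f a b c d -> cdiff f z l ->
  exists2 r : R, 0 < r & forall a' b' c' d', a <= a' -> b' <= b -> c <= c' -> d' <= d ->
   a' <= Re z -> Re z <= b' -> c' <= Im z -> Im z <= d' -> (b' - a') + (d' - c') < r ->
   cabs (rint f a' b' c' d') <= e * ((b' - a') + (d' - c')) ^+ 2.
Proof.
move=> e0 fc df; have e4 : 0 < e / 4 by rewrite divr_gt0.
have [r r0 H] := df _ e4; exists r => // a' b' c' d' aa bb cc dd xa xb yc yd.
set s := _ + _ => sr.
have ab : a' <= b' := le_trans xa xb.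
have cd : c' <= d' := le_trans yc yd.
have fc' := rcont_bcont ab cd (rcontS aa bb cc dd fc).
pose T w := f z - l * z + l * w.
have cT : bcont T a' b' c' d'.
  apply: rcont_bcont => // x y *; apply: cdiff_ccont.
  exact: (cdiffD (cdiff_cst _ _) (cdiffM (cdiff_cst l _) (cdiff_id _))).
have -> : rint f a' b' c' d' = rint (fun w => f w - T w) a' b' c' d'.
  by rewrite rintB // [X in _ - X](_ : _ = 0) ?subr0 // rint_affine.
have -> : e * s ^+ 2 = 4 * (e / 4 * s * s) by field.
apply: rint_le => //.
  have := bcontD fc' (bcontZ (-1) cT).
  by congr bcont; apply/funext => w; rewrite mulN1r.
move=> w [w1 w2 w3 w4 _].
have ws : cabs (w - z) <= s.
  apply: le_trans (cabs_le_ReIm _) _; case: w w1 w2 w3 w4 => x y /= w1 w2 w3 w4.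
  case: z {df H T cT} xa xb yc yd => x0 y0 /= xa xb yc yd.
  by rewrite lerD // ler_norml; apply/andP; split; lra.
have := H (w - z) (le_lt_trans ws sr); rewrite [z + _]addrC subrK => H1.
have -> : f w - T w = f w - f z - l * (w - z) by rewrite /T; ring.
by apply: le_trans H1 _; rewrite ler_wpM2l // ltW.
Qed.

Lemma goursat f a b c d : a <= b -> c <= d ->
  (forall x y, a <= x -> x <= b -> c <= y -> y <= d ->
     exists l, cdiff f (Complex x y) l) ->
  rint f a b c d = 0.
Proof.
move=> ab cd df.
have fc : rcont f a b c d.
  by move=> x y xa xb yc yd; have [l dl] := df _ _ xa xb yc yd; exact: cdiff_ccont dl.
apply/eqP; rewrite -cabs_eq0 eq_le cabs_ge0 andbT.
apply/ler_addgt0Pl => e0 e0_gt0; rewrite addr0.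
pose S := ((b - a) + (d - c)) ^+ 2 + 1.
have S0 : 0 < S by rewrite ltr_wpDl // sqr_ge0.
pose e := e0 / S; have e_gt0 : 0 < e by rewrite divr_gt0.
suff : cabs (rint f a b c d) <= e * ((b - a) + (d - c)) ^+ 2.
  move=> h; apply: le_trans h _; rewrite /e mulrAC ler_pdivrMr // ler_wpM2l ?(ltW e0_gt0) //.
  by rewrite /S lerDl.
(* Quartering halves the half-perimeter [s], and four times [e * (s / 2) ^+ 2] is [e * s ^+ 2]: the
   square is what makes [P] pass from the quarters to the whole. *)
pose P a b c d := cabs (rint f a b c d) <= e * ((b - a) + (d - c)) ^+ 2.
apply: (@bisection _ P) => // [a' b' c' d' ab' cd' m k a1 b1 c1 d1|x y xa xb yc yd].
  have [am mb] : a' <= m /\ m <= b' by rewrite /m; split; lra.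
  have [ck kd] : c' <= k /\ k <= d' by rewrite /k; split; lra.
  have fc' := rcontS a1 b1 c1 d1 fc.
  rewrite /P (rint_splitx am mb cd' (rcont_bcont ab' cd' fc')); last first.
    by apply: ccont_iconty => y *; exact: fc'.
  have fL : rcont f a' m c' d' by apply: rcontS fc'.
  have fR : rcont f m b' c' d' by apply: rcontS fc'.
  rewrite (rint_splity am ck kd (rcont_bcont am cd' fL)); last first.
    by apply: ccont_icontx => x *; exact: fL.
  rewrite (rint_splity mb ck kd (rcont_bcont mb cd' fR)); last first.
    by apply: ccont_icontx => x *; exact: fR.
  move=> p1 p2 p3 p4.
  apply: le_trans (cabsD _ _) _; apply: le_trans (lerD (cabsD _ _) (cabsD _ _)) _.
  apply: le_trans (lerD (lerD p1 p3) (lerD p2 p4)) _.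
  by rewrite /m /k le_eqVlt; apply/orP; left; apply/eqP; field.
have [l dl] := df _ _ xa xb yc yd.
exact: (goursat_local e_gt0 fc dl).
Qed.

End Rectangles.

(** * Exceptional points and the winding integral *)

Section CauchyRectangle.
Variable R : realType.
Local Notation C := R[i].
Implicit Types (f g psi : C -> C) (a b c d x y r : R).

Lemma cdiff_bcont f a b c d : a <= b -> c <= d ->
  (forall z, onbd a b c d z -> exists l, cdiff f z l) -> bcont f a b c d.
Proof.
move=> ab cd H.
have cf x y : onbd a b c d (Complex x y) -> ccont f (Complex x y).
  by move=> /H[l]; exact: cdiff_ccont.
by split; [apply: ccont_icontx| apply: ccont_icontx | apply: ccont_iconty
  | apply: ccont_iconty] => t t1 t2; apply: cf; split => //=; auto.
Qed.

(** Four rectangles that avoid the exceptional point are cut away by Goursat. On the remaining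
    square of half-side [e] the integrand is at most [e0 / 16 / e], the half-perimeter is [4 * e],
    and [rint_le] gives [e0]. *)
Lemma rint_exc g a b c d (x0 y0 : R) : a < x0 -> x0 < b -> c < y0 -> y0 < d ->
  (forall x y, a <= x -> x <= b -> c <= y -> y <= d ->
     Complex x y != Complex x0 y0 -> exists l, cdiff g (Complex x y) l) ->
  (forall e : R, 0 < e -> exists2 r : R, 0 < r & forall h, h != 0 -> cabs h < r ->
     cabs h * cabs (g (Complex x0 y0 + h)) <= e) ->
  rint g a b c d = 0.
Proof.
move=> ax xb cy yd dg lim0.
apply/eqP; rewrite -cabs_eq0 eq_le cabs_ge0 andbT.
apply/ler_addgt0Pl => e0 e0_gt0; rewrite addr0.
have e16 : 0 < e0 / 16 by rewrite divr_gt0.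
have [r r0 H] := lim0 _ e16.
(* On the boundary of the small square the distance to the exceptional point is at most [2 * e],
   hence below [r]. *)
pose e := Num.min (r / 3) (Num.min (Num.min (x0 - a) (b - x0)) (Num.min (y0 - c) (d - y0))).
have e_gt0 : 0 < e by rewrite !lt_min divr_gt0 ?subr_gt0 ?ax ?xb ?cy.
have er : e <= r / 3 by rewrite ge_min lexx.
have ea : e <= x0 - a by rewrite !ge_min lexx !orbT.
have eb : e <= b - x0 by rewrite !ge_min lexx !orbT.
have ec : e <= y0 - c by rewrite !ge_min lexx !orbT.
have ed : e <= d - y0 by rewrite !ge_min lexx !orbT.
clearbody e.
have ne x y : x != x0 \/ y != y0 -> Complex x y != Complex x0 y0.
  by rewrite eq_complex /= negb_and => -[->|->] //; rewrite orbT.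
have cx x y : a <= x -> x <= b -> c <= y -> y <= d -> x != x0 \/ y != y0 -> ccont g (Complex x y).
  by move=> h1 h2 h3 h4 /ne h5; have [l] := dg x y h1 h2 h3 h4 h5; exact: cdiff_ccont.
have zero a' b' c' d' : a <= a' -> b' <= b -> c <= c' -> d' <= d -> a' <= b' -> c' <= d' ->
  (forall x y, a' <= x -> x <= b' -> c' <= y -> y <= d' -> x != x0 \/ y != y0) ->
  rint g a' b' c' d' = 0.
  move=> h1 h2 h3 h4 h5 h6 H0; apply: goursat => // x y k1 k2 k3 k4; apply: dg.
  - exact: le_trans k1.
  - exact: le_trans h2.
  - exact: le_trans k3.
  - exact: le_trans h4.
  - exact/ne/H0.
have bc a' b' c' d' : a <= a' -> b' <= b -> c <= c' -> d' <= d -> a' < x0 -> x0 < b' ->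
   c' < y0 -> y0 < d' -> bcont g a' b' c' d'.
  move=> h1 h2 h3 h4 h5 h6 h7 h8.
  have k1 := le_trans h1 (ltW (lt_trans h5 h6)).
  have k2 := le_trans (ltW (lt_trans h5 h6)) h2.
  have k3 := le_trans h3 (ltW (lt_trans h7 h8)).
  have k4 := le_trans (ltW (lt_trans h7 h8)) h4.
  split; [apply: ccont_icontx| apply: ccont_icontx | apply: ccont_iconty
  | apply: ccont_iconty] => t t1 t2; apply: cx => //;
    try solve [exact: le_trans t1 | exact: le_trans h2 | exact: le_trans h4].
  - by right; rewrite lt_eqF.
  - by right; rewrite gt_eqF.
  - by left; rewrite lt_eqF.
  - by left; rewrite gt_eqF.
have vert x : a <= x -> x <= b -> x != x0 -> icont c d (fun y => g (Complex x y)).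
  by move=> *; apply: ccont_iconty => y *; apply: cx => //; left.
have horz y : c <= y -> y <= d -> y != y0 ->
    icont (x0 - e) (x0 + e) (fun x => g (Complex x y)).
  move=> h1 h2 h3; apply: ccont_icontx => x k1 k2; apply: cx => //; last by right.
  - by apply: le_trans k1; rewrite lerBrDr -lerBrDl.
  - by apply: le_trans k2 _; rewrite -lerBrDl.
have xm : x0 - e != x0 by rewrite lt_eqF // ltrBlDr ltrDl.
have xp : x0 + e != x0 by rewrite gt_eqF // ltrDl.
have ym : y0 - e != y0 by rewrite lt_eqF // ltrBlDr ltrDl.
have yp : y0 + e != y0 by rewrite gt_eqF // ltrDl.
have l1 : a <= x0 - e by lra.
have l2 : x0 - e <= x0 + e by lra.
have l3 : x0 + e <= b by lra.
have l4 : c <= y0 - e by lra.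
have l5 : y0 - e <= y0 + e by lra.
have l6 : y0 + e <= d by lra.
have l7 : x0 - e < x0 by lra.
have l8 : x0 < x0 + e by lra.
have l9 : y0 - e < y0 by lra.
have l10 : y0 < y0 + e by lra.
have l11 : x0 - e <= b := le_trans l2 l3.
have l12 : a <= x0 + e := le_trans l1 l2.
have l13 : y0 - e <= d := le_trans l5 l6.
have l14 : c <= y0 + e := le_trans l4 l5.
have cd : c <= d := le_trans l4 l13.
have -> : rint g a b c d = rint g (x0 - e) (x0 + e) (y0 - e) (y0 + e).
  rewrite (rint_splitx l1 l11 cd (bc _ _ _ _ _ _ _ _ _ _ _ _) (vert _ l1 l11 xm)) //.
  rewrite zero ?add0r //; last first.
    by move=> x y _ h _ _; left; rewrite lt_eqF // (le_lt_trans h).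
  rewrite (rint_splitx l2 l3 cd (bc _ _ _ _ _ _ _ _ _ _ _ _) (vert _ l12 l3 xp)) //.
  rewrite [X in _ + X]zero ?addr0 //; last first.
    by move=> x y h _ _ _; left; rewrite gt_eqF // (lt_le_trans _ h).
  rewrite (rint_splity l2 l4 l13 (bc _ _ _ _ _ _ _ _ _ _ _ _) (horz _ l4 l13 ym)) //.
  rewrite zero ?add0r //; last first.
    by move=> x y _ _ _ h; right; rewrite lt_eqF // (le_lt_trans h).
  rewrite (rint_splity l2 l5 l6 (bc _ _ _ _ _ _ _ _ _ _ _ _) (horz _ l14 l6 yp)) //.
  rewrite [X in _ + X]zero ?addr0 //.
  by move=> x y _ _ h _; right; rewrite gt_eqF // (lt_le_trans _ h).
have -> : e0 = 4 * (e0 / 16 / e * (x0 + e - (x0 - e) + (y0 + e - (y0 - e)))).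
  by field; rewrite gt_eqF.
apply: rint_le => //; first exact: bc.
move=> z [z1 z2 z3 z4 zb].
pose h := z - Complex x0 y0.
have Reh : Re h = Re z - x0 by rewrite /h; case: (z).
have Imh : Im h = Im z - y0 by rewrite /h; case: (z).
have lo x : e <= `|x - e - x| by rewrite addrAC subrr sub0r normrN ler_norm.
have hi x : e <= `|x + e - x| by rewrite addrAC subrr add0r ler_norm.
have eh : e <= cabs h.
  by case: zb => -[E|E]; [apply: le_trans (cabs_Re _); rewrite Reh E
    | apply: le_trans (cabs_Re _); rewrite Reh E
    | apply: le_trans (cabs_Im _); rewrite Imh E
    | apply: le_trans (cabs_Im _); rewrite Imh E].
have h0 : h != 0 by rewrite -cabs_gt0; apply: lt_le_trans eh.
have hr : cabs h < r.
  apply: le_lt_trans (cabs_le_ReIm _) _; rewrite Reh Imh.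
  have k1 : `|Re z - x0| <= e by rewrite ler_distl z1.
  have k2 : `|Im z - y0| <= e by rewrite ler_distl z3.
  apply: le_lt_trans (lerD k1 k2) _; move: er e_gt0; clear; lra.
have := H _ h0 hr; rewrite [_ + h](_ : _ = z); last by rewrite /h addrC subrK.
move=> H1; rewrite ler_pdivlMr // mulrC; apply: le_trans H1.
by rewrite ler_wpM2r // cabs_ge0.
Qed.

Lemma ReB (z w : C) : Re (z - w) = Re z - Re w.
Proof. by case: z w => [? ?] [? ?]. Qed.

Lemma ImB (z w : C) : Im (z - w) = Im z - Im w.
Proof. by case: z w => [? ?] [? ?]. Qed.

Lemma Re_inv (x y : R) : Re (Complex x y)^-1 = x / (x ^+ 2 + y ^+ 2).
Proof. by []. Qed.

Lemma Im_inv (x y : R) : Im (Complex x y)^-1 = - (y / (x ^+ 2 + y ^+ 2)).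
Proof. by []. Qed.

(** Each side may lie anywhere between distance [r] and [2 * r] from the centre. This freedom allows
    [mean_L1] to choose the sides by averaging, with constants that depend on [r] alone. *)
Definition square_like (x0 y0 : R) r a b c d :=
  [/\ 0 < r, r <= x0 - a <= 2 * r, r <= b - x0 <= 2 * r, r <= y0 - c <= 2 * r &
      r <= d - y0 <= 2 * r].

Lemma onbd_dist (x0 y0 : R) r a b c d z : square_like x0 y0 r a b c d -> onbd a b c d z ->
  r <= cabs (z - Complex x0 y0).
Proof.
move=> [r0 /andP[? ?] /andP[? ?] /andP[? ?] /andP[? ?]] [? ? ? ? zb].
have Reh : Re (z - Complex x0 y0) = Re z - x0 by case: (z).
have Imh : Im (z - Complex x0 y0) = Im z - y0 by case: (z).
case: zb => -[E|E].
- by apply: le_trans (cabs_Re _); rewrite Reh E ler_normr; apply/orP; right; lra.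
- by apply: le_trans (cabs_Re _); rewrite Reh E ler_normr; apply/orP; left; lra.
- by apply: le_trans (cabs_Im _); rewrite Imh E ler_normr; apply/orP; right; lra.
- by apply: le_trans (cabs_Im _); rewrite Imh E ler_normr; apply/orP; left; lra.
Qed.

Lemma square_like_le (x0 y0 : R) r a b c d : square_like x0 y0 r a b c d ->
  [/\ a < x0, x0 < b, c < y0 & y0 < d].
Proof. by move=> [r0 /andP[? ?] /andP[? ?] /andP[? ?] /andP[? ?]]; split; lra. Qed.

Lemma cdiff_shiftV z0 z n : z != z0 -> cdiff (fun w : C => (w - z0) ^- n) z
  (- (n%:R * (z - z0) ^+ n.-1) / ((z - z0) ^+ n) ^+ 2).
Proof.
move=> zz.
have dB : cdiff (fun w : C => w - z0) z 1.
  by have := cdiffB (cdiff_id z) (cdiff_cst z0 z); rewrite subr0.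
have := cdiffV _ (cdiffX n dB); rewrite mulr1; apply.
by rewrite expf_neq0 // subr_eq0.
Qed.

Lemma bcont_shiftV (x0 y0 : R) r a b c d n : square_like x0 y0 r a b c d ->
  bcont (fun w : C => (w - Complex x0 y0) ^- n) a b c d.
Proof.
move=> sq; have [? ? ? ?] := square_like_le sq.
apply: cdiff_bcont; try lra; move=> z /(onbd_dist sq) h.
eexists; apply: cdiff_shiftV; rewrite -subr_eq0 -cabs_gt0.
by apply: lt_le_trans h; case: sq.
Qed.

(** A lower bound in the role of the value 2 pi i. In the imaginary part the horizontal sides
    contribute a nonnegative amount, the vertical ones at least [(8 * r)^-1] per unit of a length of
    at least [2 * r]. *)
Lemma rint_inv_ge (x0 y0 : R) r a b c d : square_like x0 y0 r a b c d ->
  1 / 4 <= cabs (rint (fun w => (w - Complex x0 y0)^-1) a b c d).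
Proof.
move=> sq; have [ax xb cy yd] := square_like_le sq.
have bc := bcont_shiftV 1 sq.
have [ab cd] : a <= b /\ c <= d by split; lra.
have [h1 h2 h3 h4] := bc.
apply: le_trans (cabs_Im _); apply: le_trans (ler_norm _).
rewrite /rint; set F := cint a b _; set G := cint c d _.
have -> : Im (F + Complex 0 1 * G) = Im F + Re G.
  by case: F G => [? ?] [? ?] /=; ring.
have F0 : 0 * (b - a) <= Im F.
  apply: Rint_ge => //; first exact: (icont_Im (icontB h1 h2)).
  move=> t t1 t2.
  have -> : (Complex t c - Complex x0 y0)^-1 - (Complex t d - Complex x0 y0)^-1 =
    (Complex (t - x0) (c - y0))^-1 - (Complex (t - x0) (d - y0))^-1 by [].
  rewrite ImB !Im_inv opprK -mulNr opprB.
  rewrite addr_ge0 // divr_ge0 //; try lra; by rewrite addr_ge0 ?sqr_ge0.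
case: sq => r0 /andP[? ?] /andP[? ?] /andP[? ?] /andP[? ?].
have G0 : (8 * r)^-1 * (d - c) <= Re G.
  apply: Rint_ge => //; first exact: (icont_Re (icontB h4 h3)).
  move=> t t1 t2.
  have -> : (Complex b t - Complex x0 y0)^-1 - (Complex a t - Complex x0 y0)^-1 =
    (Complex (b - x0) (t - y0))^-1 - (Complex (a - x0) (t - y0))^-1 by [].
  rewrite ReB !Re_inv -mulNr opprB.
  have t3 : `|t - y0| <= 2 * r by rewrite ler_norml; apply/andP; split; lra.
  have t4 : (t - y0) ^+ 2 <= 4 * r ^+ 2.
    by rewrite -(real_normK (num_real (t - y0))) (_ : 4 * r ^+ 2 = (2 * r) ^+ 2);
      [rewrite ler_pXn2r // nnegrE; lra | ring].
  have t5 : (b - x0) ^+ 2 <= 4 * r ^+ 2.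
    by rewrite (_ : 4 * r ^+ 2 = (2 * r) ^+ 2); [rewrite ler_pXn2r // nnegrE; lra | ring].
  have s0 : 0 < (b - x0) ^+ 2 + (t - y0) ^+ 2.
    by rewrite ltr_pwDl ?sqr_ge0 // exprn_gt0; lra.
  rewrite -[leLHS]addr0; apply: lerD; last first.
    by rewrite divr_ge0 //; [lra | rewrite addr_ge0 ?sqr_ge0].
  rewrite ler_pdivlMr // ler_pdivrMl; last by lra.
  apply: (@le_trans _ _ (8 * r ^+ 2)); first lra.
  by rewrite expr2 mulrA ler_wpM2l; lra.
suff : 1 / 4 <= (8 * r)^-1 * (d - c) by lra.
by rewrite [_^-1 * _]mulrC ler_pdivlMr; lra.
Qed.

End CauchyRectangle.

(** * Cauchy formulas, their estimates, and differentiability of the derivative *)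

Section CauchyFormulas.
Variable R : realType.
Local Notation C := R[i].
Local Notation mu := (@lebesgue_measure R).
Implicit Types (f g psi : C -> C) (a b c d x y r : R).

Lemma bcontB f g a b c d : bcont f a b c d -> bcont g a b c d ->
  bcont (fun z => f z - g z) a b c d.
Proof. by move=> [? ? ? ?] [? ? ? ?]; split; exact: icontB. Qed.

Definition holo_rect f a b c d := forall x y, a <= x -> x <= b -> c <= y -> y <= d ->
  exists l, cdiff f (Complex x y) l.

Definition inside (z : C) a b c d := [/\ a < Re z, Re z < b, c < Im z & Im z < d].

Lemma inside_le z a b c d : inside z a b c d -> a <= b /\ c <= d.
Proof. by move=> [? ? ? ?]; split; apply: ltW;
  [apply: lt_trans (Re z) _ _ _ _| apply: lt_trans (Im z) _ _ _ _]. Qed.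

Lemma onbd_neq z w a b c d : inside z a b c d -> onbd a b c d w -> w != z.
Proof.
move=> [h1 h2 h3 h4] [_ _ _ _ wb]; apply/eqP => E; move: h1 h2 h3 h4; rewrite -E.
by case: wb => -[->|->]; rewrite ltxx.
Qed.

Lemma bcont_shiftV' z a b c d n : inside z a b c d ->
  bcont (fun w : C => (w - z) ^- n) a b c d.
Proof.
move=> zi; have [ab cd] := inside_le zi.
apply: cdiff_bcont => // w /(onbd_neq zi) wz; eexists; exact: cdiff_shiftV.
Qed.

Lemma holo_rect_bd f a b c d z : holo_rect f a b c d -> onbd a b c d z ->
  exists l, cdiff f z l.
Proof. by case: z => x y H [*]; exact: H. Qed.

Lemma bcont_holoV f z a b c d n : inside z a b c d -> holo_rect f a b c d ->
  bcont (fun w => f w * (w - z) ^- n) a b c d.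
Proof.
move=> zi hf; have [ab cd] := inside_le zi.
apply: cdiff_bcont => // w wb; have [l dl] := holo_rect_bd hf wb.
eexists; apply: (cdiffM dl (cdiff_shiftV _ _)); exact: onbd_neq zi wb.
Qed.

Lemma bcont_holo f z a b c d : inside z a b c d -> holo_rect f a b c d ->
  bcont f a b c d.
Proof.
move=> zi hf; have [ab cd] := inside_le zi.
by apply: cdiff_bcont => // w wb; exact: holo_rect_bd hf wb.
Qed.

Lemma complexK (z : C) : Complex (Re z) (Im z) = z.
Proof. by case: z. Qed.

(** By continuity of [f], the function [(f w - f z) / (w - z)] is admissible for [rint_exc]. The
    winding integral stays as a factor. *)
Lemma cauchy1 f z a b c d : inside z a b c d -> holo_rect f a b c d ->
  f z * rint (fun w => (w - z)^-1) a b c d = rint (fun w => f w * (w - z)^-1) a b c d.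
Proof.
move=> zi hf; have [ab cd] := inside_le zi.
have b1 := bcont_shiftV' 1 zi; have b2 := bcont_holoV 1 zi hf.
apply/eqP; rewrite eq_sym -subr_eq0 -rintZ // -rintB //; last exact: bcontZ.
case: (zi) => h1 h2 h3 h4; apply/eqP.
apply: (@rint_exc _ _ _ _ _ _ (Re z) (Im z)) => //.
  move=> x y xa xb yc yd; rewrite complexK => xyz.
  have [l dl] := hf x y xa xb yc yd; eexists.
  apply: (cdiffB (cdiffM dl (cdiff_shiftV 1 xyz)) (cdiffM (cdiff_cst _ _) (cdiff_shiftV 1 xyz))).
move=> e e0; have [l dl] := hf _ _ (ltW h1) (ltW h2) (ltW h3) (ltW h4).
have [r r0 H] := cdiff_ccont dl e0; rewrite complexK in H *.
exists r => // h h0 /H /ltW H1.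
by rewrite addrAC subrr add0r -mulrBl mulrC cabsM cabsV -mulrA mulVf ?mulr1 // cabs_eq0.
Qed.

(** One order higher: by differentiability, [(f w - f z - l * (w - z)) / (w - z) ^+ 2] is o(1 / |w -
    z|), which is what [rint_exc] asks for. *)
Lemma cauchy2 f z l a b c d : inside z a b c d -> holo_rect f a b c d -> cdiff f z l ->
  l * rint (fun w => (w - z)^-1) a b c d = rint (fun w => f w * (w - z) ^- 2) a b c d -
    f z * rint (fun w => (w - z) ^- 2) a b c d.
Proof.
move=> zi hf dl; have [ab cd] := inside_le zi.
have b1 := bcont_shiftV' 1 zi; have b2 := bcont_holoV 2 zi hf.
have b3 := bcont_shiftV' 2 zi.
apply/eqP; rewrite eq_sym -subr_eq0 -!rintZ // -!rintB //; try exact: bcontZ; last first.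
  exact: (bcontB b2 (bcontZ _ b3)).
case: (zi) => h1 h2 h3 h4; apply/eqP.
apply: (@rint_exc _ _ _ _ _ _ (Re z) (Im z)) => //.
  move=> x y xa xb yc yd; rewrite complexK => xyz.
  have [m dm] := hf x y xa xb yc yd; eexists.
  apply: (cdiffB (cdiffB (cdiffM dm (cdiff_shiftV 2 xyz)) (cdiffM (cdiff_cst _ _) (cdiff_shiftV 2
    xyz))) (cdiffM (cdiff_cst _ _) (cdiff_shiftV 1 xyz))).
move=> e e0; have [r r0 H] := dl _ e0; rewrite complexK.
exists r => // h h0 /H H1.
rewrite [z + h - z]addrAC subrr add0r.
have -> : f (z + h) * h ^- 2 - f z * h ^- 2 - l * h^-1 = (f (z + h) - f z - l * h) / h ^+ 2.
  by field.
rewrite cabsM cabsV cabsX.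
have ch : cabs h != 0 by rewrite cabs_eq0.
rewrite (_ : _ * _ = cabs (f (z + h) - f z - l * h) / cabs h); last by field.
by rewrite ler_pdivrMr // lt_def ch cabs_ge0.
Qed.

Definition bnorm f a b c d : R :=
  \int[mu]_(x in `[a, b]) cabs (f (Complex x c)) +
  \int[mu]_(x in `[a, b]) cabs (f (Complex x d)) +
  (\int[mu]_(y in `[c, d]) cabs (f (Complex a y)) +
  \int[mu]_(y in `[c, d]) cabs (f (Complex b y))).

Lemma bnorm_ge0 f a b c d : 0 <= bnorm f a b c d.
Proof. by rewrite !addr_ge0 //; apply: Rintegral_ge0 => t _; exact: cabs_ge0. Qed.

Lemma cabs_cintB_le (g1 g2 p1 p2 : R -> C) a b (K : R) : 0 <= K ->
  icont a b g1 -> icont a b g2 -> icont a b p1 -> icont a b p2 ->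
  (forall t, a <= t -> t <= b -> cabs (g1 t) <= K * cabs (p1 t)) ->
  (forall t, a <= t -> t <= b -> cabs (g2 t) <= K * cabs (p2 t)) ->
  cabs (cint a b (fun t => g1 t - g2 t)) <=
  2 * K * (\int[mu]_(t in `[a, b]) cabs (p1 t) + \int[mu]_(t in `[a, b]) cabs (p2 t)).
Proof.
move=> K0 c1 c2 d1 d2 H1 H2; apply: le_trans (cabs_cint (icontB c1 c2)) _.
have i1 := icont_cabs d1; have i2 := icont_cabs d2.
rewrite -mulrA ler_pM2l //.
rewrite -RintegralD // -RintegralZl //; last first.
  exact: (integrableD _ i1 i2).
apply: le_Rintegral => //; first exact: (icont_cabs (icontB c1 c2)).
  by apply: (integrableZl (mu := mu) _ K (integrableD (mu := mu) _ i1 i2)); exact: measurable_itv.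
move=> t /=; rewrite in_itv /= => /andP[ta tb].
by apply: le_trans (cabsD _ _) _; rewrite cabsN mulrDr lerD ?H1 ?H2.
Qed.

Lemma rint_bnorm f psi a b c d (K : R) : a <= b -> c <= d -> 0 <= K ->
  bcont f a b c d -> bcont psi a b c d ->
  (forall z, onbd a b c d z -> cabs (f z) <= K * cabs (psi z)) ->
  cabs (rint f a b c d) <= 2 * K * bnorm psi a b c d.
Proof.
move=> ab cd K0 [f1 f2 f3 f4] [p1 p2 p3 p4] H; rewrite /rint /bnorm mulrDr.
apply: le_trans (cabsD _ _) _; rewrite cabsM cabs_imag normr1 mul1r.
apply: lerD; first by apply: cabs_cintB_le => // t t1 t2; apply: H; split => //=; auto.
rewrite [X in 2 * K * X]addrC.
by apply: cabs_cintB_le => // t t1 t2; apply: H; split => //=; auto.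
Qed.

Lemma square_inside (x0 y0 : R) r a b c d : square_like x0 y0 r a b c d ->
  inside (Complex x0 y0) a b c d.
Proof. by move=> /square_like_le. Qed.

(** In [cauchy1] the right-hand side is at most [2 / r] times the boundary norm, and the winding
    factor is at least 1/4. *)
Lemma cauchy_L1 f (x0 y0 : R) r a b c d : square_like x0 y0 r a b c d ->
  holo_rect f a b c d ->
  cabs (f (Complex x0 y0)) <= 8 / r * bnorm f a b c d.
Proof.
move=> sq hf; have zi := square_inside sq; have [ab cd] := inside_le zi.
have r0 : 0 < r by case: sq.
have H : cabs (f (Complex x0 y0) * rint (fun w => (w - Complex x0 y0)^-1) a b c d) <=
   2 * r^-1 * bnorm f a b c d.
  rewrite (cauchy1 zi hf); apply: rint_bnorm => //.
  - by rewrite invr_ge0 ltW.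
  - exact: (bcont_holoV 1 zi hf).
  - exact: bcont_holo zi hf.
  - move=> z /(onbd_dist sq) h; rewrite cabsM cabsV mulrC ler_wpM2r ?cabs_ge0 //.
    by rewrite lef_pV2 // posrE; apply: lt_le_trans h.
have := rint_inv_ge sq; move: H; rewrite cabsM; set I := cabs (rint _ _ _ _ _) => H HI.
have : cabs (f (Complex x0 y0)) * (1 / 4) <= 2 * r^-1 * bnorm f a b c d.
  by apply: le_trans H; rewrite ler_wpM2l ?cabs_ge0.
lra.
Qed.

(** The right-hand side of [cauchy2] is at most [64 * (M / r)]; dividing by the winding factor costs
    another 4. The bound at the centre is used for the term with [f z]. *)
Lemma cauchy_deriv f (x0 y0 : R) l r a b c d (M : R) : square_like x0 y0 r a b c d ->
  holo_rect f a b c d -> cdiff f (Complex x0 y0) l ->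
  (forall z, onbd a b c d z -> cabs (f z) <= M) -> cabs (f (Complex x0 y0)) <= M ->
  cabs l <= 256 * (M / r).
Proof.
move=> sq hf dl HM HM0; have zi := square_inside sq; have [ab cd] := inside_le zi.
have r0 : 0 < r by case: sq.
have M0 : 0 <= M by apply: le_trans HM0; exact: cabs_ge0.
have b2 := bcont_holoV 2 zi hf; have b3 := bcont_shiftV' 2 zi.
have H : cabs (l * rint (fun w => (w - Complex x0 y0)^-1) a b c d) <=
   4 * (2 * M / r ^+ 2 * (8 * r)).
  rewrite (cauchy2 zi hf dl) -rintZ // -rintB //; last exact: bcontZ.
  apply: (@le_trans _ _ (4 * (2 * M / r ^+ 2 * (b - a + (d - c))))); last first.
    rewrite ler_pM2l // ler_wpM2l //.
      by rewrite divr_ge0 ?mulr_ge0 ?exprn_ge0 // ltW.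
    by case: sq => _ /andP[? ?] /andP[? ?] /andP[? ?] /andP[? ?]; lra.
  apply: rint_le => //.
    exact: (bcontB b2 (bcontZ _ b3)).
  move=> z zb; have h := onbd_dist sq zb.
  rewrite -mulrBl cabsM cabsV cabsX; apply: ler_pM; rewrite ?cabs_ge0 ?invr_ge0 ?exprn_ge0 ?cabs_ge0 //.
    apply: le_trans (cabsD _ _) _; rewrite cabsN mulrDl mul1r; apply: lerD => //.
    exact: HM.
  by rewrite lef_pV2 ?posrE ?exprn_gt0 // ?(lt_le_trans r0 h) // ler_pXn2r // nnegrE ?cabs_ge0 // ltW.
have := rint_inv_ge sq; move: H; rewrite cabsM; set I := cabs (rint _ _ _ _ _) => H HI.
have : cabs l * (1 / 4) <= 4 * (2 * M / r ^+ 2 * (8 * r)).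
  by apply: le_trans H; rewrite ler_wpM2l ?cabs_ge0.
have -> : 4 * (2 * M / r ^+ 2 * (8 * r)) = 64 * (M / r) by field; rewrite gt_eqF.
lra.
Qed.

Lemma quadratic_cdiff (F : C -> C) z l (K r : R) : 0 < r -> 0 <= K ->
  (forall h, cabs h < r -> cabs (F (z + h) - F z - l * h) <= K * cabs h ^+ 2) ->
  cdiff F z l.
Proof.
move=> r0 K0 H e e0; have K1 : 0 < K + 1 by rewrite ltr_wpDl.
exists (Num.min r (e / (K + 1))); first by rewrite lt_min r0 divr_gt0.
move=> h; rewrite lt_min ltr_pdivlMr // => /andP[/H h1 h2].
apply: le_trans h1 _; rewrite expr2 mulrA ler_wpM2r ?cabs_ge0 //.
by rewrite mulrC; apply: le_trans (ltW h2); rewrite ler_wpM2l ?cabs_ge0 // lerDl.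
Qed.

Lemma inside_near (x0 y0 : R) r a b c d h : square_like x0 y0 r a b c d ->
  cabs h < r / 2 -> inside (Complex x0 y0 + h) a b c d.
Proof.
move=> [r0 /andP[? ?] /andP[? ?] /andP[? ?] /andP[? ?]] hr.
have := le_lt_trans (cabs_Re h) hr; have := le_lt_trans (cabs_Im h) hr.
rewrite !ltr_norml; case: h {hr} => u v /= /andP[? ?] /andP[? ?].
by split => /=; lra.
Qed.

(** Differentiation under the integral sign: on the contour the first-order remainder of each kernel
    is [h ^+ 2] times a bounded factor, so [quadratic_cdiff] applies. *)
Lemma transform_cdiff psi (x0 y0 : R) r a b c d : square_like x0 y0 r a b c d ->
  holo_rect psi a b c d ->
  (exists l, cdiff (fun zeta => rint (fun w => psi w * (w - zeta)^-1) a b c d) (Complex x0 y0) l) /\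
  (exists l, cdiff (fun zeta => rint (fun w => psi w * (w - zeta) ^- 2) a b c d) (Complex x0 y0) l).
Proof.
move=> sq hp; have zi := square_inside sq; have [ab cd] := inside_le zi.
set z := Complex x0 y0 in zi *.
have r0 : 0 < r by case: sq.
have r2 : 0 < r / 2 by rewrite divr_gt0.
have bV zeta n := @bcont_holoV psi zeta a b c d n.
have bp := bcont_holo zi hp.
have N0 := bnorm_ge0 psi a b c d.
have vh w h : onbd a b c d w -> cabs h < r / 2 ->
  [/\ w - z != 0, w - (z + h) != 0, r <= cabs (w - z) & r / 2 <= cabs (w - (z + h))].
  move=> /(onbd_dist sq) h1 h2.
  have h3 : r / 2 <= cabs (w - (z + h)).
    have := cabs_le_sub (w - z) (w - (z + h)).
    by rewrite (_ : w - z - (w - (z + h)) = h); [move: h1; rewrite -/z; lra | ring].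
  by split => //; rewrite -cabs_gt0; [exact: lt_le_trans h1 | exact: lt_le_trans h3].
have inv_le (s t : R) n : 0 < s -> s <= t -> t ^- n <= s ^- n.
  move=> s0 st; have t0 := lt_le_trans s0 st.
  by rewrite lef_pV2 ?posrE ?exprn_gt0 // lerXn2r // nnegrE ltW.
split.
- exists (rint (fun w => psi w * (w - z) ^- 2) a b c d).
  apply: (quadratic_cdiff (K := 2 * (r ^- 2 * (r / 2)^-1) * bnorm psi a b c d) r2).
    by rewrite mulr_ge0 // mulr_ge0 // mulr_ge0 // invr_ge0 ?exprn_ge0 // ltW.
  move=> h hr; have zih := inside_near sq hr; rewrite -/z in zih.
  have b1 := bV _ 1%N zih hp; have b2 := bV _ 1%N zi hp; have b3 := bV _ 2%N zi hp.
  have b4 := bcontZ h b3; have b5 := bcontB b1 b2.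
  rewrite [rint _ _ _ _ _ * h]mulrC -(rintZ h b3) -(rintB b1 b2) -(rintB b5 b4).
  rewrite (_ : _ * cabs h ^+ 2 = 2 * (r ^- 2 * (r / 2)^-1 * cabs h ^+ 2) * bnorm psi a b c d);
    last by ring.
  apply: rint_bnorm => //.
  + by rewrite mulr_ge0 ?sqr_ge0 // mulr_ge0 // invr_ge0 ?exprn_ge0 // ltW.
  + exact: (bcontB b5 b4).
  + move=> w wb; have [n1 n2 l1 l2] := vh _ _ wb hr.
    rewrite (_ : _ - _ - _ = h ^+ 2 * ((w - z) ^- 2 * (w - (z + h))^-1) * psi w); last first.
      by field; rewrite n1 n2.
    rewrite !cabsM !cabsV !cabsX ler_wpM2r ?cabs_ge0 //.
    rewrite mulrC ler_wpM2r ?sqr_ge0 //; apply: ler_pM.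
    * by rewrite invr_ge0 exprn_ge0 ?cabs_ge0.
    * by rewrite invr_ge0 cabs_ge0.
    * exact: inv_le.
    * exact: (inv_le _ _ 1%N).
- exists (rint (fun w => (2 * psi w) * (w - z) ^- 3) a b c d).
  apply: (quadratic_cdiff (K := 2 * (4 * (r ^- 2 * (r / 2) ^- 2)) * bnorm psi a b c d) r2).
    by rewrite mulr_ge0 // mulr_ge0 // mulr_ge0 // mulr_ge0 // invr_ge0 ?exprn_ge0 // ltW.
  move=> h hr; have zih := inside_near sq hr; rewrite -/z in zih.
  have hp2 : holo_rect (fun w => 2 * psi w) a b c d.
    move=> x y xa xb yc yd; have [l dl] := hp x y xa xb yc yd; eexists.
    exact: (cdiffM (cdiff_cst _ _) dl).
  have b1 := bV _ 2%N zih hp; have b2 := bV _ 2%N zi hp.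
  have b3 := bcont_holoV 3 zi hp2.
  have b4 := bcontZ h b3; have b5 := bcontB b1 b2.
  rewrite [rint _ _ _ _ _ * h]mulrC -(rintZ h b3) -(rintB b1 b2) -(rintB b5 b4).
  rewrite (_ : _ * cabs h ^+ 2 = 2 * (4 * (r ^- 2 * (r / 2) ^- 2) * cabs h ^+ 2) * bnorm psi a b c
    d); last by ring.
  apply: rint_bnorm => //.
  + by rewrite mulr_ge0 ?sqr_ge0 // mulr_ge0 // mulr_ge0 // invr_ge0 ?exprn_ge0 // ltW.
  + exact: (bcontB b5 b4).
  + move=> w wb; have [n1 n2 l1 l2] := vh _ _ wb hr.
    rewrite (_ : _ - _ - _ = h ^+ 2 * ((3 * (w - z) - 2 * h) / (w - z) * ((w - z) ^- 2 * (w - (z +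
      h)) ^- 2)) * psi w); last first.
      by field; rewrite n1 n2.
    rewrite !cabsM !cabsV !cabsX ler_wpM2r ?cabs_ge0 //.
    rewrite [leLHS]mulrC ler_wpM2r ?sqr_ge0 //; apply: ler_pM.
    * by rewrite mulr_ge0 ?invr_ge0 ?cabs_ge0.
    * by rewrite mulr_ge0 // invr_ge0 ?exprn_ge0 ?cabs_ge0.
    * rewrite ler_pdivrMr; last exact: lt_le_trans l1.
      apply: le_trans (cabsD _ _) _; rewrite cabsN !cabsM.
      have nat k : cabs (k%:R : C) <= k%:R.
        elim: k => [|k IH]; first by rewrite cabs0.
        by rewrite -!natr1; apply: le_trans (cabsD _ _) _; rewrite cabs1 lerD2r.
      have := ler_wpM2r (cabs_ge0 (w - z)) (nat 3%N).
      have := ler_wpM2r (cabs_ge0 h) (nat 2%N).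
      move: hr l1; clear; lra.
    * apply: ler_pM; rewrite ?invr_ge0 ?exprn_ge0 ?cabs_ge0 //; exact: inv_le.
Qed.

Lemma holo_rect_cst k a b c d : holo_rect (fun=> k) a b c d.
Proof. by move=> *; exists 0; exact: cdiff_cst. Qed.

(** Near the centre [cauchy2] writes the derivative as [(H w - f w * D w) / I w]. The transforms
    [I], [D] and [H] are differentiable at the centre, and [I] does not vanish nearby because of
    [rint_inv_ge]. *)
Lemma deriv_cdiff f (df : C -> C) (x0 y0 : R) r a b c d : square_like x0 y0 r a b c d ->
  holo_rect f a b c d ->
  (forall h, cabs h < r / 2 -> cdiff f (Complex x0 y0 + h) (df (Complex x0 y0 + h))) ->
  exists l, cdiff df (Complex x0 y0) l.
Proof.
move=> sq hf Hd; have zi := square_inside sq; have [ab cd] := inside_le zi.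
set z := Complex x0 y0 in zi Hd *.
have r0 : 0 < r by case: sq.
have r2 : 0 < r / 2 by rewrite divr_gt0.
(* The factor 1 is the constant density to which [transform_cdiff] is applied. *)
pose I zeta := rint (fun w => 1 * (w - zeta)^-1) a b c d.
pose D zeta := rint (fun w => 1 * (w - zeta) ^- 2) a b c d.
pose H zeta := rint (fun w => f w * (w - zeta) ^- 2) a b c d.
have [[lI dI] [lD dD]] := transform_cdiff sq (holo_rect_cst 1 (a:=a) (b:=b) (c:=c) (d:=d)).
have [_ [lH dH]] := transform_cdiff sq hf.
have I0 : I z != 0.
  rewrite -cabs_gt0; apply: (@lt_le_trans _ _ (1 / 4)); first by rewrite divr_gt0.
  by rewrite /I; under eq_fun do rewrite mul1r; exact: rint_inv_ge sq.
have df0 := Hd 0; rewrite cabs0 addr0 in df0.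
have [s s0 Hs] := ccont_neq0 (cdiff_ccont dI) I0.
pose F w := (H w - f w * D w) * (I w)^-1.
suff [l dl] : exists l, cdiff F z l.
  exists l; apply: (cdiff_near (d := Num.min s (r / 2))) dl; first by rewrite lt_min s0.
  move=> h; rewrite lt_min => /andP[/Hs nI hr].
  have := cauchy2 (inside_near sq hr) hf (Hd _ hr); rewrite -/z /F.
  rewrite (_ : rint (fun w => (w - (z + h))^-1) a b c d = I (z + h)); last first.
    by rewrite /I; under [in RHS]eq_fun do rewrite mul1r.
  rewrite (_ : rint (fun w => (w - (z + h)) ^- 2) a b c d = D (z + h)); last first.
    by rewrite /D; under [in RHS]eq_fun do rewrite mul1r.
  by rewrite -/(H (z + h)) => <-; rewrite mulfK.
eexists; exact: (cdiffM (cdiffB dH (cdiffM (df0 r2) dD)) (cdiffV I0 dI)).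
Qed.

End CauchyFormulas.

(** * Measurability of open sets and continuous functions in the plane *)

Section PlaneMeasurability.
Variable R : realType.

Definition open2 (U : set (R * R)) := forall x, U x -> exists2 e : R, 0 < e &
  forall y : R * R, `|y.1 - x.1| < e -> `|y.2 - x.2| < e -> U y.

Lemma near_rat (x e : R) : 0 < e -> exists p : rat, `|x - ratr p| < e.
Proof.
move=> e0; have /rat_in_itvoo[p] : x - e < x + e by rewrite ltrBlDr -addrA ltrDl addr_gt0.
by rewrite in_itv /= => h; exists p; rewrite distrC ltr_distl.
Qed.

Lemma small_inv (e : R) : 0 < e -> exists k : nat, k.+1%:R^-1 < e.
Proof.
move=> e0; exists (Num.bound e^-1); rewrite invf_plt ?posrE //.
apply: lt_le_trans (archi_boundP _) _; first by rewrite invr_ge0 ltW.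
by rewrite ler_nat.
Qed.

(** An open set is the union of the countably many rational squares that it contains. *)
Lemma open2_measurable (U : set (R * R)) : open2 U -> measurable U.
Proof.
move=> oU.
pose Q (i : rat * rat * nat) : set (R * R) :=
  (`](ratr i.1.1 - i.2.+1%:R^-1), (ratr i.1.1 + i.2.+1%:R^-1)[%classic : set R) `*`
  (`](ratr i.1.2 - i.2.+1%:R^-1), (ratr i.1.2 + i.2.+1%:R^-1)[%classic : set R).
have -> : U = \bigcup_i (if `[< Q i `<=` U >] then Q i else set0).
  apply/seteqP; split => [x Ux|x [i _]]; last by case: asboolP => // h /h.
  have [e e0 He] := oU x Ux.
  have [k ke] := small_inv (divr_gt0 e0 (ltr0n R 2)).
  have k0 : (0 : R) < k.+1%:R^-1 by rewrite invr_gt0.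
  have [p1 h1] := near_rat x.1 k0; have [p2 h2] := near_rat x.2 k0.
  exists (p1, p2, k) => //; case: asboolP => [_|[]].
    by split; rewrite /= in_itv /= -ltr_distl.
  move=> y [/=]; rewrite !in_itv /= -!ltr_distl => h3 h4; apply: He.
  - apply: le_lt_trans (ler_distD (ratr p1) _ _) _; rewrite [ltRHS]splitr.
    by apply: ltrD; [apply: lt_trans ke | rewrite distrC; apply: lt_trans ke].
  - apply: le_lt_trans (ler_distD (ratr p2) _ _) _; rewrite [ltRHS]splitr.
    by apply: ltrD; [apply: lt_trans ke | rewrite distrC; apply: lt_trans ke].
apply: countable_bigcupT_measurable; first exact: countableP.
move=> i; case: ifP => // _; apply: measurableX; exact: measurable_itv.
Qed.

Definition cont2 (D : set (R * R)) (F : R * R -> R) := forall x, D x ->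
  forall e : R, 0 < e -> exists2 d : R, 0 < d &
  forall y : R * R, `|y.1 - x.1| < d -> `|y.2 - x.2| < d -> `|F y - F x| < e.

Lemma cont2_measurable D F : open2 D -> cont2 D F -> measurable_fun D F.
Proof.
move=> oD cF mD; apply: (measurability _ (RGenOInfty.measurableE R)) => //.
move=> _ [_ [a ->] <-]; apply: open2_measurable => x [Dx] /=.
rewrite in_itv /= andbT => ax.
have [e e0 He] := oD x Dx.
have aF : 0 < F x - a by rewrite subr_gt0.
have [d d0 Hd] := cF x Dx _ aF.
exists (Num.min e d); first by rewrite lt_min e0.
move=> y; rewrite !lt_min => /andP[e1 d1] /andP[e2 d2]; split; first exact: He.
rewrite /= in_itv /= andbT.
by have := Hd y d1 d2; rewrite ltr_distl => /andP[]; rewrite opprB addrC subrK.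
Qed.

End PlaneMeasurability.

(** * Holomorphic functions on the disc and Cauchy estimates *)

Section HolomorphicDisc.
Variable R : realType.
Local Notation C := R[i].
Implicit Types (f g : C -> C) (z w : C).

Lemma discE z : disc z = (cabs z < 1) :> Prop. Proof. by []. Qed.

Lemma disc_ball z w : cabs (w - z) < 1 - cabs z -> disc w.
Proof.
by move=> h; rewrite discE; apply: le_lt_trans (cabs_le_sub w z) _; rewrite -ltrBrDl.
Qed.

Lemma holo_cdiff f z : holo f -> disc z -> cdiff f z (cderiv 1 f z).
Proof. by move=> hf dz; exact/derivable_cdiff/hf. Qed.

Lemma cdiff_cderiv1 f z l : cdiff f z l -> cderiv 1 f z = l.
Proof. by move=> /cdiff_derivable[]. Qed.

Lemma cderivS k f : cderiv k.+1 f = cderiv 1 (cderiv k f).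
Proof. by []. Qed.

Lemma holo_of_cdiff f : (forall z, disc z -> exists l, cdiff f z l) -> holo f.
Proof. by move=> H z /H[l] /cdiff_derivable[]. Qed.

Lemma square_like_std (x0 y0 r : R) : 0 < r ->
  square_like x0 y0 r (x0 - r) (x0 + r) (y0 - r) (y0 + r).
Proof. by move=> r0; split => //; apply/andP; split; lra. Qed.

Lemma square_ball (x0 y0 r x y : R) : x0 - r <= x -> x <= x0 + r -> y0 - r <= y ->
  y <= y0 + r -> cabs (Complex x y - Complex x0 y0) <= 2 * r.
Proof.
move=> h1 h2 h3 h4; apply: le_trans (cabs_le_ReIm _) _ => /=.
rewrite -[2]/(1 + 1) mulrDl mul1r; apply: lerD; by rewrite ler_distl ?h1 ?h3.
Qed.

Lemma holo_rect_square f (x0 y0 r : R) : holo f ->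
  2 * r < 1 - cabs (Complex x0 y0) ->
  holo_rect f (x0 - r) (x0 + r) (y0 - r) (y0 + r).
Proof.
move=> hf hr x y h1 h2 h3 h4; eexists; apply: holo_cdiff => //.
apply: (@disc_ball (Complex x0 y0)); apply: le_lt_trans hr; exact: square_ball.
Qed.

Lemma holo_deriv f : holo f -> holo (cderiv 1 f).
Proof.
move=> hf; apply: holo_of_cdiff => -[x0 y0]; rewrite discE => dz.
pose r := (1 - cabs (Complex x0 y0)) / 4.
have r0 : 0 < r by rewrite divr_gt0 // subr_gt0.
have r1 : 2 * r < 1 - cabs (Complex x0 y0) by rewrite /r; move: r0; rewrite /r; lra.
apply: (deriv_cdiff (square_like_std x0 y0 r0) (holo_rect_square hf r1)) => h hh.
apply: holo_cdiff => //; apply: (@disc_ball (Complex x0 y0)).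
by rewrite addrAC subrr add0r; apply: lt_trans r1; move: hh r0; lra.
Qed.

Lemma holo_cderiv f k : holo f -> holo (cderiv k f).
Proof. by move=> hf; elim: k => [|k IH]; [exact: hf | exact: (holo_deriv IH)]. Qed.

Lemma cderiv_cdiff f k z : holo f -> disc z -> cdiff (cderiv k f) z (cderiv k.+1 f z).
Proof. by move=> hf dz; exact: (holo_cdiff (holo_cderiv (k := k) hf) dz). Qed.

(** Each differentiation costs 256 from [cauchy_deriv] and 4 from the half-side [r / 4], together
    [2 ^+ 10]; the factor [2 ^+ j] pays for using the bound of order [j] with radius [r / 2]. *)
Fixpoint cauchy_const (k : nat) : R :=
  if k is j.+1 then 2 ^+ (10 + j) * cauchy_const j else 1.

Lemma cauchy_constS j : cauchy_const j.+1 = 2 ^+ (10 + j) * cauchy_const j.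
Proof. by []. Qed.

Lemma cauchy_const_gt0 k : 0 < cauchy_const k.
Proof.
elim: k => [|k IH]; first exact: ltr01.
by rewrite cauchy_constS mulr_gt0 ?exprn_gt0.
Qed.

Lemma cauchy_estimate k f z (r M : R) : holo f -> 0 < r -> r < 1 - cabs z ->
  (forall w, cabs (w - z) <= r -> cabs (f w) <= M) ->
  cabs (cderiv k f z) <= cauchy_const k / r ^+ k * M.
Proof.
move=> hf; elim: k z r => [|k IH] z r r0 rz HM.
  by rewrite expr0 divr1 mul1r; apply: HM; rewrite subrr cabs0 ltW.
have dz : disc z by apply: (@disc_ball z); rewrite subrr cabs0; apply: lt_trans rz.
have r2 : 0 < r / 2 by rewrite divr_gt0.
have r4 : 0 < r / 4 by rewrite divr_gt0.
pose M' := cauchy_const k / (r / 2) ^+ k * M.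
have HM' w : cabs (w - z) <= r / 2 -> cabs (cderiv k f w) <= M'.
  move=> wz; apply: IH => //.
    by have := cabs_le_sub w z; move: r0 rz wz; lra.
  move=> v vw; apply: HM.
  have -> : v - z = (v - w) + (w - z) by ring.
  by apply: le_trans (cabsD _ _) _; rewrite [r]splitr lerD.
case: z dz rz HM HM' => x0 y0 dz rz HM HM'.
have rz4 : 2 * (r / 4) < 1 - cabs (Complex x0 y0) by move: r0 rz; lra.
have e2 : 2 * (r / 4) = r / 2 by field.
have := @cauchy_deriv _ _ _ _ _ _ _ _ _ _ M' (square_like_std x0 y0 r4)
  (holo_rect_square (holo_cderiv (k := k) hf) rz4) (cderiv_cdiff k hf dz).
have -> : cauchy_const k.+1 / r ^+ k.+1 * M = 256 * (M' / (r / 4)).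
  rewrite /M' cauchy_constS exprD exprMn exprVn [r ^+ k.+1]exprS.
  have -> : 2 ^+ 10 = 4 * 256 :> R by rewrite -!natrX -natrM.
  by field; rewrite (gt_eqF r0) !expf_neq0 ?gt_eqF.
apply.
  case=> x y [/= h1 h2 h3 h4 _]; apply: HM'; rewrite -e2; exact: square_ball.
by apply: HM'; rewrite subrr cabs0 ltW.
Qed.

Lemma toC_lip (x y : R * R) : cabs (toC y - toC x) <= `|y.1 - x.1| + `|y.2 - x.2|.
Proof. exact: (cabs_le_ReIm (toC y - toC x)). Qed.

Lemma open2_discR2 : open2 (@discR2 R).
Proof.
move=> x dx; have d0 : 0 < 1 - cabs (toC x) by rewrite subr_gt0.
exists ((1 - cabs (toC x)) / 2); first by rewrite divr_gt0.
move=> y h1 h2; apply: (@disc_ball (toC x)).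
by apply: le_lt_trans (toC_lip _ _) _; rewrite [ltRHS]splitr ltrD.
Qed.

Lemma measurable_discR2 : measurable (@discR2 R).
Proof. by apply: open2_measurable; exact: open2_discR2. Qed.

Lemma ccont_cont2 f : (forall z, disc z -> ccont f z) ->
  cont2 (@discR2 R) (fun x => cabs (f (toC x))).
Proof.
move=> H x dx e e0; have [d d0 Hd] := H _ dx _ e0.
exists (d / 2); first by rewrite divr_gt0.
move=> y h1 h2; apply: le_lt_trans (cabs_lip _ _) _.
have := Hd (toC y - toC x); rewrite [toC x + _]addrC subrK; apply.
by apply: le_lt_trans (toC_lip _ _) _; rewrite [ltRHS]splitr ltrD.
Qed.

Lemma measurable_cabs f : (forall z, disc z -> ccont f z) ->
  measurable_fun (@discR2 R) (fun x => cabs (f (toC x))).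
Proof. by move=> /ccont_cont2; apply: cont2_measurable; exact: open2_discR2. Qed.

Lemma holo_ccont f z : holo f -> disc z -> ccont f z.
Proof. by move=> hf dz; exact: cdiff_ccont (holo_cdiff hf dz). Qed.

End HolomorphicDisc.

(** * The mean value estimate for the integral of [|f|] *)

Section SubMeanValue.
Variable R : realType.
Local Notation C := R[i].
Local Notation mu := (@lebesgue_measure R).
Implicit Types (f g : C -> C) (z w : C) (F : R * R -> R).

(** The measure [leb2] together with its measure structure. *)
Definition leb2m := [the {measure set _ -> \bar R} of (mu \x mu)%E].

Definition sq2 (z : R * R) (r : R) : set (R * R) :=
  (`[z.1 - r, z.1 + r]%classic : set R) `*` (`[z.2 - r, z.2 + r]%classic : set R).

Lemma sq2P (z x : R * R) r : sq2 z r x <-> `|x.1 - z.1| <= r /\ `|x.2 - z.2| <= r.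
Proof. by rewrite /sq2 /= !in_itv /= -!ler_distl. Qed.

Lemma measurable_sq2 (z : R * R) r : measurable (sq2 z r).
Proof. by apply: measurableX; exact: measurable_itv. Qed.

Lemma leb2_sq2 (z : R * R) r : 0 <= r -> leb2m (sq2 z r) = ((2 * r) ^+ 2)%:E.
Proof.
move=> r0.
have e (x : R) : mu `[x - r, x + r]%classic = (2 * r)%:E.
  rewrite lebesgue_measure_itv /= lte_fin; case: ltP => h.
    by rewrite -EFinB; congr EFin; ring.
  have -> : r = 0 by lra.
  by rewrite mulr0.
apply: etrans (product_measure1E mu mu _ _) _; try exact: measurable_itv.
by apply: etrans (f_equal2 mule (e z.1) (e z.2)) _; rewrite -EFinM expr2.
Qed.

Lemma ge0_integralS (d : measure_display) (T : measurableType d)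
    (m : {measure set T -> \bar R}) (A B : set T) (f : T -> R) :
  measurable A -> measurable B -> A `<=` B -> measurable_fun B f ->
  (forall x, B x -> 0 <= f x) ->
  (\int[m]_(x in A) (f x)%:E <= \int[m]_(x in B) (f x)%:E)%E.
Proof.
move=> mA mB AB mf f0; apply: ge0_subset_integral => //; exact/measurable_EFinP.
Qed.

(** Pigeonhole and Fubini: if every row of a strip of height [s] had integral at least [t], the
    square would carry at least [t * s > A]. *)
Lemma pick_row (z : R * R) (r s c0 t A : R) F : 0 < s -> measurable_fun (sq2 z r) F ->
  (forall x, 0 <= F x) -> z.2 - r <= c0 -> c0 + s <= z.2 + r ->
  (\int[leb2m]_(x in sq2 z r) (F x)%:E <= A%:E)%E -> A < t * s -> 0 <= t ->
  exists c, [/\ c0 <= c, c <= c0 + s &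
    (\int[mu]_(x in `[(z.1 - r)%R, (z.1 + r)%R]) (F (x, c))%:E < t%:E)%E].
Proof.
move=> s0 mF F0 h1 h2 HA At t0; apply: contrapT => /forallNP none.
pose g := (fun x => (F x)%:E) \_ (sq2 z r).
have mg : measurable_fun setT g.
  by apply/(measurable_restrictT _ (measurable_sq2 z r))/measurable_EFinP.
have g0 x : (0 <= g x)%E by apply: erestrict_ge0 => y _; rewrite lee_fin.
have E : (\int[leb2m]_(x in sq2 z r) (F x)%:E = \int[mu]_y \int[mu]_x g (x, y))%E.
  by rewrite integral_mkcond; exact: (fubini_tonelli2 (m1 := mu) (m2 := mu) g mg g0).
have mG := measurable_fun_fubini_tonelli_G (m1 := mu) g mg g0.
have : (t%:E * s%:E <= A%:E)%E; last by rewrite -EFinM lee_fin leNgt At.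
apply: le_trans HA; rewrite E.
have L : mu `[c0, c0 + s]%classic = s%:E.
  by rewrite lebesgue_measure_itv /= lte_fin ltrDl s0 -EFinB addrAC subrr add0r.
have -> : (t%:E * s%:E = \int[mu]_(y in `[c0, (c0 + s)%R]%classic) (cst t%:E) y)%E.
  rewrite integral_cst ?measurable_itv //; congr (_ * _)%E; exact: (esym L).
apply: (@le_trans _ _ (\int[mu]_(y in `[c0, (c0 + s)%R]%classic) \int[mu]_x g (x, y))%E).
  apply: ge0_le_integral => //.
  - by apply: measurable_funTS; exact: mG.
  - move=> y; rewrite /= in_itv /= => /andP[y1 y2].
    rewrite leNgt; apply/negP => H; apply: (none y); split => //.
    apply: le_lt_trans H; rewrite integral_mkcond le_eqVlt; apply/orP; left; apply/eqP.
    apply: eq_integral => x _.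
    rewrite /g /patch; congr (if _ then _ else _); apply/idP/idP; rewrite !inE /sq2 /= !in_itv /=.
      by move=> ->; split => //; apply/andP; split; lra.
    by case.
by apply: ge0_subset_integral => // y _; exact: integral_ge0.
Qed.

Lemma pick_col (z : R * R) (r s c0 t A : R) F : 0 < s -> measurable_fun (sq2 z r) F ->
  (forall x, 0 <= F x) -> z.1 - r <= c0 -> c0 + s <= z.1 + r ->
  (\int[leb2m]_(x in sq2 z r) (F x)%:E <= A%:E)%E -> A < t * s -> 0 <= t ->
  exists c, [/\ c0 <= c, c <= c0 + s &
    (\int[mu]_(y in `[(z.2 - r)%R, (z.2 + r)%R]) (F (c, y))%:E < t%:E)%E].
Proof.
move=> s0 mF F0 h1 h2 HA At t0; apply: contrapT => /forallNP none.
pose g := (fun x => (F x)%:E) \_ (sq2 z r).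
have mg : measurable_fun setT g.
  by apply/(measurable_restrictT _ (measurable_sq2 z r))/measurable_EFinP.
have g0 x : (0 <= g x)%E by apply: erestrict_ge0 => y _; rewrite lee_fin.
have E : (\int[leb2m]_(x in sq2 z r) (F x)%:E = \int[mu]_x \int[mu]_y g (x, y))%E.
  by rewrite integral_mkcond; exact: (fubini_tonelli1 (m1 := mu) (m2 := mu) g mg g0).
have mG := measurable_fun_fubini_tonelli_F (m2 := mu) g mg g0.
have : (t%:E * s%:E <= A%:E)%E; last by rewrite -EFinM lee_fin leNgt At.
apply: le_trans HA; rewrite E.
have L : mu `[c0, c0 + s]%classic = s%:E.
  by rewrite lebesgue_measure_itv /= lte_fin ltrDl s0 -EFinB addrAC subrr add0r.
have -> : (t%:E * s%:E = \int[mu]_(y in `[c0, (c0 + s)%R]%classic) (cst t%:E) y)%E.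
  rewrite integral_cst ?measurable_itv //; congr (_ * _)%E; exact: (esym L).
apply: (@le_trans _ _ (\int[mu]_(x in `[c0, (c0 + s)%R]%classic) \int[mu]_y g (x, y))%E).
  apply: ge0_le_integral => //.
  - by apply: measurable_funTS; exact: mG.
  - move=> y; rewrite /= in_itv /= => /andP[y1 y2].
    rewrite leNgt; apply/negP => H; apply: (none y); split => //.
    apply: le_lt_trans H; rewrite integral_mkcond le_eqVlt; apply/orP; left; apply/eqP.
    apply: eq_integral => x _.
    rewrite /g /patch; congr (if _ then _ else _); apply/idP/idP; rewrite !inE /sq2 /= !in_itv /=.
      by move=> ->; split => //; apply/andP; split; lra.
    by case.
by apply: ge0_subset_integral => // y _; exact: integral_ge0.
Qed.

Lemma sq2_disc (z : R * R) r x : sq2 z r x -> 2 * r < 1 - cabs (toC z) -> discR2 x.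
Proof.
move=> /sq2P[h1 h2] hr; apply: (@disc_ball _ (toC z)); apply: le_lt_trans hr.
by apply: le_trans (toC_lip _ _) _; rewrite -[2]/(1 + 1) mulrDl mul1r lerD.
Qed.

Lemma Rint_le_int (a b a' b' t : R) (g : R -> R) : a' <= a -> b <= b' ->
  mu.-integrable `[a, b] (EFin \o g) -> measurable_fun `[a', b'] g -> (forall x, 0 <= g x) ->
  (\int[mu]_(x in `[a', b']) (g x)%:E < t%:E)%E -> \int[mu]_(x in `[a, b]) g x <= t.
Proof.
move=> aa bb gi mg g0 H; rewrite -lee_fin /Rintegral fineK; last exact: integrable_fin_num.
apply: le_trans (ltW H); apply: ge0_integralS => //.
by move=> x /=; rewrite !in_itv /= => /andP[? ?]; apply/andP; split; lra.
Qed.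

(** Two rows and two columns with small integrals bound a [square_like] rectangle, to which
    [cauchy_L1] applies. *)
Lemma mean_L1 f (z : R * R) (r A : R) : holo f -> 0 < r -> 4 * r < 1 - cabs (toC z) ->
  (\int[leb2m]_(x in sq2 z (2 * r)) (cabs (f (toC x)))%:E <= A%:E)%E ->
  cabs (f (toC z)) <= 64 * A / r ^+ 2.
Proof.
move=> hf r0 rz HA; rewrite leNgt; apply/negP => H.
(* If the claim fails, then [A < t * r], so each side can be picked with integral below [t];
   [cauchy_L1] then gives [8 / r * (4 * t)], which is half of [|f z|]. *)
pose t := cabs (f (toC z)) * r / 64.
have At : A < t * r.
  move: H; rewrite ltr_pdivrMr ?exprn_gt0 // expr2 /t; lra.
have t0 : 0 <= t by rewrite /t divr_ge0 // mulr_ge0 ?cabs_ge0 // ltW.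
have F0 x : 0 <= cabs (f (toC x)) by exact: cabs_ge0.
have rz2 : 2 * (2 * r) < 1 - cabs (toC z) by lra.
have dz x : sq2 z (2 * r) x -> discR2 x by move=> h; exact: sq2_disc h rz2.
have mF : measurable_fun (sq2 z (2 * r)) (fun x => cabs (f (toC x))).
  apply: (measurable_funS _ dz); first exact: measurable_discR2.
  by apply: measurable_cabs => w dw; exact: holo_ccont.
have [c [c1 c2 Hc]] := pick_row (c0 := z.2 - 2 * r) r0 mF F0 ltac:(lra) ltac:(lra) HA At t0.
have [d [d1 d2 Hd]] := pick_row (c0 := z.2 + r) r0 mF F0 ltac:(lra) ltac:(lra) HA At t0.
have [a [a1 a2 Ha]] := pick_col (c0 := z.1 - 2 * r) r0 mF F0 ltac:(lra) ltac:(lra) HA At t0.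
have [b [b1 b2 Hb]] := pick_col (c0 := z.1 + r) r0 mF F0 ltac:(lra) ltac:(lra) HA At t0.
have ccf x y : `|x - z.1| <= 2 * r -> `|y - z.2| <= 2 * r -> ccont f (Complex x y).
  by move=> hx hy; apply: holo_ccont => //; apply: (dz (x, y)); apply/sq2P.
have sq : square_like z.1 z.2 r a b c d by split => //; apply/andP; split;
  move: a1 a2 b1 b2 c1 c2 d1 d2; clear; lra.
have hr : holo_rect f a b c d.
  move=> x y x1 x2 y1 y2; eexists; apply: (holo_cdiff hf); apply: (dz (x, y)).
  apply/sq2P; rewrite !ler_distl; split; apply/andP; split => /=;
    move: x1 x2 y1 y2 a1 b2 c1 d2; clear; lra.
have row y : `|y - z.2| <= 2 * r -> icont (z.1 - 2 * r) (z.1 + 2 * r) (fun x => f (Complex x y)).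
  by move=> hy; apply: ccont_icontx => x x1 x2; apply: ccf => //; rewrite ler_distl x1.
have col x : `|x - z.1| <= 2 * r -> icont (z.2 - 2 * r) (z.2 + 2 * r) (fun y => f (Complex x y)).
  by move=> hx; apply: ccont_iconty => y x1 x2; apply: ccf => //; rewrite ler_distl x1.
have ic (a' b' : R) (g : R -> C) : icont a' b' g -> measurable_fun `[a', b'] (fun x => cabs (g x)).
  by move=> /icont_cabs/(measurable_int mu)/measurable_EFinP.
have := cauchy_L1 sq hr; rewrite -[Complex z.1 z.2]/(toC z).
have n1 : `|c - z.2| <= 2 * r.
  by rewrite ler_distl; apply/andP; split; move: r0 c1 c2; clear; lra.
have n2 : `|d - z.2| <= 2 * r.
  by rewrite ler_distl; apply/andP; split; move: r0 d1 d2; clear; lra.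
have n3 : `|a - z.1| <= 2 * r.
  by rewrite ler_distl; apply/andP; split; move: r0 a1 a2; clear; lra.
have n4 : `|b - z.1| <= 2 * r.
  by rewrite ler_distl; apply/andP; split; move: r0 b1 b2; clear; lra.
have la : z.1 - 2 * r <= a by [].
have lb : b <= z.1 + 2 * r by move: b2; clear; lra.
have lc : z.2 - 2 * r <= c by [].
have ld : d <= z.2 + 2 * r by move: d2; clear; lra.
have m1 : \int[mu]_(x in `[a, b]) cabs (f (Complex x c)) <= t.
  apply: (Rint_le_int la lb _ (ic _ _ _ (row _ n1)) _ Hc) => // [|x]; last exact: cabs_ge0.
  exact: (icont_cabs (icontS la lb (row _ n1))).
have m2 : \int[mu]_(x in `[a, b]) cabs (f (Complex x d)) <= t.
  apply: (Rint_le_int la lb _ (ic _ _ _ (row _ n2)) _ Hd) => // [|x]; last exact: cabs_ge0.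
  exact: (icont_cabs (icontS la lb (row _ n2))).
have m3 : \int[mu]_(x in `[c, d]) cabs (f (Complex a x)) <= t.
  apply: (Rint_le_int lc ld _ (ic _ _ _ (col _ n3)) _ Ha) => // [|x]; last exact: cabs_ge0.
  exact: (icont_cabs (icontS lc ld (col _ n3))).
have m4 : \int[mu]_(x in `[c, d]) cabs (f (Complex b x)) <= t.
  apply: (Rint_le_int lc ld _ (ic _ _ _ (col _ n4)) _ Hb) => // [|x]; last exact: cabs_ge0.
  exact: (icont_cabs (icontS lc ld (col _ n4))).
rewrite /bnorm => K.
have K2 : cabs (f (toC z)) <= 8 / r * (4 * t).
  apply: le_trans K _; rewrite ler_wpM2l ?divr_ge0 ?(ltW r0) //; move: m1 m2 m3 m4; clear; lra.
have A0 : 0 <= A.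
  by rewrite -lee_fin; apply: le_trans HA; apply: integral_ge0 => x _; rewrite lee_fin.
have K3 : 8 / r * (4 * t) = cabs (f (toC z)) / 2 by rewrite /t; field; rewrite gt_eqF.
have K4 : 0 <= 64 * A / r ^+ 2 by apply: divr_ge0; [exact: mulr_ge0 | exact: sqr_ge0].
by move: K2 H K4; rewrite K3; clear; lra.
Qed.

End SubMeanValue.

(** * The mean value estimate for [p >= 1] *)

Section PowerMean.
Variable R : realType.
Local Notation C := R[i].
Implicit Types (f g : C -> C) (F : R * R -> R).

(** Guarantees that the supremum in [mean_Lp_lt1] is finite; compactness enters through
    [bisection]. *)
Lemma bounded_sq2 f (z : R * R) r : holo f -> 0 <= r -> 2 * r < 1 - cabs (toC z) ->
  exists M : R, forall x, sq2 z r x -> cabs (f (toC x)) <= M.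
Proof.
move=> hf r0 hr.
have [M HM] : exists M : R, forall x y, z.1 - r <= x -> x <= z.1 + r -> z.2 - r <= y ->
    y <= z.2 + r -> cabs (f (Complex x y)) <= M.
  apply: (bisection (P := fun a b c d => exists M : R, forall x y, a <= x -> x <= b ->
    c <= y -> y <= d -> cabs (f (Complex x y)) <= M)); try lra.
    move=> a b c d ab cd m k _ _ _ _ [M1 H1] [M2 H2] [M3 H3] [M4 H4].
    exists (Num.max (Num.max M1 M2) (Num.max M3 M4)) => x y x1 x2 y1 y2.
    rewrite !le_max.
    have [xm|mx] := leP x m; have [yk|ky] := leP y k.
    - by rewrite H1.
    - by rewrite H3 ?orbT // ltW.
    - by rewrite H2 ?orbT // ltW.
    - by rewrite H4 ?orbT // ltW.
  move=> x y x1 x2 y1 y2.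
  have dxy : disc (Complex x y).
    by apply: (@sq2_disc _ z r (x, y) _ hr); apply/sq2P; rewrite !ler_distl x1 x2 y1.
  have [d d0 Hd] := ccont_bounded (holo_ccont hf dxy).
  exists d => // a b c e _ _ _ _ ax xb cy ye abd.
  exists (cabs (f (Complex x y)) + 1) => u v u1 u2 v1 v2.
  have := Hd (Complex u v - Complex x y); rewrite [_ + (_ - _)]addrC subrK => H.
  apply: ltW; apply: H; apply: le_lt_trans abd; apply: le_trans (cabs_le_ReIm _) _ => /=.
  by apply: lerD; rewrite ler_distl; apply/andP; split; lra.
exists M => -[x y] /sq2P; rewrite !ler_distl /= => -[/andP[x1 x2] /andP[y1 y2]].
exact: HM.
Qed.

Lemma int_le_affine (d : measure_display) (T : measurableType d)
    (m : {measure set T -> \bar R}) (D : set T) (F G : T -> R) (c k A V : R) :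
  measurable D -> measurable_fun D F -> measurable_fun D G ->
  (forall x, 0 <= F x) -> (forall x, 0 <= G x) -> 0 <= c -> 0 <= k ->
  (forall x, D x -> F x <= c * G x + k) ->
  (\int[m]_(x in D) (G x)%:E <= A%:E)%E -> (m D <= V%:E)%E ->
  (\int[m]_(x in D) (F x)%:E <= (c * A + k * V)%:E)%E.
Proof.
move=> mD mF mG F0 G0 c0 k0 H HA HV.
have mG' : measurable_fun D (fun x => (G x)%:E) by exact/measurable_EFinP.
have mcG : measurable_fun D (fun x => (c%:E * (G x)%:E)%E) by exact: measurable_funeM.
apply: (@le_trans _ _ (\int[m]_(x in D) (c%:E * (G x)%:E + (cst k%:E) x))%E).
  apply: ge0_le_integral => //.
  - by move=> x _; rewrite lee_fin.
  - exact/measurable_EFinP.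
  - by apply: emeasurable_funD.
rewrite ge0_integralD //;
  last by move=> x _; rewrite -EFinM lee_fin mulr_ge0.
rewrite ge0_integralZl //; last by move=> x _; rewrite lee_fin.
rewrite integral_cst // EFinD !EFinM; apply: leeD.
  by apply: lee_wpmul2l; rewrite ?lee_fin.
by apply: lee_wpmul2l; rewrite ?lee_fin.
Qed.

Lemma le_limit (x c A : R) : 0 <= c -> (forall A', A < A' -> x <= c * A') -> x <= c * A.
Proof.
move=> c0 H; apply/ler_addgt0Pl => e e0.
have c1 : 0 < c + 1 by rewrite ltr_wpDl.
have := H (A + e / (c + 1)); rewrite ltrDl divr_gt0 // => /(_ isT) h.
apply: le_trans h _; rewrite mulrDr addrC lerD2r mulrCA -[leRHS]mulr1 ler_wpM2l ?ltW //.
by rewrite ltr_pdivrMr // mul1r ltrDl.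
Qed.

(** Below the level [l] the last term suffices; above it the power of exponent 1 - p decreases.
    Integrated at a suitable level, this plays the part of Jensen's inequality. *)
Lemma powR_gt1_split (x l p : R) : 1 <= p -> 0 <= x -> 0 < l ->
  x <= l `^ (1 - p) * x `^ p + l.
Proof.
move=> p1 x0 l0; have [xl|lx] := leP x l.
  by rewrite ler_wpDl // mulr_ge0 // powR_ge0.
have x1 : 0 < x := lt_trans l0 lx.
rewrite ler_wpDr ?(ltW l0) //.
have e : x = x `^ (1 - p) * x `^ p.
  by rewrite -powRD subrK ?powRr1 // oner_eq0.
rewrite {1}e ler_wpM2r ?powR_ge0 // -[1 - p]opprB !powRN lef_pV2 ?posrE ?powR_gt0 //.
by rewrite ge0_ler_powR ?nnegrE ?subr_ge0 // ltW.
Qed.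

Lemma powRK (x p : R) : 0 < p -> 0 <= x -> (x `^ p) `^ p^-1 = x.
Proof. by move=> p0 x0; rewrite -powRrM divff ?gt_eqF // powRr1. Qed.

Lemma powRVK (x p : R) : 0 < p -> 0 <= x -> (x `^ p^-1) `^ p = x.
Proof. by move=> p0 x0; rewrite -powRrM mulVf ?gt_eqF // powRr1. Qed.

Lemma measurable_powR_holo f p (D : set (R * R)) : holo f -> D `<=` @discR2 R ->
  measurable_fun D (fun x => cabs (f (toC x)) `^ p).
Proof.
move=> hf DD; apply: (measurable_funS _ DD); first exact: measurable_discR2.
have mc : measurable_fun (@discR2 R) (fun x => cabs (f (toC x))).
  by apply: measurable_cabs => w dw; exact: holo_ccont.
exact: (measurableT_comp (@measurable_powR R p) mc).
Qed.

Lemma measurable_cabs_holo f (D : set (R * R)) : holo f -> D `<=` @discR2 R ->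
  measurable_fun D (fun x => cabs (f (toC x))).
Proof.
move=> hf DD; apply: (measurable_funS _ DD); first exact: measurable_discR2.
by apply: measurable_cabs => w dw; exact: holo_ccont.
Qed.

Lemma mean_Lp_ge1 p : 1 <= p -> exists2 K : R, 0 < K & forall f z r A,
  holo f -> 0 < r -> 2 * r < 1 - cabs (toC z) ->
  (\int[leb2m R]_(x in sq2 z r) (cabs (f (toC x)) `^ p)%:E <= A%:E)%E ->
  cabs (f (toC z)) `^ p <= K * A / r ^+ 2.
Proof.
move=> p1; have p0 : 0 < p := lt_le_trans ltr01 p1.
exists ((64 * 20) `^ p); first by rewrite powR_gt0 // mulr_gt0.
move=> f z r A hf r0 rz HA.
have A0 : 0 <= A.
  by rewrite -lee_fin; apply: le_trans HA; apply: integral_ge0 => x _; rewrite lee_fin powR_ge0.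
(* [A] may be 0 and would then give no positive level, so a larger [A'] is used and the limit
   taken. *)
rewrite mulrAC; apply: le_limit => [|A' AA'].
  by rewrite divr_ge0 ?powR_ge0 ?exprn_ge0 // ltW.
have A'0 : 0 < A' := le_lt_trans A0 AA'.
have HA' : (\int[leb2m R]_(x in sq2 z r) (cabs (f (toC x)) `^ p)%:E <= A'%:E)%E.
  by apply: le_trans HA _; rewrite lee_fin ltW.
pose B := A' / r ^+ 2; have B0 : 0 < B by rewrite divr_gt0 // exprn_gt0.
(* At this level the two terms of [powR_gt1_split] integrate to [l * r ^+ 2] and [4 * l * r ^+ 2];
   [mean_L1] with [r / 2] turns their sum into [64 * 20 * l]. *)
pose l := B `^ p^-1; have l0 : 0 < l by rewrite powR_gt0.
have lp : l `^ p = B by rewrite powRVK // ltW.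
have r2 : 0 < r / 2 by rewrite divr_gt0.
have e2 : 2 * (r / 2) = r by field.
have DD : sq2 z r `<=` @discR2 R by move=> x xz; exact: sq2_disc xz rz.
have V : (leb2m R (sq2 z r) <= ((2 * r) ^+ 2)%:E)%E by rewrite leb2_sq2 // ltW.
have I1 : (\int[leb2m R]_(x in sq2 z r) (cabs (f (toC x)))%:E <=
   (l `^ (1 - p) * A' + l * (2 * r) ^+ 2)%:E)%E.
  apply: (@int_le_affine _ _ (leb2m R) _ _ _ _ _ _ _ _ _ _ _ _ _ _ _ HA' V).
  - exact: measurable_sq2.
  - exact: measurable_cabs_holo.
  - exact: measurable_powR_holo.
  - by move=> x; exact: cabs_ge0.
  - by move=> x; exact: powR_ge0.
  - exact: powR_ge0.
  - exact: ltW.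
  - by move=> x _; apply: powR_gt1_split => //; exact: cabs_ge0.
have := @mean_L1 _ f z (r / 2) (l `^ (1 - p) * A' + l * (2 * r) ^+ 2) hf r2.
rewrite e2 => /(_ _ I1) H.
have {}H : cabs (f (toC z)) <= 64 * 20 * l.
  apply: le_trans (H _) _; first by move: rz; clear; lra.
  have -> : 64 * (l `^ (1 - p) * A' + l * (2 * r) ^+ 2) / (r / 2) ^+ 2 =
    64 * 4 * (l `^ (1 - p) * B) + 64 * 16 * l.
    by rewrite /B; field; rewrite gt_eqF.
  have -> : l `^ (1 - p) * B = l.
    by rewrite -lp -powRD subrK ?powRr1 ?(ltW l0) // oner_eq0.
  by rewrite -mulrDl; clear; lra.
rewrite mulrAC -[leRHS]mulrA -/B -lp -powRM ?(ltW l0) //.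
by rewrite ge0_ler_powR ?nnegrE ?cabs_ge0 ?mulr_ge0 // ltW.
Qed.

End PowerMean.

(** * The mean value estimate for [p < 1], and for derivatives *)

Section PowerMeanSmall.
Variable R : realType.
Local Notation C := R[i].
Implicit Types (f g : C -> C) (F : R * R -> R).

Lemma toC_sq2_lt (z w : R * R) (r s : R) : `|w.1 - z.1| <= s -> `|w.2 - z.2| <= s ->
  cabs (toC w) <= cabs (toC z) + 2 * s.
Proof.
move=> h1 h2; apply: le_trans (cabs_le_sub _ (toC z)) _; rewrite lerD2l.
by apply: le_trans (toC_lip _ _) _; rewrite -[2]/(1 + 1) mulrDl mul1r lerD.
Qed.

(* Let w almost attain the supremum S of dist(v, boundary)^2 |f v|^p over the square.
   Then |f|^p <= 4 S / dist(w, boundary)^2 near w, so that averaging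
   |f| = |f|^p |f|^(1-p) there bounds S by the integral of |f|^p. *)
Lemma mean_Lp_lt1 p : 0 < p -> p < 1 -> exists2 K : R, 0 < K & forall f z r A,
  holo f -> 0 < r -> 2 * r < 1 - cabs (toC z) ->
  (\int[leb2m R]_(x in sq2 z r) (cabs (f (toC x)) `^ p)%:E <= A%:E)%E ->
  cabs (f (toC z)) `^ p <= K * A / r ^+ 2.
Proof.
move=> p0 p1; pose s := p^-1 - 1.
have s0 : 0 <= s by rewrite subr_ge0 invf_ge1 ?ltW.
exists (2 * (64 * 16 * 8 `^ s)); first by rewrite !mulr_gt0 // powR_gt0.
move=> f z r A hf r0 rz HA.
have A0 : 0 <= A.
  by rewrite -lee_fin; apply: le_trans HA; apply: integral_ge0 => x _; rewrite lee_fin powR_ge0.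
set K := 2 * _; have K0 : 0 <= K by rewrite !mulr_ge0 // powR_ge0.
have xps (x : R) : 0 <= x -> x = x `^ p * (x `^ p) `^ s.
  move=> x0; rewrite -powRrM /s mulrBr mulr1 divff ?gt_eqF //.
  have [->|xn0] := eqVneq x 0; first by rewrite powR0 ?mul0r // gt_eqF.
  by rewrite -powRD ?[p + _]addrC ?subrK ?powRr1 // ?xn0 ?implybT.
have [M HM] := bounded_sq2 hf (ltW r0) rz.
pose de (x : R * R) := r - Num.max `|x.1 - z.1| `|x.2 - z.2|.
pose phi (x : R * R) := de x ^+ 2 * cabs (f (toC x)) `^ p.
have deP x : sq2 z r x -> 0 <= de x /\ de x <= r.
  by move=> /sq2P[h1 h2]; rewrite /de subr_ge0 ge_max h1 h2 gerBl le_max normr_ge0.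
have sz : sq2 z r z by apply/sq2P; rewrite !subrr normr0 ltW.
pose S := sup [set phi x | x in sq2 z r].
have hs : has_sup [set phi x | x in sq2 z r].
  split; first by exists (phi z); exists z.
  exists (r ^+ 2 * Num.max M 0 `^ p) => _ [x xz <-].
  have [d0 dr] := deP x xz.
  apply: ler_pM; rewrite ?sqr_ge0 ?powR_ge0 //.
    by rewrite ler_pXn2r // nnegrE // ltW.
  apply: ge0_ler_powR; rewrite ?nnegrE ?cabs_ge0 ?(ltW p0) //.
    by rewrite le_max lexx orbT.
  by rewrite le_max HM.
have phiS x : sq2 z r x -> phi x <= S.
  by move=> xz; apply: sup_upper_bound => //; exists x.
have Sle : S <= K * A.
  rewrite leNgt; apply/negP => KS.
  have S0 : 0 < S by apply: le_lt_trans KS; rewrite mulr_ge0.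
  have S2 : 0 < S / 2 by rewrite divr_gt0.
  have [_ [w wz <-] Hw] := sup_adherent S2 hs.
  have {}Hw : S / 2 < phi w by move: Hw; rewrite -/S; lra.
  have [d0 dr] := deP w wz.
  set d := de w in d0 dr.
  have dpos : 0 < d.
    rewrite lt_def d0 andbT; apply/eqP => E; move: Hw.
    by rewrite /phi -/d E expr0n mul0r ltNge (ltW S2).
  have d20 : 0 < d ^+ 2 by rewrite exprn_gt0.
  have d2 : 0 < d / 4 by rewrite divr_gt0.
  have dw : Num.max `|w.1 - z.1| `|w.2 - z.2| = r - d by rewrite /d /de; ring.
  have [w1 w2] : `|w.1 - z.1| <= r - d /\ `|w.2 - z.2| <= r - d.
    by rewrite -dw !le_max !lexx orbT.
  pose Y := 4 * S / d ^+ 2.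
  have Y0 : 0 < Y by rewrite divr_gt0 // mulr_gt0.
  have e2 : 2 * (d / 4) = d / 2 by field.
  have sub v : sq2 w (2 * (d / 4)) v -> sq2 z r v /\ d / 2 <= de v.
    rewrite e2 => /sq2P[v1 v2].
    have k1 : `|v.1 - z.1| <= r - d / 2.
      apply: le_trans (ler_distD w.1 _ _) _; move: v1 w1; clear; lra.
    have k2 : `|v.2 - z.2| <= r - d / 2.
      apply: le_trans (ler_distD w.2 _ _) _; move: v2 w2; clear; lra.
    split; first by apply/sq2P; move: k1 k2 dpos; clear; split; lra.
    by rewrite /de lerBrDr addrC -lerBrDr ge_max k1 k2.
  have fY v : sq2 w (2 * (d / 4)) v -> cabs (f (toC v)) `^ p <= Y.
    move=> /sub[vz dv]; rewrite /Y ler_pdivlMr // mulrC.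
    have := phiS v vz; rewrite /phi => h.
    have h1 : (d / 2) ^+ 2 <= de v ^+ 2.
      by rewrite ler_pXn2r // nnegrE; [rewrite divr_ge0 | apply: le_trans dv; rewrite divr_ge0].
    have h2 := ler_wpM2r (powR_ge0 (cabs (f (toC v))) p) h1.
    have h3 := le_trans h2 h.
    by move: h3; rewrite expr_div_n; clear; lra.
  have wd : 4 * (d / 4) < 1 - cabs (toC w).
    have := toC_sq2_lt r w1 w2; move: rz dpos; clear; lra.
  have DD : sq2 w (2 * (d / 4)) `<=` @discR2 R.
    by move=> x /sub[xz _]; exact: sq2_disc xz rz.
  have V : (leb2m R (sq2 w (2 * (d / 4))) <= ((2 * (2 * (d / 4))) ^+ 2)%:E)%E.
    by rewrite leb2_sq2 // mulr_ge0 // ltW.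
  have HA' : (\int[leb2m R]_(x in sq2 w (2 * (d / 4))) (cabs (f (toC x)) `^ p)%:E <= A%:E)%E.
    apply: le_trans HA; apply: ge0_integralS.
    - exact: measurable_sq2.
    - exact: measurable_sq2.
    - by move=> v /sub[].
    - by apply: measurable_powR_holo => // x xz; exact: sq2_disc xz rz.
    - by move=> x _; exact: powR_ge0.
  have I1 : (\int[leb2m R]_(x in sq2 w (2 * (d / 4))) (cabs (f (toC x)))%:E <=
     (Y `^ s * A + 0 * (2 * (2 * (d / 4))) ^+ 2)%:E)%E.
    apply: (@int_le_affine R _ _ (leb2m R) _ _ _ _ _ _ _ _ _ _ _ _ _ _ _ HA' V).
    - exact: measurable_sq2.
    - exact: measurable_cabs_holo.
    - exact: measurable_powR_holo.
    - by move=> x; exact: cabs_ge0.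
    - by move=> x; exact: powR_ge0.
    - exact: powR_ge0.
    - exact: lexx.
    - move=> v vw; rewrite addr0 {1}(xps _ (cabs_ge0 (f (toC v)))) mulrC.
      rewrite ler_wpM2r ?powR_ge0 // ge0_ler_powR // ?nnegrE ?powR_ge0 ?(ltW Y0) //.
      exact: fY.
  rewrite mul0r addr0 in I1.
  have := mean_L1 hf d2 wd I1; set a := cabs (f (toC w)) `^ p => H.
  have aY : Y < 8 * a.
    rewrite /Y ltr_pdivrMr //; move: Hw; rewrite /phi -/d -/a.
    by move: (d ^+ 2) (a) (S) => D a' S'; clear; lra.
  have a0 : 0 < a by move: aY Y0; clear; lra.
  have as0 : 0 < a `^ s by rewrite powR_gt0.
  rewrite (xps _ (cabs_ge0 (f (toC w)))) -/a in H.
  have Ys : Y `^ s <= 8 `^ s * a `^ s.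
    by rewrite -powRM ?(ltW a0) // ge0_ler_powR // ?nnegrE ?(ltW Y0) ?mulr_ge0 ?(ltW a0) // ltW.
  (* Because [Y < 8 * a], the same power of [a] appears on both sides and cancels, which leaves a
     bound that is linear in [A]. *)
  have : a * a `^ s <= 64 * 16 * 8 `^ s * A / d ^+ 2 * a `^ s.
    apply: le_trans H _.
    have -> : 64 * (Y `^ s * A) / (d / 4) ^+ 2 = (64 * 16 * A / d ^+ 2) * Y `^ s.
      by field; rewrite gt_eqF.
    have -> : 64 * 16 * 8 `^ s * A / d ^+ 2 * a `^ s = (64 * 16 * A / d ^+ 2) * (8 `^ s * a `^ s).
      by ring.
    by rewrite ler_wpM2l // divr_ge0 ?mulr_ge0 // ltW.
  rewrite ler_pM2r // ler_pdivlMr // => aK.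
  move: Hw KS; rewrite /phi -/d -/a /K; move: aK.
  by move: (d ^+ 2) (8 `^ s) (a) (S) => D a' S' T; clear; lra.
have := le_trans (phiS z sz) Sle; rewrite /phi /de !subrr normr0 maxxx subr0.
by rewrite ler_pdivlMr ?exprn_gt0 // mulrC.
Qed.

Lemma mean_Lp p : 0 < p -> exists2 K : R, 0 < K & forall f z r A,
  holo f -> 0 < r -> 2 * r < 1 - cabs (toC z) ->
  (\int[leb2m R]_(x in sq2 z r) (cabs (f (toC x)) `^ p)%:E <= A%:E)%E ->
  cabs (f (toC z)) `^ p <= K * A / r ^+ 2.
Proof.
move=> p0; have [p1|p1] := leP 1 p; first exact: mean_Lp_ge1.
exact: mean_Lp_lt1.
Qed.

(** [mean_Lp] bounds [|f|] within distance [r / 2] of the centre, and [cauchy_estimate] passes to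
    the derivative. The scale factor [r ^+ k] is kept apart because it will cancel against the
    coefficients. *)
Lemma mean_deriv p k : 0 < p -> exists2 K : R, 0 < K & forall f z r A,
  holo f -> 0 < r -> 2 * r < 1 - cabs (toC z) ->
  (\int[leb2m R]_(x in sq2 z r) (cabs (f (toC x)) `^ p)%:E <= A%:E)%E ->
  cabs (cderiv k f (toC z)) <= K / r ^+ k * (A / r ^+ 2) `^ p^-1.
Proof.
move=> p0; have [K K0 HK] := mean_Lp p0.
exists (cauchy_const R k * 2 ^+ k * (K * 4) `^ p^-1).
  by rewrite !mulr_gt0 ?powR_gt0 ?cauchy_const_gt0 ?exprn_gt0 // mulr_gt0.
move=> f z r A hf r0 rz HA.
have A0 : 0 <= A.
  by rewrite -lee_fin; apply: le_trans HA; apply: integral_ge0 => x _; rewrite lee_fin powR_ge0.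
have r2 : 0 < r / 2 by rewrite divr_gt0.
have B0 : 0 <= A / r ^+ 2 by rewrite divr_ge0 ?exprn_ge0 // ltW.
have HM w : cabs (w - toC z) <= r / 2 -> cabs (f w) <= (K * 4 * (A / r ^+ 2)) `^ p^-1.
  case: w => u v hw; have := le_trans (cabs_Re _) hw; have := le_trans (cabs_Im _) hw.
  rewrite /= => h2 h1.
  have wz := @toC_sq2_lt z (u, v) (r / 2) (r / 2) h1 h2.
  rewrite -[cabs (f _)](powRK p0) ?cabs_ge0 // ge0_ler_powR ?invr_ge0 ?(ltW p0) //.
  - by rewrite nnegrE powR_ge0.
  - by rewrite nnegrE mulr_ge0 // mulr_ge0 // ltW.
  have -> : K * 4 * (A / r ^+ 2) = K * A / (r / 2) ^+ 2 by field; rewrite gt_eqF.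
  apply: (HK f (u, v) (r / 2)) => //.
    by move: wz rz; clear; lra.
  apply: le_trans HA; apply: ge0_integralS.
  - exact: measurable_sq2.
  - exact: measurable_sq2.
  - move=> x /sq2P[/= k1 k2]; apply/sq2P; rewrite [r]splitr; split.
      by apply: le_trans (ler_distD u _ _) _; rewrite lerD.
    by apply: le_trans (ler_distD v _ _) _; rewrite lerD.
  - by apply: measurable_powR_holo => // x xz; exact: sq2_disc xz rz.
  - by move=> x _; exact: powR_ge0.
have rz' : r / 2 < 1 - cabs (toC z) by move: rz r0; clear; lra.
have := cauchy_estimate k hf r2 rz' HM.
rewrite powRM //; last by rewrite mulr_ge0 // ltW.
congr (_ <= _); rewrite exprMn exprVn; field.
by rewrite !expf_neq0 ?gt_eqF.
Qed.

End PowerMeanSmall.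

(** * Sums over dyadic grids *)

Section DiscreteSums.
Variable R : realType.
Implicit Types (d h t u th : R).

Lemma uniq_sum_le (T : eqType) (s s' : seq T) (F : T -> R) :
  uniq s -> {subset s <= s'} -> (forall x, 0 <= F x) ->
  \sum_(x <- s) F x <= \sum_(x <- s') F x.
Proof.
move=> us ss F0.
have -> : \sum_(x <- s) F x = \sum_(x <- undup s' | x \in s) F x.
  rewrite -[RHS]big_filter; apply: perm_big; apply: uniq_perm => //.
    by rewrite filter_uniq // undup_uniq.
  move=> x; rewrite mem_filter mem_undup; case xs : (x \in s) => //=.
  by rewrite ss.
apply: (@le_trans _ _ (\sum_(x <- undup s') F x)).
  by rewrite [leRHS](bigID (fun x => x \in s)) /= lerDl sumr_ge0.
elim: s' {ss} => [|y s' IH]; first by rewrite !big_nil.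
rewrite /=.
case: ifP => _; rewrite !big_cons.
  by apply: le_trans IH _; rewrite lerDr.
by rewrite lerD2l.
Qed.

(* The increments of the bounded function [u / (d + |u|)] dominate the kernel. *)
Lemma telescope_kernel d h u : 0 < h -> h <= d ->
  ((d + `|u|) ^+ 2)^-1 <= 2 / (d * h) * ((u + h) / (d + `|u + h|) - u / (d + `|u|)).
Proof.
move=> h0 hd; have d0 : 0 < d := lt_le_trans h0 hd.
have A0 : 0 < d + `|u| by rewrite ltr_pwDl.
have B0 : 0 < d + `|u + h| by rewrite ltr_pwDl.
have main : d * h <= (u + h) * (d + `|u|) - u * (d + `|u + h|) /\
    d + `|u + h| <= 2 * (d + `|u|).
  have [u0|u0] := leP 0 u.
    by rewrite (ger0_norm (addr_ge0 u0 (ltW h0))) (ger0_norm u0); split; nra.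
  have [uh|uh] := leP 0 (u + h).
    by rewrite (ltr0_norm u0) (ger0_norm uh); split; nra.
  by rewrite (ltr0_norm u0) (ltr0_norm uh); split; nra.
case: main; move: A0 B0; set A := d + _; set B := d + _ => A0 B0 m1 m2.
have -> : (u + h) / B - u / A = ((u + h) * A - u * B) / (A * B).
  by field; rewrite !gt_eqF.
have dh : 0 < d * h by rewrite mulr_gt0.
apply: (@le_trans _ _ (2 / (d * h) * (d * h / (A * B)))).
  have -> : 2 / (d * h) * (d * h / (A * B)) = 2 / (A * B) by field; rewrite !gt_eqF.
  rewrite ler_pdivlMr ?mulr_gt0 // mulrC ler_pdivrMr ?exprn_gt0 // expr2 mulrA.
  by rewrite [A * B]mulrC ler_wpM2r ?(ltW A0).
rewrite ler_wpM2l ?divr_ge0 ?(ltW dh) // ler_wpM2r // invr_ge0 ltW //.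
by rewrite mulr_gt0.
Qed.

Lemma inner_sum (s : seq int) d h t : uniq s -> 0 < h -> h <= d ->
  \sum_(a <- s) ((d + `|a%:~R * h - t|) ^+ 2)^-1 <= 4 / (d * h).
Proof.
move=> us h0 hd; have d0 : 0 < d := lt_le_trans h0 hd.
(* [s] is contained in the window from [-N] to [N - 1], over which the increments telescope. *)
pose N := \max_(a <- s) `|a|%N.+1.
have sub : {subset s <= [seq (i%:Z - N%:Z)%R | i <- iota 0 (N + N)]}.
  move=> a as_;
    have aN : (`|a| < N)%N by exact: (@leq_bigmax_seq _ s predT (fun a : int => `|a|%N.+1) a as_ isT).
  apply/mapP; exists `|(a + N%:Z)%R|%N.
    by rewrite mem_iota /= add0n; lia.
  by lia.
pose G (u : R) := u / (d + `|u|).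
apply: le_trans (uniq_sum_le us sub _) _ => [a|].
  by rewrite invr_ge0 sqr_ge0.
rewrite big_map.
have E (i : nat) : ((d + `|(i%:Z - N%:Z)%:~R * h - t|) ^+ 2)^-1 <=
   2 / (d * h) * (G (i.+1%:R * h - (N%:R * h + t)) - G (i%:R * h - (N%:R * h + t))).
  have := telescope_kernel (i%:R * h - (N%:R * h + t)) h0 hd.
  have -> : i%:R * h - (N%:R * h + t) + h = i.+1%:R * h - (N%:R * h + t).
    by rewrite -natr1; ring.
  have -> // : i%:R * h - (N%:R * h + t) = (i%:Z - N%:Z)%:~R * h - t.
  by rewrite intrB; ring.
apply: le_trans (ler_sum _ (fun i _ => E i)) _.
rewrite -mulr_sumr -[X in iota _ X]subn0 -/(index_iota 0 (N + N)) telescope_sumr //.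
have Gb u : `|G u| <= 1.
  have n : 0 < d + `|u| by rewrite ltr_pwDl.
  by rewrite /G normrM normfV (gtr0_norm n) ler_pdivrMr // mul1r lerDr ltW.
have -> : 4 / (d * h) = 2 / (d * h) * 2 by field; rewrite !gt_eqF.
rewrite ler_wpM2l ?divr_ge0 ?mulr_ge0 ?(ltW d0) ?(ltW h0) //.
apply: le_trans (ler_norm _) _; apply: le_trans (ler_normB _ _) _.
by rewrite -[leRHS]/(1 + 1) lerD.
Qed.

Lemma geometric_up (a : R) n : 1 < a -> \sum_(m < n) a ^+ m <= a ^+ n / (a - 1).
Proof.
move=> a1; rewrite ler_pdivlMr ?subr_gt0 //.
have := subrX1 a n => E; rewrite mulrC -E.
by rewrite gerBl.
Qed.

Lemma geometric_down (b : R) n k : 0 < b -> b < 1 ->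
  \sum_(m < n) b ^+ (k + m) <= b ^+ k / (1 - b).
Proof.
move=> b0 b1; under eq_bigr do rewrite exprD.
rewrite -mulr_sumr ler_pM2l ?exprn_gt0 //.
rewrite -[leRHS]mul1r ler_pdivlMr ?subr_gt0 //.
have := subrX1 b n => E.
have -> : (\sum_(i < n) b ^+ i) * (1 - b) = 1 - b ^+ n by rewrite -opprB mulrN mulrC -E opprB.
by rewrite gerBl exprn_ge0 // ltW.
Qed.

(** For [m < m0] a term is at most [th ^+ m], which sums because [th > 1]; for larger [m] it is at
    most [(th / 2) ^+ m * 2 ^+ m0], which sums because [th < 2]. Both sums are of the order of
    [th ^+ m0]. *)
Lemma level_sum th M m0 : 1 < th -> th < 2 ->
  \sum_(m < M) (th / 2) ^+ m / (2 ^- m + 2 ^- m0) <=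
    ((th - 1)^-1 + (1 - th / 2)^-1) * th ^+ m0.
Proof.
move=> t1 t2; have th0 : 0 < th := lt_trans ltr01 t1.
have p2 n : 0 < 2 ^- n :> R by rewrite invr_gt0 exprn_gt0.
have th2 : 0 < th / 2 by rewrite divr_gt0.
pose F m : R := (th / 2) ^+ m / (2 ^- m + 2 ^- m0).
have F0 m : 0 <= F m by rewrite divr_ge0 ?exprn_ge0 ?addr_ge0 // ltW.
have F1 m : F m <= th ^+ m.
  rewrite /F ler_pdivrMr ?addr_gt0 // expr_div_n mulrDr lerDl.
  by rewrite mulr_ge0 ?exprn_ge0 // ltW.
have F2 m : F m <= (th / 2) ^+ m * 2 ^+ m0.
  rewrite /F ler_pdivrMr ?addr_gt0 // -mulrA ler_peMr ?exprn_ge0 ?(ltW th2) //.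
  rewrite mulrDr mulfV ?expf_neq0 // lerDr.
  by rewrite mulr_ge0 ?exprn_ge0 // ltW.
apply: (@le_trans _ _ (\sum_(m < m0 + M) F m)).
  by rewrite addnC big_split_ord /= lerDl sumr_ge0.
rewrite big_split_ord /= mulrDl; apply: lerD.
  apply: (@le_trans _ _ (\sum_(m < m0) th ^+ m)); first by apply: ler_sum.
  by rewrite mulrC; exact: geometric_up.
apply: (@le_trans _ _ (\sum_(m < M) (th / 2) ^+ (m0 + m) * 2 ^+ m0)); first by apply: ler_sum.
rewrite -mulr_suml.
have b1 : th / 2 < 1 by rewrite ltr_pdivrMr // mul1r.
apply: (@le_trans _ _ ((th / 2) ^+ m0 / (1 - th / 2) * 2 ^+ m0)).
  by rewrite ler_wpM2r ?exprn_ge0 //; exact: geometric_down.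
by rewrite expr_div_n mulrAC divfK ?expf_neq0 // mulrC.
Qed.

(** The positions of one level are summed by [inner_sum], the levels by [level_sum]. This is the
    common core of the two Schur sums for kernels. *)
Lemma lattice_sum th : 1 < th -> th < 2 -> exists2 K : R, 0 < K &
  forall (s : seq (nat * int)) (m0 : nat) (t : R), uniq s ->
  \sum_(i <- s) th ^+ i.1 * (2 ^- i.1) ^+ 2 *
     ((2 ^- i.1 + 2 ^- m0 + `|i.2%:~R * 2 ^- i.1 - t|) ^+ 2)^-1 <= K * th ^+ m0.
Proof.
move=> t1 t2; have th0 : 0 < th := lt_trans ltr01 t1.
have p2 n : 0 < 2 ^- n :> R by rewrite invr_gt0 exprn_gt0.
exists (4 * ((th - 1)^-1 + (1 - th / 2)^-1)).
  by rewrite mulr_gt0 // addr_gt0 // invr_gt0 subr_gt0 // ltr_pdivrMr // mul1r.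
move=> s m0 t us.
pose M := \max_(i <- s) i.1.+1.
pose A := undup [seq i.2 | i <- s].
pose s' := [seq (m, a) | m <- iota 0 M, a <- A].
have sub : {subset s <= s'}.
  move=> i is_;
    have iM : (i.1 < M)%N by exact: (@leq_bigmax_seq _ s predT (fun i : nat * int => i.1.+1) i is_ isT).
  apply/allpairsP; exists i; rewrite mem_iota mem_undup; split => //.
    by apply: map_f.
  by case: (i).
have p0 m (a : int) : 0 < 2 ^- m + 2 ^- m0 + `|a%:~R * 2 ^- m - t|.
  by rewrite ltr_pwDl // addr_gt0.
apply: le_trans (uniq_sum_le us sub _) _ => [i|].
  by rewrite !mulr_ge0 ?exprn_ge0 ?invr_ge0 ?exprn_ge0 ?(ltW th0) // ltW.
rewrite big_allpairs /=.
have E (m : nat) : \sum_(a <- A) th ^+ m * (2 ^- m) ^+ 2 *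
     ((2 ^- m + 2 ^- m0 + `|a%:~R * 2 ^- m - t|) ^+ 2)^-1 <=
     4 * ((th / 2) ^+ m / (2 ^- m + 2 ^- m0)).
  rewrite -mulr_sumr.
  have := @inner_sum A (2 ^- m + 2 ^- m0) (2 ^- m) t (undup_uniq _) (p2 m).
  rewrite lerDl => /(_ (ltW (p2 m0))) H.
  have c0 : 0 <= th ^+ m * (2 ^- m) ^+ 2 by rewrite mulr_ge0 ?exprn_ge0 ?(ltW th0) // ltW.
  apply: le_trans (ler_wpM2l c0 H) _.
  rewrite le_eqVlt; apply/orP; left; apply/eqP; rewrite expr_div_n.
  have := p2 m; set x := 2 ^- m => x0; have := p2 m0; set y := 2 ^- m0 => y0.
  have -> : th ^+ m / 2 ^+ m = th ^+ m * x by [].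
  by field; rewrite !gt_eqF // addr_gt0.
apply: le_trans (ler_sum _ (fun m _ => E m)) _.
rewrite -mulr_sumr -mulrA ler_pM2l // -[X in iota _ X]subn0 -/(index_iota 0 M) big_mkord.
exact: level_sum.
Qed.

End DiscreteSums.

Arguments cabs : simpl never.

(** * Kernel denominators and the dyadic boxes of the disc *)

Section Boxes.
Variable R : realType.
Local Notation C := R[i].
Implicit Types (x y b : R * R).

(** By [kd_ge] and [kd_le] this is comparable to [1 - |b|] plus the distance from [b] to [x]. *)
Definition kd b x : R := cabs (1 - (toC b)^*%C * toC x).

Lemma cabsJ (z : C) : cabs z^*%C = cabs z.
Proof. by case: z => u v; rewrite /cabs /= sqrrN. Qed.

Lemma kd_sqr b x : kd b x ^+ 2 =
  (1 - cabs (toC b) ^+ 2) * (1 - cabs (toC x) ^+ 2) + cabs (toC b - toC x) ^+ 2.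
Proof.
rewrite /kd !cabs_sqr; case: b x => b1 b2 [x1 x2] /=.
by ring.
Qed.

Lemma kd_ge b x : discR2 b -> discR2 x ->
  [/\ 1 - cabs (toC b) <= kd b x, 1 - cabs (toC x) <= kd b x &
      cabs (toC b - toC x) <= kd b x].
Proof.
rewrite /discR2 /= => b1 x1.
have b0 := cabs_ge0 (toC b); have x0 := cabs_ge0 (toC x).
have k1 : 1 - cabs (toC b) * cabs (toC x) <= kd b x.
  rewrite lerBlDr /kd.
  have := cabsD (1 - (toC b)^*%C * toC x) ((toC b)^*%C * toC x).
  by rewrite subrK cabs1 cabsM cabsJ.
split.
- by apply: le_trans k1; rewrite lerD2l lerN2 ler_piMr // ltW.
- by apply: le_trans k1; rewrite lerD2l lerN2 ler_piMl // ltW.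
- rewrite -(ler_pXn2r (n := 2)) ?nnegrE ?cabs_ge0 //.
  by rewrite kd_sqr lerDr mulr_ge0 // subr_ge0 expr_le1 // ltW.
Qed.

Lemma kd_le b x : discR2 b -> kd b x <= 2 * (1 - cabs (toC b)) + cabs (toC b - toC x).
Proof.
rewrite /discR2 /= => b1; have b0 := cabs_ge0 (toC b).
have -> : 2 * (1 - cabs (toC b)) + cabs (toC b - toC x) =
   2 * (1 - cabs (toC b)) + 1 * cabs (toC b - toC x) by rewrite mul1r.
rewrite /kd.
have -> : 1 - (toC b)^*%C * toC x = (1 - (toC b)^*%C * toC b) + (toC b)^*%C * (toC b - toC x) by ring.
apply: le_trans (cabsD _ _) _; apply: lerD; last first.
  by rewrite cabsM cabsJ ler_wpM2r ?cabs_ge0 // ltW.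
have -> : 1 - (toC b)^*%C * toC b = Complex (1 - cabs (toC b) ^+ 2) 0.
  by rewrite cabs_sqr; case: (b) => b1' b2'; apply/eqP; rewrite eq_complex /=; apply/andP; split;
    apply/eqP; ring.
rewrite cabs_real ger0_norm ?subr_ge0 ?expr_le1 ?(ltW b1) //.
by rewrite -[1 in X in X <= _](expr1n _ 2) subr_sqr mulrC ler_wpM2r ?subr_ge0 ?(ltW b1) // lerD2l ltW.
Qed.

(** The flag [s] says that the first coordinate is the smaller one. Then [co] is the coordinate
    along the arc, and [dc] the dominant one, determined by [co], the modulus and a sign. *)
Definition co (s : bool) x := if s then x.1 else x.2.
Definition dc (s : bool) x := if s then x.2 else x.1.

Lemma co_le s x y : `|co s x - co s y| <= cabs (toC x - toC y).
Proof. by case: s; [exact: (cabs_Re (toC x - toC y)) | exact: (cabs_Im (toC x - toC y))]. Qed.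

Lemma cabs_co_dc s x : cabs (toC x) ^+ 2 = co s x ^+ 2 + dc s x ^+ 2.
Proof. by rewrite cabs_sqr; case: s => //=; rewrite addrC. Qed.

Lemma cabs_sub_co_dc s x y : cabs (toC x - toC y) <= `|co s x - co s y| + `|dc s x - dc s y|.
Proof.
have := cabs_le_ReIm (toC x - toC y).
rewrite (_ : Re (toC x - toC y) = x.1 - y.1) // (_ : Im (toC x - toC y) = x.2 - y.2) // => h.
by case: s; rewrite /co /dc; [exact: h | rewrite [leRHS]addrC; exact: h].
Qed.

Definition bidx : Type := (bool * bool * nat * int)%type.

Definition lv (j : bidx) : nat := j.1.2.
Definition dm (j : bidx) : R := 2 ^- lv j.

Lemma dm_gt0 j : 0 < dm j. Proof. by rewrite invr_gt0 exprn_gt0. Qed.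

(* A box is indexed by which coordinate is the smaller one in absolute value, the
   sign of the other one ([dc]), the dyadic distance to the circle ([lv]), and the
   position of the smaller coordinate ([co]) in a grid of the same scale. *)
Definition box (j : bidx) : set (R * R) := [set x | [/\ discR2 x,
  (`|x.1| <= `|x.2|) = j.1.1.1, (0 <= dc j.1.1.1 x) = j.1.1.2,
  dm j / 2 < 1 - cabs (toC x) <= dm j &
  j.2%:~R * dm j <= co j.1.1.1 x < (j.2 + 1)%:~R * dm j]].

Lemma dyadic_level (t : R) : 0 < t -> t <= 1 -> exists m, 2 ^- m / 2 < t <= 2 ^- m.
Proof.
move=> t0 t1.
have ex : exists m, 2 ^- m / 2 < t.
  have := archi_boundP (ltW (divr_gt0 ltr01 t0)); set m := Num.bound _ => h.
  exists m; apply: (@lt_trans _ _ (2 ^- m)).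
    by rewrite ltr_pdivrMr // ltr_pMr ?ltr1n // invr_gt0 exprn_gt0.
  rewrite invf_plt ?posrE ?exprn_gt0 //; rewrite div1r in h; apply: lt_trans h _.
  by rewrite -natrX ltr_nat ltn_expl.
case: (ex_minnP ex) => m Hm Hmin; exists m; rewrite Hm /=.
case: m Hm Hmin => [|m] Hm Hmin; first by rewrite expr0 invr1.
rewrite leNgt; apply/negP => h; have := Hmin m.
rewrite -invfM mulrC -exprS => /(_ h); by rewrite ltnn.
Qed.

Lemma box_cover x : discR2 x -> exists j, box j x.
Proof.
move=> dx; have t0 : 0 < 1 - cabs (toC x) by rewrite subr_gt0.
have t1 : 1 - cabs (toC x) <= 1 by rewrite gerBl cabs_ge0.
have [m Hm] := dyadic_level t0 t1.
have p : 0 < 2 ^- m :> R by rewrite invr_gt0 exprn_gt0.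
pose s := (`|x.1| <= `|x.2|).
exists (s, 0 <= dc s x, m, Num.floor (co s x / 2 ^- m)); split => //.
by rewrite /dm /lv /= -ler_pdivlMr // -ltr_pdivrMr // floor_le_tmp floorD1_gt.
Qed.

Lemma dyadic_level_uniq (m m' : nat) (t : R) : 2 ^- m / 2 < t <= 2 ^- m ->
  2 ^- m' / 2 < t <= 2 ^- m' -> m = m'.
Proof.
have H (k k' : nat) : 2 ^- k / 2 < t -> t <= 2 ^- k' -> (k' <= k)%N.
  move=> h1 h2; rewrite leqNgt; apply/negP => kk.
  have := lt_le_trans h1 h2; rewrite -invfM -exprSr ltf_pV2 ?posrE ?exprn_gt0 //.
  by rewrite ltr_eXn2l ?ltr1n // ltnS leqNgt kk.
by move=> /andP[a b] /andP[c d]; apply/eqP; rewrite eqn_leq (H m' m) // (H m m').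
Qed.

Lemma box_uniq i j x : box i x -> box j x -> i = j.
Proof.
case: i j => [[[s b] m] a] [[[s' b'] m'] a'] [_ h1 h2 h3 h4] [_ k1 k2 k3 k4].
have es : s' = s := etrans (esym k1) h1.
move: k2 k3 k4; rewrite {}es => k2 k3 k4.
have eb : b' = b := etrans (esym k2) h2.
have em : m' = m by exact: (dyadic_level_uniq k3 h3).
move: h4 k4; rewrite eb em => /andP[h4 h5] /andP[k4 k5]; congr (_, _).
have p : 0 < dm (s, b, m, a) := dm_gt0 _.
have l1 : a%:~R * dm (s, b, m, a) < (a' + 1)%:~R * dm (s, b, m, a) := le_lt_trans h4 k5.
have l2 : a'%:~R * dm (s, b, m, a) < (a + 1)%:~R * dm (s, b, m, a) := le_lt_trans k4 h5.
move: l1 l2; rewrite !(ltr_pM2r p) !ltr_int => l1 l2.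
by apply/eqP; rewrite eq_le; apply/andP; split; rewrite -ltzD1.
Qed.

Lemma lip_measurable (F : R * R -> R) (L : R) : 0 < L ->
  (forall x y, `|F y - F x| <= L * (`|y.1 - x.1| + `|y.2 - x.2|)) ->
  measurable [set x | 0 < F x] /\ measurable [set x | 0 <= F x].
Proof.
move=> L0 H.
have op (G : R * R -> R) : (forall x y, `|G y - G x| <= L * (`|y.1 - x.1| + `|y.2 - x.2|)) ->
    measurable [set x | 0 < G x].
  move=> HG; apply: open2_measurable => x /= Gx.
  exists (G x / (2 * L)); first by rewrite divr_gt0 // mulr_gt0.
  move=> y h1 h2; have := HG x y.
  rewrite ler_norml => /andP[h3 _].
  rewrite ltr_pdivlMr ?mulr_gt0 // in h1; rewrite ltr_pdivlMr ?mulr_gt0 // in h2.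
  by rewrite /=; move: h1 h2 h3; clear; lra.
split; first exact: op.
rewrite (_ : [set x | 0 <= F x] = ~` [set x | 0 < - F x]).
  apply: measurableC; apply: op => x y.
  by rewrite -normrN opprB opprK addrC.
by apply/seteqP; split => x /=; rewrite oppr_gt0 leNgt => /negP.
Qed.

Lemma normr_lip (u v : R) : `| `|u| - `|v| | <= `|u - v|.
Proof. exact: ler_dist_dist. Qed.

Lemma measurable_box j : measurable (box j).
Proof.
have m1 : measurable [set x : R * R | (`|x.1| <= `|x.2|) = j.1.1.1].
  have [h1 h2] : measurable [set x : R * R | 0 < `|x.1| - `|x.2|] /\
     measurable [set x : R * R | 0 <= `|x.1| - `|x.2|].
    apply: (@lip_measurable _ 1) => // x y; rewrite mul1r.
    have -> : `|y.1| - `|y.2| - (`|x.1| - `|x.2|) = (`|y.1| - `|x.1|) - (`|y.2| - `|x.2|) by ring.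
    by apply: le_trans (ler_normB _ _) _; rewrite lerD // normr_lip.
  case: j.1.1.1.
    rewrite (_ : [set x | _] = ~` [set x : R * R | 0 < `|x.1| - `|x.2|]).
      exact: measurableC.
    by apply/seteqP; split => x /=; rewrite subr_gt0 ltNge; [move=> -> | move=> /negP; rewrite negbK].
  rewrite (_ : [set x | _] = [set x : R * R | 0 < `|x.1| - `|x.2|]) //.
  by apply/seteqP; split => x /=; rewrite subr_gt0 ltNge; [move=> -> | move=> /negbTE].
have m2 : measurable [set x : R * R | (0 <= dc j.1.1.1 x) = j.1.1.2].
  have [_ h2] : measurable [set x : R * R | 0 < dc j.1.1.1 x] /\
     measurable [set x : R * R | 0 <= dc j.1.1.1 x].
    apply: (@lip_measurable _ 1) => // x y; rewrite mul1r.
    by case: (j.1.1.1) => /=; rewrite ?lerDl ?lerDr.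
  case: j.1.1.2; first exact: h2.
  rewrite (_ : [set x | _] = ~` [set x : R * R | 0 <= dc j.1.1.1 x]); first exact: measurableC.
  by apply/seteqP; split => x /=; [move=> -> | move=> /negP/negbTE].
have lipc k x y : `|k - cabs (toC y) - (k - cabs (toC x))| <= 1 * (`|y.1 - x.1| + `|y.2 - x.2|).
  rewrite mul1r (_ : _ - _ - _ = - (cabs (toC y) - cabs (toC x))); last by ring.
  by rewrite normrN; apply: le_trans (cabs_lip _ _) _; exact: toC_lip.
have lipc' k x y : `|cabs (toC y) - k - (cabs (toC x) - k)| <= 1 * (`|y.1 - x.1| + `|y.2 - x.2|).
  rewrite mul1r (_ : _ - _ - _ = (cabs (toC y) - cabs (toC x))); last by ring.
  by apply: le_trans (cabs_lip _ _) _; exact: toC_lip.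
have lipo k x y : `|co j.1.1.1 y - k - (co j.1.1.1 x - k)| <= 1 * (`|y.1 - x.1| + `|y.2 - x.2|).
  rewrite mul1r (_ : _ - _ - _ = co j.1.1.1 y - co j.1.1.1 x); last by ring.
  by case: (j.1.1.1) => /=; rewrite ?lerDl ?lerDr.
have lipo' k x y : `|k - co j.1.1.1 y - (k - co j.1.1.1 x)| <= 1 * (`|y.1 - x.1| + `|y.2 - x.2|).
  rewrite mul1r (_ : _ - _ - _ = - (co j.1.1.1 y - co j.1.1.1 x)); last by ring.
  by rewrite normrN; case: (j.1.1.1) => /=; rewrite ?lerDl ?lerDr.
have [m3 _] := lip_measurable ltr01 (lipc (1 - dm j / 2)).
have [_ m4] := lip_measurable ltr01 (lipc' (1 - dm j)).
have [_ m5] := lip_measurable ltr01 (lipo (j.2%:~R * dm j)).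
have [m6 _] := lip_measurable ltr01 (lipo' ((j.2 + 1)%:~R * dm j)).
have -> : box j = @discR2 R `&` [set x : R * R | (`|x.1| <= `|x.2|) = j.1.1.1] `&`
   [set x : R * R | (0 <= dc j.1.1.1 x) = j.1.1.2] `&`
   [set x | 0 < 1 - dm j / 2 - cabs (toC x)] `&` [set x | 0 <= cabs (toC x) - (1 - dm j)] `&`
   [set x | 0 <= co j.1.1.1 x - j.2%:~R * dm j] `&` [set x | 0 < (j.2 + 1)%:~R * dm j - co j.1.1.1 x].
  apply/seteqP; split => x /=.
    case=> a1 a2 a3 /andP[a4 a5] /andP[a6 a7]; rewrite !subr_ge0 !subr_gt0.
    by do !split => //; move: a4 a5; clear; lra.
  rewrite !subr_ge0 !subr_gt0 => -[[[[[[a1 a2] a3] a4] a5] a6] a7].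
  by split => //; apply/andP; split => //; move: a4 a5; clear; lra.
do 6! (apply: measurableI => //); exact: measurable_discR2.
Qed.

End Boxes.

(** * Diameters of boxes, test points, and sums of kernels *)

Section BoxGeometry.
Variable R : realType.
Implicit Types (x y b z : R * R) (i j : bidx).

(** The difference of the squares of [e] and [e'] is [(n - n') * (n + n') - (c - c') * (c + c')], at
    most [3 * h] in modulus. The dominant coordinates have equal sign and modulus at least 1/3, so
    dividing by [|e| + |e'|] loses at most a factor 3/2. *)
Lemma box_arith (h c e c' e' n n' : R) : 0 < h -> 1 / 2 <= n -> n <= 1 ->
  1 / 2 <= n' -> n' <= 1 -> `|n - n'| <= h / 2 -> `|c - c'| <= h ->
  c ^+ 2 <= e ^+ 2 -> c' ^+ 2 <= e' ^+ 2 -> (0 <= e) = (0 <= e') ->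
  n ^+ 2 = c ^+ 2 + e ^+ 2 -> n' ^+ 2 = c' ^+ 2 + e' ^+ 2 -> `|e - e'| <= 5 * h.
Proof.
move=> h0 n1 n2 n1' n2' nn cc ce ce' sg N N'.
have big (a c0 m : R) : 1 / 2 <= m -> c0 ^+ 2 <= a ^+ 2 -> m ^+ 2 = c0 ^+ 2 + a ^+ 2 -> 1 / 3 <= `|a|.
  move=> m1 ca M; rewrite leNgt; apply/negP => a3.
  have a0 := normr_ge0 a.
  have : `|a| ^+ 2 < (1 / 3) ^+ 2 by rewrite ltr_pXn2r // nnegrE; lra.
  rewrite real_normK ?num_real // => a4.
  have : (1 / 2) ^+ 2 <= m ^+ 2 by rewrite ler_pXn2r // nnegrE; lra.
  move: M ca a4; clear; lra.
have small (a c0 m : R) : 0 <= m -> m <= 1 -> m ^+ 2 = c0 ^+ 2 + a ^+ 2 -> `|c0| <= 1.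
  move=> m0 m1 M; rewrite -(ler_pXn2r (n := 2)) ?nnegrE // real_normK ?num_real //.
  have : m ^+ 2 <= 1 ^+ 2 by rewrite ler_pXn2r // nnegrE.
  have := sqr_ge0 a; move: M; clear; lra.
have E3 := big _ _ _ n1 ce N; have E3' := big _ _ _ n1' ce' N'.
have c1 : `|c| <= 1 by apply: (small e c n) => //; lra.
have c1' : `|c'| <= 1 by apply: (small e' c' n') => //; lra.
have -> : `|e - e'| = `| `|e| - `|e'| |.
  have [e0|e0] := leP 0 e.
    by have := sg; rewrite e0 => /esym e0'; rewrite (ger0_norm e0) (ger0_norm e0').
  have e0' : e' < 0 by move: sg; rewrite leNgt e0 /= => /esym/negbT; rewrite -ltNge.
  by rewrite (ltr0_norm e0) (ltr0_norm e0') -opprD normrN.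
have key : `| `|e| - `|e'| | * (`|e| + `|e'|) <= 3 * h.
  rewrite -[X in _ * X]ger0_norm ?addr_ge0 // -normrM -subr_sqr !real_normK ?num_real //.
  have -> : e ^+ 2 - e' ^+ 2 = (n - n') * (n + n') - (c - c') * (c + c').
    by rewrite -!subr_sqr N N'; ring.
  apply: le_trans (ler_normB _ _) _; rewrite !normrM.
  have k1 : `|n - n'| * `|n + n'| <= h / 2 * 2.
    by apply: ler_pM => //; rewrite ger0_norm; lra.
  have k2 : `|c - c'| * `|c + c'| <= h * 2.
    by apply: ler_pM => //; apply: le_trans (ler_normD _ _) _; lra.
  by move: k1 k2; clear; lra.
set A := `|_| in key *; have A0 : 0 <= A by exact: normr_ge0.
have : A * (2 / 3) <= A * (`|e| + `|e'|) by rewrite ler_wpM2l //; lra.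
by move: key; move: (A * _) => X; lra.
Qed.

Lemma box_close j x y : box j x -> box j y -> cabs (toC x - toC y) <= 6 * dm R j.
Proof.
move=> [dx h1 h2 /andP[h3 h4] /andP[h5 h6]] [dy k1 k2 /andP[k3 k4] /andP[k5 k6]].
have d0 := @dm_gt0 R j.
have cx := cabs_ge0 (toC x); have cy := cabs_ge0 (toC y).
have dx1 : cabs (toC x) < 1 := dx; have dy1 : cabs (toC y) < 1 := dy.
set s := j.1.1.1 in h1 h2 h5 h6 k1 k2 k5 k6.
have cc : `|co s x - co s y| <= dm R j.
  by move: h5 h6 k5 k6; rewrite intrD mulrDl mul1r ler_norml => ? ? ? ?; apply/andP; split; lra.
have dom z : (`|z.1| <= `|z.2|) = s -> co s z ^+ 2 <= dc s z ^+ 2.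
  rewrite -[co s z ^+ 2]real_normK ?num_real // -[dc s z ^+ 2]real_normK ?num_real //.
  by case: s {h1 h2 h5 h6 k1 k2 k5 k6 cc} => H; rewrite ler_pXn2r ?nnegrE //= ltW // ltNge H.
have [m0|m0] := posnP (lv j).
  have -> : dm R j = 1 by rewrite /dm m0 expr0 invr1.
  by apply: le_trans (cabsD _ _) _; rewrite cabsN; lra.
have dh : dm R j <= 1 / 2.
  rewrite /dm -(prednK m0) exprS invfM div1r ler_piMr ?invr_ge0 //.
  by rewrite invf_le1 ?exprn_gt0 // exprn_ege1 // ler1n.
have ee : `|dc s x - dc s y| <= 5 * dm R j.
  apply: (box_arith (n := cabs (toC x)) (n' := cabs (toC y)) d0 _ _ _ _ _ cc).
  - lra.
  - lra.
  - lra.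
  - lra.
  - by rewrite ler_norml; apply/andP; split; lra.
  - exact: dom.
  - exact: dom.
  - by rewrite h2 k2.
  - exact: cabs_co_dc.
  - exact: cabs_co_dc.
apply: le_trans (cabs_sub_co_dc s _ _) _; lra.
Qed.

(** The point that represents the box in the kernels. Its modulus is kept away from 0 because powers
    of its conjugate, produced by differentiation, are divided out later; at level 0 it may
    therefore lie outside the box. *)
Definition test_pt j b := [/\ discR2 b, dm R j / 2 <= 1 - cabs (toC b) <= dm R j,
  1 / 4 <= cabs (toC b), `|co j.1.1.1 b - j.2%:~R * dm R j| <= 3 * dm R j &
  forall z, box j z -> cabs (toC z - toC b) <= 6 * dm R j].

Lemma test_pt_exists j : box (R := R) j !=set0 -> exists b, test_pt j b.
Proof.
move=> [x bx]; have d0 := @dm_gt0 R j; have [dx h1 h2 /andP[h3 h4] /andP[h5 h6]] := bx.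
have dx1 : cabs (toC x) < 1 := dx.
have [m0|m0] := posnP (lv j).
  have d1 : dm R j = 1 by rewrite /dm m0 expr0 invr1.
  have ab : cabs (toC (1 / 2, 0 : R)) = 1 / 2 by rewrite /toC cabs_real ger0_norm ?divr_ge0.
  (* One point serves all nonempty boxes of level 0; at higher levels any point of the box will
     do. *)
  exists (1 / 2, 0); rewrite /test_pt /discR2 /= ab d1; split; try lra.
  - have cx : `|co j.1.1.1 x| <= cabs (toC x).
      by case: (j.1.1.1); [exact: (cabs_Re (toC x)) | exact: (cabs_Im (toC x))].
    move: h5 h6 cx; rewrite d1 !mulr1 ler_norml intrD => h5 h6 /andP[c1 c2].
    have cb : 0 <= co j.1.1.1 (1 / 2, 0 : R) <= 1 / 2 by case: (j.1.1.1) => /=; apply/andP; split; lra.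
    by move: cb => /andP[? ?]; rewrite ler_norml; apply/andP; split; lra.
  - move=> z [dz _ _ _ _]; have dz1 : cabs (toC z) < 1 := dz.
    by apply: le_trans (cabsD _ _) _; rewrite cabsN ab; lra.
have dh : dm R j <= 1 / 2.
  rewrite /dm -(prednK m0) exprS invfM div1r ler_piMr ?invr_ge0 //.
  by rewrite invf_le1 ?exprn_gt0 // exprn_ege1 // ler1n.
exists x; split => //.
- by rewrite (ltW h3) h4.
- lra.
- move: h5 h6; rewrite intrD mulrDl mul1r => h5 h6.
  by rewrite ler_norml; apply/andP; split; lra.
- by move=> z bz; exact: box_close bz bx.
Qed.

Definition uker b j z : R := dm R j / kd b z.

Lemma kd_gt0 b z : discR2 b -> discR2 z -> 0 < kd b z.
Proof.
move=> db dz; have [h _ _] := kd_ge db dz; apply: lt_le_trans h.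
by rewrite subr_gt0.
Qed.

Lemma uker_ge0 b j z : 0 <= uker b j z.
Proof. by rewrite divr_ge0 ?cabs_ge0 // ltW // dm_gt0. Qed.

(** A minorant of [kd], up to the factor 24, with the test point replaced by the grid position of
    [j]: exactly the shape of the terms in [lattice_sum]. *)
Definition rho1 i j z : R := dm R j + dm R i + `|j.2%:~R * dm R j - co j.1.1.1 z|.

Lemma rho1_gt0 i j z : 0 < rho1 i j z.
Proof. by rewrite ltr_pwDl // addr_gt0 // dm_gt0. Qed.

Lemma uker_le1 i j b z : test_pt j b -> box i z -> uker b j z <= 24 * (dm R j / rho1 i j z).
Proof.
move=> [db /andP[b1 b2] _ cb _] [dz _ _ /andP[z1 z2] _].
have [k1 k2 k3] := kd_ge db dz.
have k4 := co_le j.1.1.1 b z; have p := rho1_gt0 i j z.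
rewrite /uker mulrCA ler_wpM2l ?(ltW (dm_gt0 _ _)) //.
rewrite invf_ple ?posrE ?kd_gt0 //; last by rewrite divr_gt0.
rewrite invf_div ler_pdivrMr // /rho1.
set t := j.2%:~R * dm R j in cb *; set s := j.1.1.1 in cb k4 *.
have : `|t - co s z| <= `|co s b - t| + `|co s b - co s z|.
  by rewrite distrC -[`|co s b - co s z|]distrC [leRHS]addrC; exact: ler_distD.
lra.
Qed.

(** Here the grid of the other box [i] is used: the bound is the same for all [z] in box [i] and can
    be summed over [i]. *)
Lemma uker_le2 i j b z : test_pt j b -> box i z -> uker b j z <= 24 * (dm R j / rho1 j i b).
Proof.
move=> [db /andP[b1 b2] _ cb _] [dz _ _ /andP[z1 z2] /andP[z3 z4]].
have [k1 k2 k3] := kd_ge db dz.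
have k4 := co_le i.1.1.1 b z; have p := rho1_gt0 j i b.
rewrite /uker mulrCA ler_wpM2l ?(ltW (dm_gt0 _ _)) //.
rewrite invf_ple ?posrE ?kd_gt0 //; last by rewrite divr_gt0.
rewrite invf_div ler_pdivrMr // /rho1.
move: z3 z4; rewrite intrD mulrDl mul1r.
set t := i.2%:~R * dm R i; set s := i.1.1.1 in k4 * => z3 z4.
have : `|t - co s b| <= `|t - co s z| + `|co s b - co s z|.
  by rewrite -[`|co s b - co s z|]distrC; exact: ler_distD.
have : `|t - co s z| <= dm R i by rewrite ler_norml; apply/andP; split; lra.
lra.
Qed.

Lemma uker_ge j b z : test_pt j b -> box j z -> 1 / 8 <= uker b j z.
Proof.
move=> [db /andP[b1 b2] _ cb H] bz; have [dz _ _ _ _] := bz.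
have k := kd_le z db; have := H _ bz; rewrite cabsB => h.
by rewrite /uker ler_pdivlMr ?kd_gt0 //; lra.
Qed.

(** The factor 4 counts the values of the two flags; what remains of an index is a level and a
    position. *)
Lemma bidx_sum_le (F : bidx -> R) (B : R) : (forall j, 0 <= F j) ->
  (forall s c (l : seq (nat * int)), uniq l -> \sum_(p <- l) F (s, c, p.1, p.2) <= B) ->
  forall l : seq bidx, uniq l -> \sum_(j <- l) F j <= 4 * B.
Proof.
move=> F0 H l ul.
pose P := undup [seq (lv j, j.2) | j : bidx <- l].
pose T := [:: (true, true); (true, false); (false, true); (false, false)].
have sub : {subset l <= [seq (t.1, t.2, p.1, p.2) | t <- T, p <- P]}.
  move=> j jl; apply/allpairsP; exists (j.1.1, (lv j, j.2)); split => //=.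
  - by case: (j.1.1) => -[] [].
  - by rewrite mem_undup; apply: (map_f (fun j : bidx => (lv j, j.2))).
  - by case: (j) => [[[? ?] ?] ?].
apply: le_trans (uniq_sum_le ul sub F0) _.
rewrite big_allpairs_dep /= !big_cons big_nil addr0.
have uP : uniq P by exact: undup_uniq.
have := H true true P uP; have := H true false P uP.
have := H false true P uP; have := H false false P uP.
lra.
Qed.

(* Together with [kernel_sum2], a Schur test with the weight [th ^+ lv]. *)
Lemma kernel_sum1 (th : R) : 1 < th -> th < 2 -> exists2 K : R, 0 < K &
  forall (bp : bidx -> R * R) (l : seq bidx), uniq l -> (forall j, j \in l -> test_pt j (bp j)) ->
  forall i z, box i z -> \sum_(j <- l) th ^+ lv j * uker (bp j) j z ^+ 2 <= K * th ^+ lv i.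
Proof.
move=> t1 t2; have th0 : 0 < th := lt_trans ltr01 t1.
have [K K0 HK] := lattice_sum t1 t2.
exists (4 * (24 ^+ 2 * K)); first by rewrite !mulr_gt0.
move=> bp l ul Hl i z bz.
pose F j := 24 ^+ 2 * (th ^+ lv j * dm R j ^+ 2 * (rho1 i j z ^+ 2)^-1).
apply: (@le_trans _ _ (\sum_(j <- l) F j)).
  rewrite big_seq [leRHS]big_seq; apply: ler_sum => j jl.
  have := uker_le1 (Hl j jl) bz => h.
  have -> : F j = th ^+ lv j * (24 * (dm R j / rho1 i j z)) ^+ 2.
    by rewrite /F; field; rewrite gt_eqF // rho1_gt0.
  rewrite ler_wpM2l ?exprn_ge0 ?(ltW th0) // ler_pXn2r // nnegrE ?uker_ge0 //.
  by apply: le_trans h; exact: uker_ge0.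
rewrite -mulrA; apply: bidx_sum_le => // [j|s c m um].
  by rewrite !mulr_ge0 ?exprn_ge0 ?invr_ge0 ?exprn_ge0 ?(ltW th0) // ltW ?dm_gt0 // rho1_gt0.
rewrite -mulr_sumr -mulrA ler_pM2l ?exprn_gt0 //.
exact: (HK m (lv i) (co s z) um).
Qed.

Lemma kernel_sum2 (th : R) : 1 < th -> th < 2 -> exists2 K : R, 0 < K &
  forall j b (l : seq bidx), uniq l ->
  \sum_(i <- l) th ^+ lv i * dm R i ^+ 2 * (24 * (dm R j / rho1 j i b)) ^+ 2 <=
    K * (th ^+ lv j * dm R j ^+ 2).
Proof.
move=> t1 t2; have th0 : 0 < th := lt_trans ltr01 t1.
have [K K0 HK] := lattice_sum t1 t2.
exists (4 * (24 ^+ 2 * K)); first by rewrite !mulr_gt0.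
move=> j b l ul.
pose F i := (24 * dm R j) ^+ 2 * (th ^+ lv i * dm R i ^+ 2 * (rho1 j i b ^+ 2)^-1).
apply: (@le_trans _ _ (\sum_(i <- l) F i)).
  apply: ler_sum => i _; rewrite le_eqVlt; apply/orP; left; apply/eqP.
  by rewrite /F; field; rewrite gt_eqF // rho1_gt0.
have -> : 4 * (24 ^+ 2 * K) * (th ^+ lv j * dm R j ^+ 2) =
   4 * ((24 * dm R j) ^+ 2 * (K * th ^+ lv j)) by ring.
apply: bidx_sum_le => // [i|s c m um].
  by rewrite !mulr_ge0 ?exprn_ge0 ?invr_ge0 ?exprn_ge0 ?(ltW th0) ?mulr_ge0 // ltW ?dm_gt0 // rho1_gt0.
rewrite -mulr_sumr ler_pM2l ?exprn_gt0 ?mulr_gt0 ?dm_gt0 //.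
exact: (HK m (lv j) (co s b) um).
Qed.

End BoxGeometry.

(** * Integrals over countable partitions and over overlapping families *)

Section GenericIntegrals.
Context (R : realType) (d : measure_display) (T : measurableType d).
Variable m : {measure set T -> \bar R}.

(** Countable additivity along [pickle_inv], codes without an index giving the empty set. It reduces
    the integrals over the disc to finite families of boxes. *)
Lemma countable_integral_bound (I : countType) (Q : I -> set T) (D : set T) (F : T -> R)
    (M : \bar R) : (forall i, measurable (Q i)) ->
  (forall i j x, Q i x -> Q j x -> i = j) -> (forall x, D x <-> exists i, Q i x) ->
  measurable_fun D F -> (forall x, 0 <= F x) ->
  (forall l : seq I, uniq l -> (\sum_(i <- l) \int[m]_(x in Q i) (F x)%:E <= M)%E) ->
  (\int[m]_(x in D) (F x)%:E <= M)%E.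
Proof.
move=> mQ dis cov mF F0 H.
pose P k := if @pickle_inv I k is Some i then Q i else set0.
have DP : D = \bigcup_k P k.
  apply/seteqP; split => x.
    by move=> /cov[i Qi]; exists (pickle i) => //; rewrite /P pickleK_inv.
  by move=> [k _]; rewrite /P; case: pickle_inv => // i Qi; apply/cov; exists i.
have mP k : measurable (P k) by rewrite /P; case: pickle_inv.
have trP : trivIset setT P.
  apply/trivIsetP => k k' _ _ kk; apply/seteqP; split => // x [].
  rewrite /P; case ek : (@pickle_inv I k) => [i|] //; case ek' : (@pickle_inv I k') => [i'|] //.
  move=> h h'; have E := dis _ _ _ h h'; move: kk; apply/negP; rewrite negbK; apply/eqP.
  have := pickle_invK (T := I) k; rewrite ek /= => <-.
  by have := pickle_invK (T := I) k'; rewrite ek' /= => <-; rewrite E.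
rewrite DP ge0_integral_bigcup //; last 2 first.
- by rewrite -DP; exact/measurable_EFinP.
- by move=> x _; rewrite lee_fin.
have n0 k : (0 <= \int[m]_(x in P k) (F x)%:E)%E.
  by apply: integral_ge0 => x _; rewrite lee_fin.
apply: lime_le; first by apply: is_cvg_nneseries => k _ _; exact: n0.
apply: nearW => n.
have := H (pmap (@pickle_inv I) (iota 0 n)).
have u : uniq (pmap (@pickle_inv I) (iota 0 n)).
  by apply: (pmap_uniq (@pickle_invK I)); exact: iota_uniq.
move=> /(_ u); apply: le_trans; rewrite le_eqVlt; apply/orP; left; apply/eqP.
rewrite /index_iota subn0; elim: (iota 0 n) => [|k s IH]; first by rewrite !big_nil.
rewrite big_cons IH /= /P; case: (@pickle_inv I k) => [i|] /=; first by rewrite big_cons.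
by rewrite integral_set0 add0e.
Qed.

Lemma overlap_integral (I : Type) (l : seq I) (E : I -> set T) (D : set T) (F : T -> R) (N : R) :
  measurable D -> (forall i, measurable (E i)) -> measurable_fun D F -> (forall x, 0 <= F x) ->
  0 <= N -> (forall x, D x -> \sum_(i <- l) \1_(E i) x <= N) ->
  (\sum_(i <- l) \int[m]_(x in D `&` E i) (F x)%:E <= N%:E * \int[m]_(x in D) (F x)%:E)%E.
Proof.
move=> mD mE mF F0 N0 H.
have mF' : measurable_fun D (fun x => (F x)%:E) by exact/measurable_EFinP.
have e i : (\int[m]_(x in D `&` E i) (F x)%:E = \int[m]_(x in D) (F x * \1_(E i) x)%:E)%E.
  rewrite integral_mkcondr; apply: eq_integral => x _; rewrite /patch indicE.
  by case: ifP; rewrite ?mulr1 ?mulr0.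
under eq_bigr do rewrite e.
have mi i : measurable_fun D (fun x => (F x * \1_(E i) x)%:E).
  by apply/measurable_EFinP; apply: measurable_funM => //; exact: measurable_indic.
rewrite -ge0_integral_sum //; last first.
  by move=> i x _; rewrite lee_fin mulr_ge0.
rewrite -ge0_integralZl //; last by move=> x _; rewrite lee_fin.
apply: ge0_le_integral => //.
- by move=> x _; apply: sume_ge0 => i _; rewrite lee_fin mulr_ge0.
- exact: emeasurable_sum.
- exact: measurable_funeM.
- move=> x Dx; rewrite sumEFin -EFinM lee_fin -mulr_sumr mulrC ler_wpM2r //.
  exact: H.
Qed.

End GenericIntegrals.

(** * The Bergman norm of a sum of kernels *)

Section AtomNorm.
Variable R : realType.
Implicit Types (x y b z : R * R) (i j : bidx).

Lemma powR_gt1 (a p : R) : 0 < p -> 1 < a -> 1 < a `^ p.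
Proof.
move=> p0 a1; have a0 : 0 < a := lt_trans ltr01 a1.
rewrite ltNge; apply/negP => h.
have := @ge0_ler_powR R p^-1; rewrite invr_ge0 (ltW p0) => /(_ isT (a `^ p) 1).
rewrite !nnegrE powR_ge0 ler01 => /(_ isT isT h).
by rewrite powRK ?(ltW a0) // powR1 leNgt a1.
Qed.

(** In [atom_norm] the weight has base [th] before, and its p-th power after, raising to the power
    [p]; each must be admissible for a kernel sum. *)
Lemma base_exists (p : R) : 0 < p -> exists th : R, [/\ 1 < th, th < 2, 1 < th `^ p & th `^ p < 2].
Proof.
move=> p0; have h1 : 1 < 3 / 2 :> R by rewrite ltr_pdivlMr // mul1r ltr_nat.
have h2 : 3 / 2 < 2 :> R by rewrite ltr_pdivrMr // -natrM ltr_nat.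
have h3 : 0 <= 3 / 2 :> R by rewrite divr_ge0.
have [p1|p1] := leP 1 p.
  exists ((3 / 2) `^ p^-1); rewrite powRVK //; split => //.
    by apply: powR_gt1 => //; rewrite invr_gt0.
  by apply: le_lt_trans h2; apply: ler1_powR; [exact: ltW | rewrite invf_le1].
exists (3 / 2); split => //; first exact: powR_gt1.
by apply: le_lt_trans h2; apply: ler1_powR; exact: ltW.
Qed.

Lemma powR_exprn (a p : R) n : 0 <= a -> (a ^+ n) `^ p = (a `^ p) ^+ n.
Proof. by move=> a0; rewrite -powR_mulrn // powRAC powR_mulrn ?powR_ge0. Qed.

Lemma powR_sum_ge (I : eqType) (l : seq I) (W : I -> R) (p : R) (i : I) : 0 < p ->
  (forall k, 0 <= W k) -> i \in l -> W i <= (\sum_(k <- l) W k `^ p) `^ p^-1.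
Proof.
move=> p0 W0 il; rewrite -{1}(powRK p0 (W0 i)).
rewrite ge0_ler_powR ?invr_ge0 ?(ltW p0) ?nnegrE ?powR_ge0 //.
  by apply: sumr_ge0 => k _; exact: powR_ge0.
rewrite (big_rem i) //= lerDl; apply: sumr_ge0 => k _; exact: powR_ge0.
Qed.

Lemma box_disc j x : box j x -> discR2 x.
Proof. by case. Qed.

Lemma leb2_box j : (leb2m R (box j) <= ((12 * dm R j) ^+ 2)%:E)%E.
Proof.
have d0 := @dm_gt0 R j.
have [->|/set0P[x bx]] := eqVneq (box (R := R) j) set0.
  by rewrite measure0 lee_fin sqr_ge0.
have -> : 12 * dm R j = 2 * (6 * dm R j) by ring.
rewrite -(leb2_sq2 x); last by rewrite mulr_ge0 // ltW.
apply: le_measure; rewrite ?inE.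
- exact: measurable_box.
- exact: measurable_sq2.
move=> y bY; have h := box_close bY bx; apply/sq2P; split.
  by apply: le_trans h; exact: (cabs_Re (toC y - toC x)).
by apply: le_trans h; exact: (cabs_Im (toC y - toC x)).
Qed.

Lemma int_box_le j (F : R * R -> R) (c : R) : 0 <= c -> (forall x, 0 <= F x) ->
  measurable_fun (@discR2 R) F -> (forall x, box j x -> F x <= c) ->
  (\int[leb2m R]_(x in box j) (F x)%:E <= (c * (12 * dm R j) ^+ 2)%:E)%E.
Proof.
move=> c0 F0 mF H.
apply: (@le_trans _ _ (\int[leb2m R]_(x in box j) (cst c%:E) x)%E).
  apply: ge0_le_integral.
  - exact: measurable_box.
  - by move=> x _; rewrite lee_fin.
  - apply/measurable_EFinP; apply: (measurable_funS _ (@box_disc j) mF).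
    exact: measurable_discR2.
  - exact: measurable_cst.
  - by move=> x bx; rewrite lee_fin; exact: H.
rewrite integral_cst; last exact: measurable_box.
by rewrite EFinM; apply: lee_wpmul2l; [rewrite lee_fin | exact: leb2_box].
Qed.

(** A Schur test valid for every [p > 0]. With [B = M + 2], two powers of the kernel, weighted by
    [th ^+ lv j], are summed by [kernel_sum1]. The other factor is bounded on box [i] by its l^p sum
    over [j]. The p-th powers are then summed over the boxes by [kernel_sum2], which requires
    [M * p >= 2]; hence the dependence of [B0] on [p]. *)
Lemma atom_norm (p : R) : 0 < p -> exists B0 : nat, forall B, (B0 <= B)%N ->
  exists2 K : R, 0 < K & forall (bp : bidx -> R * R) (l : seq bidx) (H : bidx -> R) (g : R * R -> R),
    uniq l -> (forall j, j \in l -> test_pt j (bp j)) -> (forall j, 0 <= H j) ->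
    measurable_fun (@discR2 R) g -> (forall x, 0 <= g x) ->
    (forall x, discR2 x -> g x <= \sum_(j <- l) H j * uker (bp j) j x ^+ B) ->
    (\int[leb2m R]_(x in @discR2 R) (g x `^ p)%:E <= (K * \sum_(j <- l) H j `^ p * dm R j ^+ 2)%:E)%E.
Proof.
move=> p0; have [th [t1 t2 t3 t4]] := base_exists p0.
have th0 : 0 < th := lt_trans ltr01 t1.
have [K1 K10 HK1] := @kernel_sum1 R th t1 t2.
have [K2 K20 HK2] := @kernel_sum2 R (th `^ p) t3 t4.
have [N Np] : exists N : nat, 2 <= N%:R * p.
  exists (Num.bound (2 / p)); rewrite -ler_pdivrMr //; apply: ltW; apply: archi_boundP.
  by rewrite divr_ge0 // ltW.
exists (N + 2)%N => B NB.
have [M BM] : exists M, B = (M + 2)%N.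
  by exists (B - 2)%N; rewrite subnK // (leq_trans _ NB) // leq_addl.
have NM : (N <= M)%N by rewrite -(leq_add2r 2) -BM.
have Mp : 2 <= M%:R * p.
  by apply: le_trans Np _; rewrite ler_wpM2r ?(ltW p0) // ler_nat.
(* The majorants [v] below are at most 24; after normalization to at most 1, a power of exponent
   [M * p >= 2] is below the square. *)
pose C3 : R := 24 `^ (M%:R * p) / 24 ^+ 2.
have C30 : 0 < C3 by rewrite divr_gt0 ?powR_gt0.
have mdisc := @measurable_discR2 R.
exists (144 * K1 `^ p * C3 * K2); first by rewrite !mulr_gt0 ?powR_gt0.
move=> bp l H g ul tl H0 mg g0 Hg.
pose v i j := 24 * (dm R j / rho1 j i (bp j)).
have v0 i j : 0 <= v i j.
  by rewrite mulr_ge0 // divr_ge0 // ltW ?dm_gt0 // rho1_gt0.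
have v24 i j : v i j <= 24.
  rewrite /v ler_piMr // ler_pdivrMr ?rho1_gt0 // mul1r /rho1 -[dm R i + _]addrC -addrA lerDl.
  by rewrite addr_ge0 // ltW ?dm_gt0.
pose W i j := H j * v i j ^+ M * th ^- lv j.
have W0 i j : 0 <= W i j.
  by rewrite !mulr_ge0 ?exprn_ge0 ?invr_ge0 ?exprn_ge0 // ltW.
pose S i := \sum_(j <- l) W i j `^ p.
have S0 i : 0 <= S i by apply: sumr_ge0 => j _; exact: powR_ge0.
have gS i x : box i x -> g x `^ p <= (K1 `^ p * (th `^ p) ^+ lv i) * S i.
  move=> bx; have := Hg x (box_disc bx) => h.
  have {}h : g x <= (K1 * th ^+ lv i) * S i `^ p^-1.
    apply: le_trans h _.
    apply: (@le_trans _ _ (\sum_(j <- l) S i `^ p^-1 * (th ^+ lv j * uker (bp j) j x ^+ 2))).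
      rewrite big_seq [leRHS]big_seq; apply: ler_sum => j jl.
      have -> : H j * uker (bp j) j x ^+ B =
          (H j * uker (bp j) j x ^+ M * th ^- lv j) * (th ^+ lv j * uker (bp j) j x ^+ 2).
        by rewrite BM exprD; field; rewrite expf_neq0 // gt_eqF.
      rewrite ler_wpM2r //; first by rewrite mulr_ge0 ?exprn_ge0 ?uker_ge0 // ltW.
      apply: (@le_trans _ _ (W i j)); last exact: (powR_sum_ge p0 (W0 i) jl).
      rewrite /W ler_wpM2r ?invr_ge0 ?exprn_ge0 ?(ltW th0) // ler_wpM2l //.
      rewrite lerXn2r // ?nnegrE ?uker_ge0 ?v0 //.
      exact: uker_le2 (tl j jl) bx.
    rewrite -mulr_sumr mulrC ler_wpM2r ?powR_ge0 //.
    exact: HK1.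
  have -> : K1 `^ p * (th `^ p) ^+ lv i * S i = (K1 * th ^+ lv i * S i `^ p^-1) `^ p.
    by rewrite !powRM ?mulr_ge0 ?powR_ge0 ?exprn_ge0 ?(ltW K10) ?(ltW th0) // powR_exprn ?(ltW th0)
      // powRVK.
  rewrite ge0_ler_powR ?(ltW p0) ?nnegrE //.
  by rewrite !mulr_ge0 ?powR_ge0 ?exprn_ge0 ?(ltW K10) ?(ltW th0).
have Wp i j : W i j `^ p <= H j `^ p * (th `^ p) ^- lv j * C3 * v i j ^+ 2.
  have vp : (v i j ^+ M) `^ p <= C3 * v i j ^+ 2.
    have [->|vn] := eqVneq (v i j) 0.
      rewrite expr0n; case: eqP => [M0|_] /=.
        by exfalso; move: Mp; rewrite M0 mul0r; lra.
      by rewrite powR0 ?gt_eqF // mulr_ge0 ?sqr_ge0 // ltW.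
    have vpos : 0 < v i j by rewrite lt_def vn v0.
    have [k [k0 k1 ->]] : exists k, [/\ 0 < k, k <= 1 & v i j = 24 * k].
      exists (v i j / 24); split; [by rewrite divr_gt0 | by rewrite ler_pdivrMr // mul1r | by field].
    rewrite -powR_mulrn ?mulr_ge0 ?(ltW k0) // -powRrM powRM ?(ltW k0) //.
    rewrite exprMn /C3 mulrA divfK ?expf_neq0 // ler_wpM2l ?powR_ge0 //.
    by rewrite -powR_mulrn ?(ltW k0) // ger_powR ?k0.
  rewrite /W !powRM ?mulr_ge0 ?exprn_ge0 ?invr_ge0 ?exprn_ge0 ?(ltW th0) //.
  have -> : (th ^- lv j) `^ p = (th `^ p) ^- lv j.
    rewrite -powR_inv1 ?exprn_ge0 ?(ltW th0) // -powRrM mulN1r powRN.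
    by rewrite powR_exprn // ltW.
  rewrite mulrAC -[leRHS]mulrA; apply: ler_wpM2l => //.
  by rewrite mulr_ge0 ?powR_ge0 // invr_ge0 exprn_ge0 // powR_ge0.
apply: (@countable_integral_bound R _ _ (leb2m R) bidx (@box R)).
- exact: measurable_box.
- exact: box_uniq.
- by move=> x; split => [/box_cover//|[j /box_disc]].
- exact: (measurableT_comp (@measurable_powR R p) mg).
- by move=> x; exact: powR_ge0.
move=> l' ul'.
apply: (@le_trans _ _ (\sum_(i <- l') ((K1 `^ p * (th `^ p) ^+ lv i) * S i * (12 * dm R i) ^+ 2)%:E)%E).
  apply: lee_sum => i _; apply: int_box_le.
  - by rewrite !mulr_ge0 ?powR_ge0 ?exprn_ge0 ?powR_ge0.
  - by move=> x; exact: powR_ge0.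
  - exact: (measurableT_comp (@measurable_powR R p) mg).
  - exact: gS.
rewrite sumEFin lee_fin.
apply: (@le_trans _ _ (\sum_(i <- l') \sum_(j <- l) 144 * K1 `^ p * C3 * (H j `^ p * (th `^ p) ^- lv
  j) *
   ((th `^ p) ^+ lv i * dm R i ^+ 2 * v i j ^+ 2))).
  apply: ler_sum => i _; rewrite /S mulrAC mulr_sumr; apply: ler_sum => j _.
  have -> : 144 * K1 `^ p * C3 * (H j `^ p / (th `^ p) ^+ lv j) * ((th `^ p) ^+ lv i * dm R i ^+ 2 *
    v i j ^+ 2)
    = (K1 `^ p * (th `^ p) ^+ lv i * (12 * dm R i) ^+ 2) * (H j `^ p * (th `^ p) ^- lv j * C3 * v i j
      ^+ 2).
    by ring.
  apply: ler_wpM2l => //.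
  by rewrite mulr_ge0 ?sqr_ge0 // mulr_ge0 ?powR_ge0 ?exprn_ge0 ?powR_ge0.
rewrite exchange_big /= mulr_sumr; apply: ler_sum => j _.
rewrite -mulr_sumr.
have h := HK2 j (bp j) l' ul'.
have c0 : 0 <= 144 * K1 `^ p * C3 * (H j `^ p / (th `^ p) ^+ lv j).
  by rewrite !mulr_ge0 ?powR_ge0 ?invr_ge0 ?exprn_ge0 ?powR_ge0 // ltW.
apply: le_trans (ler_wpM2l c0 h) _.
rewrite le_eqVlt; apply/orP; left; apply/eqP; field.
by rewrite expf_neq0 // gt_eqF // powR_gt0.
Qed.

End AtomNorm.

(** * Derivatives of the kernels and inversion of the rising factorials *)

Section Atoms.
Variable R : realType.
Local Notation C := R[i].
Implicit Types (b x : R * R) (j : bidx) (z w : C) (f : C -> C).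

(** A formula for the k-th derivative holds only on the disc, which is enough because
    differentiation at [z] sees only a neighbourhood. *)
Lemma cderiv_step f (F : C -> C) k z l :
  (forall w, disc w -> cderiv k f w = F w) -> disc z -> cdiff F z l ->
  cderiv k.+1 f z = l.
Proof.
move=> E dz dF; rewrite cderivS; apply: cdiff_cderiv1.
have r0 : 0 < 1 - cabs z by rewrite subr_gt0.
apply: (cdiff_near r0 _ dF) => h hh; rewrite E //; apply: (disc_ball (z := z)).
by rewrite addrAC subrr add0r.
Qed.

Lemma cderiv_lin (I : Type) (l : seq I) (c : I -> C) (f : I -> C -> C) k z :
  (forall i, holo (f i)) -> disc z ->
  cderiv k (fun w => \sum_(i <- l) c i * f i w) z = \sum_(i <- l) c i * cderiv k (f i) z.
Proof.
move=> hf; elim: k z => [|k IH] z dz; first by [].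
apply: (cderiv_step IH dz).
elim: l {IH} => [|i l IHl].
  under eq_fun do rewrite big_nil.
  by rewrite big_nil; exact: cdiff_cst.
under eq_fun do rewrite big_cons.
rewrite big_cons.
have := cdiffM (cdiff_cst (c i) z) (cderiv_cdiff k (hf i) dz).
rewrite mulr0 addr0 => h; exact: (cdiffD h IHl).
Qed.

Lemma holo_lin (I : Type) (l : seq I) (c : I -> C) (f : I -> C -> C) :
  (forall i, holo (f i)) -> holo (fun w => \sum_(i <- l) c i * f i w).
Proof.
move=> hf; apply: holo_of_cdiff => z dz; elim: l => [|i l [m dm]].
  exists 0; under eq_fun do rewrite big_nil; exact: cdiff_cst.
eexists; under eq_fun do rewrite big_cons.
exact: (cdiffD (cdiffM (cdiff_cst (c i) z) (holo_cdiff (hf i) dz)) dm).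
Qed.

Lemma uDf_lin (I : Type) (l : seq I) (c : I -> C) (f : I -> C -> C) n u z :
  (forall i, holo (f i)) -> disc z ->
  uDf n u (fun w => \sum_(i <- l) c i * f i w) z = \sum_(i <- l) c i * uDf n u (f i) z.
Proof.
move=> hf dz; rewrite /uDf.
under eq_bigr do rewrite cderiv_lin // mulr_sumr.
rewrite exchange_big; apply: eq_bigr => i _; rewrite mulr_sumr.
by apply: eq_bigr => k _; rewrite mulrCA.
Qed.

Definition atom b j (B : nat) z : C :=
  (Complex (dm R j) 0 / (1 - (toC b)^*%C * z)) ^+ B.

Definition rise (B k : nat) : C := \prod_(i < k) (B + i)%:R.

Lemma riseS B k : rise B k.+1 = rise B k * (B + k)%:R.
Proof. by rewrite /rise big_ord_recr. Qed.

Lemma riseSl B k : rise B k.+1 = B%:R * rise B.+1 k.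
Proof.
rewrite /rise big_ord_recl addn0; congr (_ * _).
by apply: eq_bigr => i _; rewrite /= /bump /= addnA addn1.
Qed.

Lemma rise_diff B k : rise B.+1 k.+1 - rise B k.+1 = k.+1%:R * rise B.+1 k.
Proof.
rewrite riseS riseSl mulrC -mulrBl; congr (_ * _).
by rewrite addSnnS natrD addrAC subrr add0r.
Qed.

Lemma atom_den b z : discR2 b -> disc z -> 1 - (toC b)^*%C * z != 0.
Proof.
move=> db dz; rewrite -cabs_gt0.
have := @kd_gt0 R b (Re z, Im z) db; rewrite /kd.
have -> : toC (Re z, Im z) = z by case: (z).
by apply; rewrite /discR2 /= /toC complexK.
Qed.

Lemma cderiv_atom b j B k z : discR2 b -> disc z ->
  cderiv k (atom b j B) z = rise B k * (toC b)^*%C ^+ k * Complex (dm R j) 0 ^+ B /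
    (1 - (toC b)^*%C * z) ^+ (B + k).
Proof.
move=> db; elim: k z => [|k IH] z dz.
  rewrite /rise big_ord0 expr0 !mul1r addn0 /atom /cderiv /= expr_div_n.
  by [].
set a := (toC b)^*%C; set D := Complex (dm R j) 0.
pose F w := rise B k * a ^+ k * D ^+ B / (1 - a * w) ^+ (B + k).
apply: (cderiv_step (F := F) IH dz).
have nz := atom_den db dz; rewrite -/a in nz.
have d1 : cdiff (fun w => 1 - a * w) z (- a).
  have := cdiffB (cdiff_cst 1 z) (cdiffM (cdiff_cst a z) (cdiff_id z)).
  by rewrite mulr1 mulr0 addr0 sub0r.
have d2 := cdiffV _ (cdiffX (B + k) d1); rewrite expf_neq0 // in d2.
have := cdiffM (cdiff_cst (rise B k * a ^+ k * D ^+ B) z) (d2 isT).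
rewrite mulr0 addr0 /F; congr cdiff.
rewrite riseS addnS exprS.
(* If [B + k] is 0, both sides vanish, so the truncated predecessor of the exponent does no harm. *)
case: (B + k)%N => [|m]; first by rewrite !mulr0 !mul0r oppr0 mul0r mulr0.
by rewrite /= !exprS; field; rewrite nz expf_neq0.
Qed.

Lemma holo_atom b j B : discR2 b -> holo (atom b j B).
Proof.
move=> db; apply: holo_of_cdiff => z dz.
have nz := atom_den db dz.
have d1 : cdiff (fun w => 1 - (toC b)^*%C * w) z (0 - (toC b)^*%C).
  have := cdiffB (cdiff_cst 1 z) (cdiffM (cdiff_cst (toC b)^*%C z) (cdiff_id z)).
  by rewrite mulr1 mulr0 addr0.
have d2 := cdiffM (cdiff_cst (Complex (dm R j) 0) z) (cdiffV (f := fun w => 1 - (toC b)^*%C * w) nz d1).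
eexists; exact: (cdiffX B d2).
Qed.

Lemma cabs_atom b j B x : cabs (atom b j B (toC x)) = uker b j x ^+ B.
Proof.
rewrite /atom cabsX cabsM cabsV cabs_real ger0_norm; last by rewrite ltW // dm_gt0.
by [].
Qed.

(* Finite differences in [B] turn the rising factorials of order [k.+1] into those
   of order [k], which reduces the system to one of smaller size. *)
Lemma rise_inversion n B : exists2 K : R, 0 < K & forall V : nat -> C, forall k, (k <= n)%N ->
  cabs (V k) <= K * \sum_(i < n.+1) cabs (\sum_(k < n.+1) rise (B + i) k * V k).
Proof.
elim: n B => [|n IH] B.
  exists 1 => // V k; rewrite leqn0 => /eqP ->.
  by rewrite mul1r !big_ord_recl !big_ord0 !addr0 /rise big_ord0 mul1r.
have [K K0 HK] := IH B.+1.
pose K2 := 1 + \sum_(k < n.+1) cabs (rise B k.+1) * (K * 2).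
have K2g : 1 <= K2.
  rewrite /K2 lerDl; apply: sumr_ge0 => k _.
  by rewrite mulr_ge0 ?cabs_ge0 // mulr_ge0 // ltW.
exists (K * 2 + K2); first by rewrite addr_gt0 ?mulr_gt0 // (lt_le_trans ltr01).
move=> V; set S := fun i => cabs (\sum_(k < n.+2) rise (B + i) k * V k).
have T0 : 0 <= \sum_(i < n.+2) S i by apply: sumr_ge0 => i _; exact: cabs_ge0.
set T := \sum_(i < n.+2) S i in T0 *.
have V1 k : (k <= n)%N -> cabs (V k.+1) <= K * 2 * T.
  (* The difference of consecutive equations is free of [V 0]; by [rise_diff] it is the system with
     base [B.+1] in the unknowns [k.+1%:R * V k.+1]. *)
  move=> kn; have := HK (fun k => k.+1%:R * V k.+1) k kn.
  have e i : \sum_(k < n.+1) rise (B.+1 + i) k * (k.+1%:R * V k.+1) =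
     (\sum_(k < n.+2) rise (B + i.+1) k * V k) - (\sum_(k < n.+2) rise (B + i) k * V k).
    rewrite -sumrB [RHS]big_ord_recl /= /rise !big_ord0 subrr add0r.
    apply: eq_bigr => m _; rewrite /= /bump /= add1n -mulrBl mulrA; congr (_ * _).
    by rewrite addnS addSn mulrC -[LHS]rise_diff.
  under eq_bigr do rewrite e.
  move=> H; apply: (@le_trans _ _ (cabs (k.+1%:R * V k.+1))).
    rewrite cabsM ler_peMl ?cabs_ge0 //.
    have -> : (k.+1%:R : C) = Complex k.+1%:R 0.
      by rewrite -[RHS]/((k.+1%:R)%:C%C) rmorph_nat.
    by rewrite cabs_real ger0_norm // ler1n.
  apply: le_trans H _; rewrite -mulrA ler_wpM2l ?(ltW K0) //.
  apply: (@le_trans _ _ (\sum_(i < n.+1) (S i.+1 + S i))).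
    by apply: ler_sum => i _; apply: le_trans (cabsD _ _) _; rewrite cabsN.
  rewrite big_split /= mulrDl mul1r; apply: lerD.
    rewrite /T [leRHS]big_ord_recl lerDr.
    exact: cabs_ge0.
  by rewrite /T [leRHS]big_ord_recr /= lerDl; exact: cabs_ge0.
case=> [_|k kn]; last first.
  apply: le_trans (V1 k kn) _; rewrite mulrDl lerDl mulr_ge0 //.
  exact: le_trans K2g.
(* The coefficient of [V 0] is an empty product, so the first equation yields [V 0] from the other
   unknowns. *)
have e : V 0%N = (\sum_(k < n.+2) rise (B + 0) k * V k) - \sum_(k < n.+1) rise B k.+1 * V k.+1.
  rewrite [in RHS]big_ord_recl /= addn0 {1}/rise big_ord0 mul1r.
  by rewrite addrK.
rewrite e; apply: le_trans (cabsD _ _) _; rewrite cabsN.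
rewrite [(K * 2 + K2) * T]mulrDl ler_wpDl ?mulr_ge0 ?(ltW K0) //.
rewrite /K2 mulrDl mul1r; apply: lerD.
  by rewrite /T [leRHS]big_ord_recl /= lerDl; apply: sumr_ge0 => i _; exact: cabs_ge0.
apply: le_trans (cabs_sum _ _ _) _; rewrite mulr_suml; apply: ler_sum => k _.
by rewrite cabsM -mulrA ler_wpM2l ?cabs_ge0 // V1 // -ltnS.
Qed.

End Atoms.

(** * Decoupling disjoint sets by averaging over signs *)

Section SignAverage.
Context (R : realType) (d : measure_display) (T : measurableType d).
Variable m : {measure set T -> \bar R}.
Local Notation C := R[i].

Definition sgnC (b : bool) : C := if b then 1 else -1.

Lemma cabs_sgnC b : cabs (sgnC b) = 1.
Proof. by case: b; rewrite /sgnC ?cabsN cabs1. Qed.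

(* Flipping the [i]-th sign changes the sum by twice its [i]-th term. *)
Lemma sign_pointwise (N : nat) (g : 'I_N -> C) (q : R) (i : 'I_N) : 0 < q ->
  #|{ffun 'I_N -> bool}|%:R * cabs (g i) `^ q <=
  2 * \sum_(e : {ffun 'I_N -> bool}) cabs (\sum_(k < N) sgnC (e k) * g k) `^ q.
Proof.
move=> q0; pose X (e : {ffun 'I_N -> bool}) := \sum_(k < N) sgnC (e k) * g k.
pose flip (e : {ffun 'I_N -> bool}) := [ffun k => if k == i then ~~ e k else e k].
have flipK : involutive flip.
  by move=> e; apply/ffunP => k; rewrite !ffunE; case: eqP => // _; rewrite negbK.
have E : \sum_e cabs (X e) `^ q = \sum_e cabs (X (flip e)) `^ q.
  by rewrite (reindex_inj (inv_inj flipK)).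
have -> : 2 * \sum_(e : {ffun 'I_N -> bool}) cabs (\sum_(k < N) sgnC (e k) * g k) `^ q =
   \sum_e (cabs (X e) `^ q + cabs (X (flip e)) `^ q).
  by rewrite big_split /= -E -[2]/(1 + 1) mulrDl mul1r.
rewrite mulr_natl -sumr_const; apply: ler_sum => e _.
have XX : 2 * cabs (g i) <= cabs (X e) + cabs (X (flip e)).
  have -> : 2 * cabs (g i) = cabs (X e - X (flip e)).
    rewrite /X -sumrB (bigD1 i) //= big1 => [|k ki]; last first.
      by rewrite !ffunE (negbTE ki) subrr.
    rewrite addr0 ffunE eqxx -mulrBl cabsM; congr (_ * _).
    have -> : sgnC (e i) - sgnC (~~ e i) = sgnC (e i) * 2.
      by rewrite /sgnC; case: (e i) => /=; ring.
    rewrite cabsM cabs_sgnC mul1r.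
    have -> : (2 : C) = Complex 2 0 by rewrite -[RHS]/((2 : R)%:C%C) rmorph_nat.
    by rewrite cabs_real ger0_norm.
  by apply: le_trans (cabsD _ _) _; rewrite cabsN.
have [h|h] := leP (cabs (g i)) (cabs (X e)).
  by rewrite ler_wpDr ?powR_ge0 // ge0_ler_powR ?nnegrE ?cabs_ge0 // ltW.
rewrite ler_wpDl ?powR_ge0 // ge0_ler_powR ?nnegrE ?cabs_ge0 ?(ltW q0) //.
by move: XX h; clear; lra.
Qed.

(** The sets are disjoint, so at each point at most one index counts, and [sign_pointwise] bounds
    its term by twice the average over all sign patterns. The result does not depend on [N]. *)
Lemma sign_average (N : nat) (g : 'I_N -> T -> C) (Q : 'I_N -> set T) (D : set T) (q M : R) :
  0 < q -> measurable D -> (forall i, measurable (Q i)) ->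
  (forall i k x, Q i x -> Q k x -> i = k) ->
  (forall i, measurable_fun D (fun x => cabs (g i x))) ->
  (forall e : {ffun 'I_N -> bool},
     measurable_fun D (fun x => cabs (\sum_(k < N) sgnC (e k) * g k x))) ->
  (forall e : {ffun 'I_N -> bool},
    (\int[m]_(x in D) (cabs (\sum_(k < N) sgnC (e k) * g k x) `^ q)%:E <= M%:E)%E) ->
  (\sum_(i < N) \int[m]_(x in D `&` Q i) (cabs (g i x) `^ q)%:E <= (2 * M)%:E)%E.
Proof.
move=> q0 mD mQ dis mg mX HM.
have e i : (\int[m]_(x in D `&` Q i) (cabs (g i x) `^ q)%:E =
    \int[m]_(x in D) (cabs (g i x) `^ q * \1_(Q i) x)%:E)%E.
  rewrite integral_mkcondr; apply: eq_integral => x _; rewrite /patch indicE.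
  by case: ifP; rewrite ?mulr1 ?mulr0.
under eq_bigr do rewrite e.
have mgq i : measurable_fun D (fun x => cabs (g i x) `^ q).
  exact: (measurableT_comp (@measurable_powR R q) (mg i)).
have mXq (e0 : {ffun 'I_N -> bool}) : measurable_fun D (fun x => (cabs (\sum_(k < N) sgnC (e0 k) * g
  k x) `^ q)%:E).
  have h : measurable_fun D (fun x => cabs (\sum_(k < N) sgnC (e0 k) * g k x) `^ q).
    exact: (measurableT_comp (@measurable_powR R q) (mX e0)).
  exact/measurable_EFinP.
have mi i : measurable_fun D (fun x => (cabs (g i x) `^ q * \1_(Q i) x)%:E).
  by apply/measurable_EFinP; apply: measurable_funM => //; exact: measurable_indic.
rewrite -ge0_integral_sum //; last first.
  by move=> i x _; rewrite lee_fin mulr_ge0 ?powR_ge0.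
set c := #|{ffun 'I_N -> bool}|.
have c0 : 0 < c%:R :> R by rewrite ltr0n; apply/card_gt0P; exists [ffun=> true].
have pt x : \sum_(i < N) cabs (g i x) `^ q * \1_(Q i) x <=
   2 / c%:R * \sum_(e : {ffun 'I_N -> bool}) cabs (\sum_(k < N) sgnC (e k) * g k x) `^ q.
  have S0 : 0 <= \sum_(e : {ffun 'I_N -> bool}) cabs (\sum_(k < N) sgnC (e k) * g k x) `^ q.
    by apply: sumr_ge0 => e0 _; exact: powR_ge0.
  have [[i Qi]|none] := pselect (exists i, Q i x); last first.
    rewrite big1 => [|i _]; first by rewrite mulr_ge0 // divr_ge0 // ltW.
    by rewrite indicE memNset ?mulr0 // => Qi; apply: none; exists i.
  rewrite (bigD1 i) //= big1 => [|k ki]; last first.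
    rewrite indicE memNset ?mulr0 // => Qk; move: ki; apply/negP; rewrite negbK.
    by apply/eqP; exact: dis Qk Qi.
  rewrite addr0 indicE mem_set // mulr1.
  have := sign_pointwise (fun k => g k x) i q0.
  by rewrite mulrAC ler_pdivlMr // mulrC.
apply: (@le_trans _ _ (\int[m]_(x in D) ((2 / c%:R)%:E * \sum_(e : {ffun 'I_N -> bool})
    (cabs (\sum_(k < N) sgnC (e k) * g k x) `^ q)%:E))%E).
  apply: ge0_le_integral => //.
  - by move=> x _; apply: sume_ge0 => i _; rewrite lee_fin mulr_ge0 ?powR_ge0.
  - exact: emeasurable_sum.
  - by apply: measurable_funeM; exact: emeasurable_sum.
  - by move=> x _; rewrite !sumEFin -EFinM lee_fin pt.
have mS := emeasurable_sum (index_enum {ffun 'I_N -> bool}) mXq.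
have S0 x : D x -> (0 <= \sum_(e : {ffun 'I_N -> bool})
    (cabs (\sum_(k < N) sgnC (e k) * g k x) `^ q)%:E)%E.
  by move=> _; apply: sume_ge0 => e0 _; rewrite lee_fin powR_ge0.
have ck : (0 <= (2 / c%:R)%:E :> \bar R)%E by rewrite lee_fin divr_ge0 // ltW.
rewrite ge0_integralZl //.
rewrite ge0_integral_sum //; last by move=> e0 x _; rewrite lee_fin powR_ge0.
apply: (@le_trans _ _ ((2 / c%:R)%:E * \sum_(e0 : {ffun 'I_N -> bool}) M%:E)%E).
  by apply: lee_wpmul2l; [rewrite lee_fin divr_ge0 // ltW | apply: lee_sum => e0 _].
rewrite sumEFin -EFinM lee_fin sumr_const -/c -[M *+ c]mulr_natl.
by rewrite mulrA divfK // gt_eqF.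
Qed.

End SignAverage.

(** * Testing the Sobolev condition on kernels *)

Section TestFunctions.
Variable R : realType.
Local Notation C := R[i].
Implicit Types (u : nat -> C -> C) (f : C -> C) (j : bidx) (b x : R * R).

Lemma holo_uDf n u f : (forall k, (k <= n)%N -> holo (u k)) -> holo f -> holo (uDf n u f).
Proof.
move=> hu hf; apply: holo_of_cdiff => z dz.
(* Holomorphy of [u k] is available only for [k <= n], so the induction runs over initial segments
   of the sum. *)
suff H m : (m <= n.+1)%N ->
    exists l, cdiff (fun w => \sum_(k < m) u k w * cderiv k f w) z l by exact: H.
elim: m => [|m IH] mn.
  exists 0; have -> : (fun w => \sum_(k < 0) u k w * cderiv k f w) = (fun=> 0) :> (C -> C).
    by apply: funext => w; rewrite big_ord0.
  exact: cdiff_cst.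
have [l Hl] := IH (ltnW mn).
have := cdiffD Hl (cdiffM (holo_cdiff (hu m mn) dz) (cderiv_cdiff m hf dz)).
set l' := (X in cdiff _ _ X -> _) => H; exists l'.
have -> : (fun w => \sum_(k < m.+1) u k w * cderiv k f w) =
   (fun w => \sum_(k < m) u k w * cderiv k f w + u m w * cderiv m f w).
  by apply: funext => w; rewrite big_ord_recr.
exact: H.
Qed.

(** Once the atom is factored out, [B] occurs only in the rising factorials. Varying [B] thus gives
    several equations for the same unknowns. *)
Lemma uDf_atom n u j b B x : discR2 b -> discR2 x ->
  uDf n u (atom b j B) (toC x) = atom b j B (toC x) *
    \sum_(k < n.+1) rise R B k * (u k (toC x) * (toC b)^*%C ^+ k /
       (1 - (toC b)^*%C * toC x) ^+ k).
Proof.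
move=> db dx; have e0 := atom_den db dx.
rewrite /uDf mulr_sumr; apply: eq_bigr => k _.
rewrite cderiv_atom // /atom exprD expr_div_n; field.
by rewrite !expf_neq0.
Qed.

(** [rise_inversion] bounds the unknowns of [uDf_atom]. Recovering [u k] costs 32 per order, since
    [kd b x <= 8 * dm R j] and [|b| >= 1 / 4]; dividing by the atoms costs powers of 8 by
    [uker_ge]. *)
Lemma coef_le_atoms n B : exists2 K : R, 0 < K & forall u j b x k,
  test_pt j b -> box j x -> (k <= n)%N ->
  cabs (u k (toC x)) <= K * dm R j ^+ k *
    \sum_(i < n.+1) cabs (uDf n u (atom b j (B + i)) (toC x)).
Proof.
have [K0 K00 HK] := @rise_inversion R n B.
exists (32 ^+ n * K0 * 8 ^+ (B + n)); first by rewrite !mulr_gt0 ?exprn_gt0.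
move=> u j b x k tb bx kn; have [db _ b4 _ _] := tb.
have dx := box_disc bx; have d0 := dm_gt0 R j.
have kd0 := kd_gt0 db dx; have w8 := uker_ge tb bx.
have e0 := atom_den db dx.
pose V k := u k (toC x) * (toC b)^*%C ^+ k / (1 - (toC b)^*%C * toC x) ^+ k.
have Vu : cabs (u k (toC x)) <= (32 * dm R j) ^+ k * cabs (V k).
  have -> : (32 * dm R j) ^+ k * cabs (V k) =
      cabs (u k (toC x)) * (32 * dm R j * cabs (toC b) / kd b x) ^+ k.
    rewrite /V !(cabsM, cabsV, cabsX) cabsJ -/(kd b x) !exprMn -exprVn.
    by move: (32 ^+ k) (dm R j ^+ k) (cabs _) (cabs _ ^+ k) (_^-1 ^+ k) => ? ? ? ? ?; ring.
  rewrite ler_peMr ?cabs_ge0 // exprn_ege1 // ler_pdivlMr // mul1r.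
  have h : kd b x <= 8 * dm R j by move: w8; rewrite /uker ler_pdivlMr //; lra.
  apply: le_trans h _; nra.
apply: le_trans Vu _.
have hV := HK V k kn.
have S0 : 0 <= \sum_(i < n.+1) cabs (uDf n u (atom b j (B + i)) (toC x)).
  by apply: sumr_ge0 => i _; exact: cabs_ge0.
have hS : \sum_(i < n.+1) cabs (\sum_(k < n.+1) rise R (B + i) k * V k) <=
   8 ^+ (B + n) * \sum_(i < n.+1) cabs (uDf n u (atom b j (B + i)) (toC x)).
  rewrite mulr_sumr; apply: ler_sum => i _; rewrite uDf_atom // cabsM cabs_atom mulrA.
  rewrite ler_peMl ?cabs_ge0 //.
  apply: (@le_trans _ _ (8 ^+ (B + i) * (1 / 8) ^+ (B + i))).
    by rewrite -exprMn mulrC divfK ?expr1n.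
  apply: ler_pM; rewrite ?exprn_ge0 ?divr_ge0 //.
    by rewrite ler_weXn2l ?ler1n // leq_add2l -ltnS ltn_ord.
  by apply: lerXn2r w8; rewrite nnegrE ?uker_ge0 // divr_ge0.
apply: (@le_trans _ _ (((32 ^+ n) * dm R j ^+ k) * (K0 * (8 ^+ (B + n) *
    \sum_(i < n.+1) cabs (uDf n u (atom b j (B + i)) (toC x)))))).
  apply: ler_pM; rewrite ?cabs_ge0 ?exprn_ge0 ?mulr_ge0 ?(ltW d0) //.
    rewrite exprMn ler_wpM2r ?exprn_ge0 ?(ltW d0) //.
    by rewrite ler_weXn2l // ler1n.
  by apply: le_trans hV _; rewrite ler_wpM2l // ltW.
rewrite le_eqVlt; apply/orP; left; apply/eqP; ring.
Qed.

Variables (n : nat) (u : nat -> C -> C) (p q : R) (mu : {measure set (R * R) -> \bar R}).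
Hypotheses (q0 : 0 < q) (qp : q < p) (hu : forall k, (k <= n)%N -> holo (u k)).

Definition atom_mass B b j : \bar R :=
  (\int[mu]_(x in box j) (cabs (uDf n u (atom b j B) (toC x)) `^ q)%:E)%E.

(** Signs do not change the moduli of the coefficients, so [atom_norm] bounds all sign patterns
    alike and [sign_average] applies. The constant is independent of the list, the test points and
    [H]. *)
Lemma sobolev_on_atoms : sobolev_carleson n u p q mu ->
  exists B0 : nat, forall B, (B0 <= B)%N -> exists2 K : R, 0 < K &
  forall (bp : bidx -> R * R) (l : seq bidx) (H : bidx -> R),
    uniq l -> (forall j, j \in l -> test_pt j (bp j)) -> (forall j, 0 <= H j) ->
    (\sum_(j <- l) (H j `^ q)%:E * atom_mass B (bp j) j <=
      (K * (\sum_(j <- l) H j `^ p * dm R j ^+ 2) `^ (q / p))%:E)%E.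
Proof.
move=> [M [M0 HM]]; have p0 := lt_trans q0 qp.
have [B0 HB] := atom_norm p0; exists B0 => B /HB[K K0 HK].
have pi0 := @pi_gt0 R.
exists (2 * (M * (pi^-1 * K) `^ (q / p))).
  by rewrite !mulr_gt0 ?powR_gt0 // mulr_gt0 ?invr_gt0.
move=> bp l H ul tl H0.
set S := \sum_(j <- l) H j `^ p * dm R j ^+ 2.
have S0 : 0 <= S by apply: sumr_ge0 => j _; rewrite mulr_ge0 ?powR_ge0 ?sqr_ge0.
pose tl' (i : 'I_(size l)) := tnth (in_tuple l) i.
have inl i : tl' i \in l by exact: mem_tnth.
have tt i := tl _ (inl i).
have db i : discR2 (bp (tl' i)) by case: (tt i).
pose a i := atom (bp (tl' i)) (tl' i) B.
have ha i : holo (a i) by exact: holo_atom.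
have mdisc := @measurable_discR2 R.
have Hc j : cabs (Complex (H j) 0) = H j by rewrite cabs_real ger0_norm.
pose g i x := Complex (H (tl' i)) 0 * uDf n u (a i) (toC x).
pose f (e : {ffun 'I_(size l) -> bool}) w :=
  \sum_(i < size l) (sgnC R (e i) * Complex (H (tl' i)) 0) * a i w.
have hf e : holo (f e) by exact: holo_lin.
have uf e x : discR2 x -> uDf n u (f e) (toC x) = \sum_(i < size l) sgnC R (e i) * g i x.
  move=> dx; rewrite /f uDf_lin //; apply: eq_bigr => i _.
  by rewrite /g mulrA.
have fint e : (bergman_int p (f e) <= (pi^-1 * (K * S))%:E)%E.
  rewrite /bergman_int EFinM; apply: lee_wpmul2l.
    by rewrite lee_fin invr_ge0 ltW.
  apply: (HK bp l H (fun x => cabs (f e (toC x)))) => //.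
  - exact: (@measurable_cabs_holo R (f e) _ (hf e)).
  - by move=> x; exact: cabs_ge0.
  - move=> x dx; apply: le_trans (cabs_sum _ _ _) _.
    rewrite [leRHS]big_tnth; apply: ler_sum => i _.
    by rewrite !cabsM cabs_sgnC mul1r Hc cabs_atom.
have f0 e : (0 <= bergman_int p (f e))%E.
  rewrite /bergman_int mule_ge0 ?lee_fin ?invr_ge0 ?(ltW pi0) //.
  by apply: integral_ge0 => x _; rewrite lee_fin powR_ge0.
have fA e : inAp p (f e).
  by split; [exact: hf | apply: le_lt_trans (fint e) _; rewrite ltry].
have fn e : normAp p (f e) `^ q <= (pi^-1 * K) `^ (q / p) * S `^ (q / p).
  rewrite /normAp -powRrM [p^-1 * q]mulrC -powRM ?mulr_ge0 ?invr_ge0 ?(ltW pi0) ?(ltW K0) //.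
  rewrite ge0_ler_powR ?divr_ge0 ?nnegrE ?(ltW q0) ?(ltW p0) ?fine_ge0 //.
    by rewrite -mulrA !mulr_ge0 ?invr_ge0 ?(ltW pi0) ?(ltW K0).
  rewrite -mulrA -lee_fin fineK //.
  by rewrite ge0_fin_numE //; case: (fA e).
have fmu (e : {ffun 'I_(size l) -> bool}) : (\int[mu]_(x in @discR2 R)
     (cabs (\sum_(i < size l) sgnC R (e i) * g i x) `^ q)%:E <=
     (M * ((pi^-1 * K) `^ (q / p) * S `^ (q / p)))%:E)%E.
  apply: (@le_trans _ _ (M * normAp p (f e) `^ q)%:E); last first.
    by rewrite lee_fin ler_wpM2l // ltW.
  apply: le_trans (HM _ (fA e)); rewrite le_eqVlt; apply/orP; left; apply/eqP.
  by apply: eq_integral => x; rewrite inE => dx; rewrite uf.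
have mua i : measurable_fun (@discR2 R) (fun x => cabs (uDf n u (a i) (toC x))).
  by apply: measurable_cabs_holo => //; exact: holo_uDf.
have mg i : measurable_fun (@discR2 R) (fun x => cabs (g i x)).
  under eq_fun do rewrite cabsM Hc.
  by apply: measurable_funM => //; exact: measurable_cst.
have mX (e : {ffun 'I_(size l) -> bool}) : measurable_fun (@discR2 R)
    (fun x => cabs (\sum_(i < size l) sgnC R (e i) * g i x)).
  apply: (@eq_measurable_fun _ _ _ _ _ (fun x => cabs (uDf n u (f e) (toC x)))).
    by move=> x; rewrite inE => dx; rewrite uf.
  by apply: measurable_cabs_holo => //; exact: holo_uDf.
have dis (i k : 'I_(size l)) x : box (tl' i) x -> box (tl' k) x -> i = k.
  move=> bi bk; have := box_uniq bi bk; rewrite /tl' !(tnth_nth (tl' i)) /= => /eqP.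
  by rewrite nth_uniq // => /eqP /val_inj.
have := @sign_average R _ _ mu _ g (fun i => box (tl' i)) (@discR2 R) q _ q0 mdisc
  (fun i => measurable_box _) dis mg mX fmu.
rewrite -!mulrA; apply: le_trans.
rewrite big_tnth; apply: lee_sum => i _; rewrite -/(tl' i).
have -> : @discR2 R `&` box (tl' i) = box (tl' i).
  by apply/setIidr => x; exact: box_disc.
rewrite /atom_mass -ge0_integralZl_EFin ?powR_ge0 //; last first.
- apply/measurable_EFinP; apply: (measurable_funS _ (@box_disc R _)) => //.
  exact: (measurableT_comp (@measurable_powR R q) (mua i)).
- by move=> x _; rewrite lee_fin powR_ge0.
- exact: measurable_box.
rewrite le_eqVlt; apply/orP; left; apply/eqP; apply: eq_integral => x _.
by rewrite -EFinM /g cabsM Hc powRM ?cabs_ge0.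
Qed.

Lemma atom_mass_bound : sobolev_carleson n u p q mu ->
  exists B0 : nat, forall B, (B0 <= B)%N -> exists2 M : R, 0 < M &
  forall (bp : bidx -> R * R) (l : seq bidx), uniq l ->
    (forall j, j \in l -> test_pt j (bp j)) ->
    (forall j, j \in l -> (atom_mass B (bp j) j < +oo)%E) /\
    \sum_(j <- l) dm R j ^+ 2 *
      (fine (atom_mass B (bp j) j) / dm R j ^+ 2) `^ (p / (p - q)) <= M.
Proof.
move=> /sobolev_on_atoms[B0 HB]; exists B0 => B /HB[K K0 HK].
have p0 := lt_trans q0 qp; have pq : 0 < p - q by rewrite subr_gt0.
exists (K `^ (p / (p - q))); first by rewrite powR_gt0.
move=> bp l ul tl.
pose c j := atom_mass B (bp j) j.
have c0 j : (0 <= c j)%E by apply: integral_ge0 => x _; rewrite lee_fin powR_ge0.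
(* Finiteness comes first, from a single box with [H] equal to 1: the choice of [H] below uses
   [fine (c j)], which would be 0 for an infinite mass. *)
have cfin j : j \in l -> (c j < +oo)%E.
  move=> jl; have := HK bp [:: j] (fun=> 1) isT; rewrite !big_seq1 powR1 mul1e => h.
  apply: le_lt_trans (h _ _) _; rewrite ?ltry // => k.
  by rewrite inE => /eqP ->; exact: tl.
split; first exact: cfin.
pose y j := fine (c j) / dm R j ^+ 2.
have d2 j : 0 < dm R j ^+ 2 by rewrite exprn_gt0 ?dm_gt0.
have y0 j : 0 <= y j by rewrite divr_ge0 ?fine_ge0 // ltW.
(* This choice makes the sums on both sides equal to [S], and [S] at most [K] times its power q / p
   gives the bound. *)
pose H j := y j `^ (p - q)^-1.
set S := \sum_(j <- l) _.
have S0 : 0 <= S by apply: sumr_ge0 => j _; rewrite mulr_ge0 ?powR_ge0 // ltW.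
have := HK bp l H ul tl (fun j => powR_ge0 _ _).
have -> : (\sum_(j <- l) (H j `^ q)%:E * atom_mass B (bp j) j = S%:E)%E.
  rewrite /S -sumEFin big_seq [RHS]big_seq; apply: eq_bigr => j jl.
  rewrite -/(c j) -[c j]fineK ?ge0_fin_numE ?cfin // -EFinM; congr (_%:E).
  have -> : fine (c j) = dm R j ^+ 2 * y j by rewrite /y mulrC divfK // gt_eqF.
  rewrite [dm R j ^+ 2 * y j / _]mulrAC divff ?gt_eqF // mul1r.
  rewrite mulrCA; congr (_ * _).
  rewrite /H -powRrM -{2}[y j]powRr1 // -powRD; last first.
    by rewrite gt_eqF // addr_gt0 // mulr_gt0 // invr_gt0.
  by congr (_ `^ _); field; rewrite gt_eqF.
have -> : \sum_(j <- l) H j `^ p * dm R j ^+ 2 = S.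
  apply: eq_bigr => j _; rewrite mulrC; congr (_ * _).
  by rewrite /H -powRrM [(p - q)^-1 * p]mulrC.
rewrite lee_fin => hS.
have [->|Sn] := eqVneq S 0; first exact: powR_ge0.
have Sp : 0 < S by rewrite lt_def Sn.
have -> : S = (S `^ ((p - q) / p)) `^ (p / (p - q)).
  rewrite -powRrM; have -> : (p - q) / p * (p / (p - q)) = 1.
    by field; rewrite !gt_eqF.
  by rewrite powRr1.
rewrite ge0_ler_powR ?nnegrE ?powR_ge0 ?divr_ge0 ?(ltW p0) ?(ltW pq) ?(ltW K0) //.
have -> : (p - q) / p = 1 - q / p by field; rewrite gt_eqF.
rewrite powRB; last by rewrite Sn implybT.
by rewrite powRr1 // ler_pdivrMr // powR_gt0.
Qed.

End TestFunctions.

(** * Estimates on one box and overlap of enlarged boxes *)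

Section BoxEstimates.
Variable R : realType.
Local Notation C := R[i].
Implicit Types (u : nat -> C -> C) (f : C -> C) (j : bidx) (b x : R * R).

(** Each term is at most the l^q size of the whole family, and there are [size l] of them; this
    covers [q < 1] as well as [q >= 1]. *)
Lemma powR_sum_le (I : eqType) (l : seq I) (a : I -> R) (q : R) : 0 < q ->
  (forall i, 0 <= a i) ->
  (\sum_(i <- l) a i) `^ q <= (size l)%:R `^ q * \sum_(i <- l) a i `^ q.
Proof.
move=> q0 a0.
have S0 : 0 <= \sum_(i <- l) a i `^ q by apply: sumr_ge0 => i _; exact: powR_ge0.
have -> : \sum_(i <- l) a i `^ q = ((\sum_(i <- l) a i `^ q) `^ q^-1) `^ q.
  by rewrite -powRrM mulVf ?gt_eqF // powRr1.
rewrite -powRM ?powR_ge0 //.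
rewrite ge0_ler_powR ?(ltW q0) ?nnegrE ?mulr_ge0 ?powR_ge0 ?sumr_ge0 //.
set T := _ `^ q^-1.
have -> : (size l)%:R * T = \sum_(i <- l) T.
  by rewrite big_const_seq count_predT iter_addr_0 mulr_natl.
by rewrite big_seq [leRHS]big_seq; apply: ler_sum => i il; exact: powR_sum_ge.
Qed.

(** Young's inequality with a free parameter. Comparing [a] with [e] times the power 1 - s of [y]
    decides which of the two terms alone dominates. *)
Lemma young_powR (a y e s : R) : 0 <= a -> 0 <= y -> 0 < e -> 0 < s -> s < 1 ->
  a * y `^ s <= e * y + e `^ (- s / (1 - s)) * a `^ (1 / (1 - s)).
Proof.
move=> a0 y0 e0 s0 s1; have t0 : 0 < 1 - s by rewrite subr_gt0.
have [->|yn] := eqVneq y 0.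
  by rewrite powR0 ?gt_eqF // !mulr0 add0r mulr_ge0 ?powR_ge0.
have yp : 0 < y by rewrite lt_def yn.
have [h|h] := leP a (e * y `^ (1 - s)).
  rewrite ler_wpDr ?mulr_ge0 ?powR_ge0 //.
  apply: le_trans (ler_wpM2r (powR_ge0 _ _) h) _.
  by rewrite -mulrA -powRD ?yn ?implybT // subrK powRr1.
rewrite ler_wpDl ?mulr_ge0 ?(ltW e0) //.
have ap : 0 < a by apply: le_lt_trans h; rewrite mulr_ge0 ?powR_ge0 // ltW.
have hy : y <= (a / e) `^ (1 / (1 - s)).
  have {1}-> : y = (y `^ (1 - s)) `^ (1 / (1 - s)).
    by rewrite -powRrM mulrC div1r mulVf ?gt_eqF // powRr1.
  rewrite div1r ge0_ler_powR ?invr_ge0 ?(ltW t0) ?nnegrE ?powR_ge0 ?divr_ge0 ?(ltW e0) //.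
  by rewrite ler_pdivlMr // mulrC ltW.
have : y `^ s <= ((a / e) `^ (1 / (1 - s))) `^ s.
  by rewrite ge0_ler_powR ?(ltW s0) ?nnegrE ?powR_ge0.
move=> /(ler_wpM2l a0) /le_trans; apply.
rewrite -powRrM powRM ?invr_ge0 ?(ltW e0) // -[e^-1]powR_inv1 ?(ltW e0) // -[(e `^ _) `^ _]powRrM.
rewrite [_ * e `^ _]mulrC mulrCA -{1}[a]powRr1 //.
have -> : -1 * (1 / (1 - s) * s) = - s / (1 - s) by field; rewrite gt_eqF.
rewrite ler_wpM2l ?powR_ge0 // -powRD; last by rewrite (gt_eqF ap) implybT.
by have -> : 1 + 1 / (1 - s) * s = 1 / (1 - s) by field; rewrite gt_eqF.
Qed.

(* A neighbourhood of box [j] that still has bounded overlap. *)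
Definition enl b j : set (R * R) :=
  [set w | 0 <= 9 * dm R j - kd b w] `&` [set w | 0 <= 1 - cabs (toC w) - dm R j / 4].

Lemma measurable_enl b j : measurable (enl b j).
Proof.
have b0 := cabs_ge0 (toC b).
apply: measurableI.
  apply: (proj2 (@lip_measurable R (fun w => 9 * dm R j - kd b w) (1 + cabs (toC b)) _ _)).
    by rewrite ltr_pwDl.
  move=> x y; have -> : 9 * dm R j - kd b y - (9 * dm R j - kd b x) = kd b x - kd b y by ring.
  apply: le_trans (cabs_lip _ _) _.
  have -> : 1 - (toC b)^*%C * toC x - (1 - (toC b)^*%C * toC y) =
    (toC b)^*%C * (toC y - toC x) by ring.
  rewrite cabsM cabsJ ler_pM ?cabs_ge0 ?lerDr //.
  exact: (cabs_le_ReIm (toC y - toC x)).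
apply: (proj2 (@lip_measurable R (fun w => 1 - cabs (toC w) - dm R j / 4) 1 _ _)) => // x y.
have -> : 1 - cabs (toC y) - dm R j / 4 - (1 - cabs (toC x) - dm R j / 4) =
  cabs (toC x) - cabs (toC y) by ring.
rewrite mul1r distrC; apply: le_trans (cabs_lip _ _) _.
exact: (cabs_le_ReIm (toC y - toC x)).
Qed.

(** A point of the square is within [dm R j / 8] of [x]. So [kd], at most [8 * dm R j] at [x], stays
    below [9 * dm R j], and the distance to the circle, more than half of [dm R j], stays above a
    quarter of it. *)
Lemma sq2_enl j b x : test_pt j b -> box j x ->
  sq2 x (dm R j / 16) `<=` @discR2 R `&` enl b j.
Proof.
move=> tb bx w /sq2P[w1 w2]; have [db _ _ _ _] := tb; have dx := box_disc bx.
have d0 := dm_gt0 R j; have k0 := kd_gt0 db dx; have w8 := uker_ge tb bx.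
have [_ _ _ /andP[d1 d2] _] := bx.
have xw : cabs (toC w - toC x) <= dm R j / 8.
  apply: le_trans (cabs_le_ReIm _) _.
  by have := lerD w1 w2; rewrite /=; lra.
have kx : kd b x <= 8 * dm R j.
  by move: w8; rewrite /uker ler_pdivlMr //; lra.
have kw : kd b w <= kd b x + dm R j / 8.
  have := cabs_lip (1 - (toC b)^*%C * toC w) (1 - (toC b)^*%C * toC x).
  have -> : 1 - (toC b)^*%C * toC w - (1 - (toC b)^*%C * toC x) =
    - ((toC b)^*%C * (toC w - toC x)) by ring.
  rewrite cabsN cabsM cabsJ -!/(kd _ _) => h.
  have := ler_pM (cabs_ge0 _) (cabs_ge0 _) (ltW (db : cabs (toC b) < 1)) xw.
  by move: h; rewrite ler_norml => /andP[_]; lra.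
have := cabs_le_sub (toC w) (toC x) => cw.
split; first by rewrite /discR2 /=; move: cw xw d1 d0; clear; lra.
split => /=; first by move: kw kx d0; clear; lra.
by move: cw xw d1 d0; clear; lra.
Qed.

(** On [enl] the kernel is at least 1/9, so the indicator is at most 81 times its square and
    [kernel_sum1] counts the overlaps. A point of [enl] has level at most [lv j + 2], which allows
    the weight of its own box to be replaced by that of [j]. *)
Lemma enl_overlap : exists2 N : R, 0 < N &
  forall (bp : bidx -> R * R) (l : seq bidx), uniq l ->
  (forall j, j \in l -> test_pt j (bp j)) ->
  forall x, discR2 x -> \sum_(j <- l) \1_(enl (bp j) j) x <= N.
Proof.
have [K K0 HK] := @kernel_sum1 R (3 / 2) ltac:(lra) ltac:(lra).
exists (K * 81 * (3 / 2) ^+ 2); first by rewrite !mulr_gt0 ?exprn_gt0.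
move=> bp l ul tl x dx; have [i bi] := box_cover dx.
have t32 : 0 <= 3 / 2 :> R by rewrite divr_ge0.
have t0 : 0 < (3 / 2 : R) ^+ lv i by rewrite exprn_gt0 // divr_gt0.
rewrite -(ler_pM2l t0).
have := HK bp l ul tl i x bi => h.
apply: (@le_trans _ _ (81 * (3 / 2) ^+ 2 * (K * (3 / 2) ^+ lv i))); last first.
  by rewrite le_eqVlt; apply/orP; left; apply/eqP; ring.
apply: le_trans (ler_wpM2l _ h); last by rewrite mulr_ge0 ?exprn_ge0.
rewrite !mulr_sumr big_seq [leRHS]big_seq; apply: ler_sum => j jl.
rewrite indicE; have [xe|_] := boolP (x \in enl (bp j) j); last first.
  have h1 := exprn_ge0 2 t32; have h2 := exprn_ge0 (lv j) t32.
  rewrite mulr0; apply: mulr_ge0; first exact: mulr_ge0.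
  by rewrite mulr_ge0 // sqr_ge0.
have [db _ _ _ _] := tl j jl.
move: xe; rewrite inE => -[/= e1 e2].
have k0 := kd_gt0 db dx; have d0 := dm_gt0 R j.
have w9 : 1 / 9 <= uker (bp j) j x by rewrite /uker ler_pdivlMr //; move: e1; clear; lra.
have lij : (lv i <= lv j + 2)%N.
  have [_ _ _ /andP[_ i2] _] := bi.
  have : 2 ^- (lv j + 2) <= 2 ^- lv i :> R.
    by move: i2 e2; rewrite exprD /dm invfM; lra.
  by rewrite lef_pV2 ?posrE ?exprn_gt0 // ler_eXn2l ?ltr1n.
have t1 : (3 / 2 : R) ^+ lv i <= (3 / 2) ^+ lv j * (3 / 2) ^+ 2.
  by rewrite -exprD ler_weXn2l //; lra.
have u2 : 1 <= 81 * uker (bp j) j x ^+ 2 by nra.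
rewrite mulr1; apply: le_trans t1 _.
have -> : 81 * (3 / 2) ^+ 2 * ((3 / 2) ^+ lv j * uker (bp j) j x ^+ 2) =
  (3 / 2) ^+ lv j * (3 / 2) ^+ 2 * (81 * uker (bp j) j x ^+ 2) by ring.
by rewrite ler_peMr // mulr_ge0 ?exprn_ge0.
Qed.

Variables (n : nat) (u : nat -> C -> C) (p q : R) (mu : {measure set (R * R) -> \bar R}).
Hypotheses (q0 : 0 < q) (qp : q < p) (hu : forall k, (k <= n)%N -> holo (u k)).

(** The scale cancels: [mean_deriv] loses [dm R j ^+ k] in the derivative and [coef_le_atoms] gains
    it in the coefficient. The numbers 16 and 256 stem from the half-side [dm R j / 16]. *)
Lemma box_integral_le B k : (k <= n)%N -> exists2 K : R, 0 < K &
  forall f j b A, holo f -> test_pt j b -> 0 <= A ->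
  (\int[leb2m R]_(x in @discR2 R `&` enl b j) (cabs (f (toC x)) `^ p)%:E <= A%:E)%E ->
  (\int[mu]_(x in box j) (cabs (cderiv k f (toC x)) `^ q * cabs (u k (toC x)) `^ q)%:E <=
    (K * (A / dm R j ^+ 2) `^ (q / p))%:E *
    \sum_(i < n.+1) atom_mass n u q mu (B + i) b j)%E.
Proof.
move=> kn; have p0 := lt_trans q0 qp.
have [K1 K10 HK1] := @mean_deriv R p k p0.
have [K2 K20 HK2] := @coef_le_atoms R n B.
pose N := size (index_enum 'I_n.+1).
have N0 : (0 < N)%N by rewrite /N -[index_enum _]enumT size_enum_ord.
exists ((K1 * 16 ^+ k * 256 `^ p^-1 * K2) `^ q * N%:R `^ q).
  by rewrite mulr_gt0 ?powR_gt0 ?mulr_gt0 ?powR_gt0 ?exprn_gt0 ?ltr0n.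
move=> f j b A hf tb A0 HA; have d0 := dm_gt0 R j; have [db _ _ _ _] := tb.
have mdisc := @measurable_discR2 R.
pose F i x := cabs (uDf n u (atom b j (B + i)) (toC x)).
have mF i : measurable_fun (box j) (fun x => (F i x `^ q)%:E).
  apply/measurable_EFinP.
  exact: (@measurable_powR_holo R (uDf n u (atom b j (B + i))) q _
    (holo_uDf hu (@holo_atom R b j (B + i) db)) (@box_disc R j)).
have pt x : box j x -> cabs (cderiv k f (toC x)) * cabs (u k (toC x)) <=
    (K1 * 16 ^+ k * 256 `^ p^-1 * K2) * (A / dm R j ^+ 2) `^ p^-1 * \sum_(i < n.+1) F i x.
  move=> bx; have := HK2 u j b x k tb bx kn => h2.
  have [_ _ _ /andP[b1 b2] _] := bx.
  have h1 : cabs (cderiv k f (toC x)) <=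
      K1 / (dm R j / 16) ^+ k * (A / (dm R j / 16) ^+ 2) `^ p^-1.
    apply: HK1; [exact: hf|by rewrite divr_gt0|by lra|].
    apply: le_trans HA; apply: ge0_integralS.
    - exact: measurable_sq2.
    - by apply: measurableI => //; exact: measurable_enl.
    - exact: sq2_enl.
    - by apply: measurable_powR_holo; [exact: hf | exact: subIsetl].
    - by move=> y _; exact: powR_ge0.
  have S0 : 0 <= \sum_(i < n.+1) F i x by apply: sumr_ge0 => i _; exact: cabs_ge0.
  apply: le_trans (ler_pM (cabs_ge0 _) (cabs_ge0 _) h1 h2) _.
  have -> : A / (dm R j / 16) ^+ 2 = 256 * (A / dm R j ^+ 2).
    by field; rewrite gt_eqF.
  rewrite powRM ?divr_ge0 ?exprn_ge0 ?(ltW d0) // expr_div_n.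
  rewrite le_eqVlt; apply/orP; left; apply/eqP.
  have dk : dm R j ^+ k != 0 by rewrite expf_neq0 // gt_eqF.
  move: (dm R j ^+ k) dk (\sum_(i < _) _) (_ `^ _) (_ `^ _) => D dk S1 S2 S3; field.
  by rewrite expf_neq0 /= ?pnatr_eq0.
have Z0 : 0 <= K1 * 16 ^+ k * 256 `^ p^-1 * K2.
  by rewrite !mulr_ge0 ?exprn_ge0 ?powR_ge0 // ltW.
have y0 : 0 <= A / dm R j ^+ 2 by rewrite divr_ge0 ?exprn_ge0 // ltW.
move: (K1 * _ * _ * _) (A / _) Z0 y0 pt => Z y Z0 y0 pt.
have c0 : 0 <= Z `^ q * N%:R `^ q * y `^ (q / p) by rewrite !mulr_ge0 ?powR_ge0.
have pt' x : box j x -> cabs (cderiv k f (toC x)) `^ q * cabs (u k (toC x)) `^ q <=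
    Z `^ q * N%:R `^ q * y `^ (q / p) * \sum_(i < n.+1) F i x `^ q.
  move=> bx; have S0 : 0 <= \sum_(i < n.+1) F i x by apply: sumr_ge0 => i _; exact: cabs_ge0.
  rewrite -powRM ?cabs_ge0 //.
  apply: (@le_trans _ _ ((Z * y `^ p^-1 * \sum_(i < n.+1) F i x) `^ q)).
    rewrite ge0_ler_powR ?(ltW q0) ?nnegrE ?mulr_ge0 ?cabs_ge0 ?powR_ge0 //.
    exact: pt.
  rewrite !powRM ?mulr_ge0 ?powR_ge0 // -powRrM [p^-1 * q]mulrC.
  have := powR_sum_le (index_enum 'I_n.+1) q0 (fun i => cabs_ge0 (uDf n u (atom b j (B + i)) (toC x))).
  rewrite -/N => h; rewrite -!mulrA ler_wpM2l ?powR_ge0 // mulrCA ler_wpM2l ?powR_ge0 //.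
have SF0 x : (0 <= \sum_(i < n.+1) (F i x `^ q)%:E)%E.
  by apply: sume_ge0 => i _; rewrite lee_fin powR_ge0.
have mS : measurable_fun (box j) (fun x => \sum_(i < n.+1) (F i x `^ q)%:E)%E.
  exact: emeasurable_sum.
apply: (@le_trans _ _ (\int[mu]_(x in box j) ((Z `^ q * N%:R `^ q * y `^ (q / p))%:E *
    \sum_(i < n.+1) (F i x `^ q)%:E))%E).
  apply: ge0_le_integral => //.
  - exact: measurable_box.
  - by move=> x _; rewrite lee_fin mulr_ge0 ?powR_ge0.
  - apply/measurable_EFinP; apply: measurable_funM; apply: measurable_powR_holo.
    + exact: (holo_cderiv (k := k) hf).
    + exact: box_disc.
    + exact: hu.
    + exact: box_disc.
  - exact: measurable_funeM.
  - by move=> x bx; rewrite sumEFin -EFinM lee_fin; exact: pt'.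
have mb := @measurable_box R j.
rewrite ge0_integralZl // ?lee_fin // ge0_integral_sum //; last first.
  by move=> i x _; rewrite lee_fin powR_ge0.
Qed.

End BoxEstimates.

(** * Compact subsets of the disc, and tails of bounded sums *)

Section CompactDiscs.
Variable R : realType.
Local Notation C := R[i].

Lemma cabs_continuous : continuous (@cabs R : C^o -> R^o).
Proof.
move=> z; have FF : Filter (nbhs (z : C^o)) := @nbhs_filter C^o z.
apply/cvgrPdist_lt => e e0.
have e0' : (0 < e%:C)%C by rewrite ltcR.
have H : (fun w : C^o => w) w @[w --> (z : C^o)] --> (z : C^o) by exact: cvg_id.
move/cvgrPdist_lt : H => /(_ _ e0'); apply: filterS => w /=; rewrite normC_cabs ltcR => h.
exact: le_lt_trans (cabs_lip _ _) h.
Qed.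

Lemma toC_continuous : continuous (@toC R : R^o * R^o -> C^o).
Proof.
move=> x; apply/cvgrPdist_lt => e e0.
have [e1 he] : exists e1 : R, e = (e1%:C)%C.
  by exists (Re e); move: e0; rewrite ltcE /= => /andP[/eqP h _]; case: e h => a b /= ->.
move: e0; rewrite he ltcR => e10.
have e20 : 0 < e1 / 2 by rewrite divr_gt0.
have h1 : \forall y \near (x : R^o * R^o), `|x.1 - y.1| < e1 / 2.
  have H : y.1 @[y --> (x : R^o * R^o)] --> (x.1 : R^o) by exact: cvg_fst.
  exact: (proj1 (cvgrPdist_lt _ _) H).
have h2 : \forall y \near (x : R^o * R^o), `|x.2 - y.2| < e1 / 2.
  have H : y.2 @[y --> (x : R^o * R^o)] --> (x.2 : R^o) by exact: cvg_snd.
  exact: (proj1 (cvgrPdist_lt _ _) H).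
near=> y; rewrite normC_cabs ltcR.
apply: le_lt_trans (toC_lip y x) _.
have -> : e1 = e1 / 2 + e1 / 2 by field.
by apply: ltrD; near: y.
Unshelve. all: end_near. Qed.

Lemma compact_cdisc (r : R) : compact ([set z | cabs z <= r] : set C^o).
Proof.
have -> : [set z | cabs z <= r] = (@toC R) @` (`[- r, r] `*` `[- r, r] `&`
    [set x | cabs (toC x) <= r]).
  rewrite predeqE => z; split => /= [h|[x [_ h] <-]] //.
  exists (Re z, Im z); last by case: (z).
  have a := le_trans (cabs_Re z) h; have b := le_trans (cabs_Im z) h.
  by split; [split; rewrite /= in_itv /= -ler_norml | case: (z) h].
apply: continuous_compact; first exact/continuous_subspaceT/toC_continuous.
apply: compact_closedI; first by apply: compact_setX; exact: segment_compact.
have ct : continuous ((fun x => cabs (toC x)) : R^o * R^o -> R^o).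
  move=> x; apply: (@continuous_comp _ C^o R^o (@toC R) (@cabs R)).
    exact: toC_continuous.
  exact: cabs_continuous.
have h := proj1 (continuous_closedP _) ct _ (@closed_le R r).
exact: h.
Qed.

Lemma compact_sub_disc (K : set C) : compact (K : set C^o) -> K `<=` @disc R ->
  exists r : R, [/\ 0 < r, r < 1 & forall z, K z -> cabs z <= r].
Proof.
move=> cK Kd; have [->|/set0P K0] := eqVneq K set0.
  by exists (1 / 2); split => //; lra.
have [c cKc Hc] := @compact_EVT_max C^o R (@cabs R) K K0 cK
  (continuous_subspaceT cabs_continuous).
have c1 : cabs c < 1 by apply: Kd; move: cKc; rewrite inE.
have c0 := cabs_ge0 c.
(* The midpoint between the maximal modulus and 1 is positive even if the maximum is 0. *)
exists ((cabs c + 1) / 2); split; [lra|lra|].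
by move=> z Kz; have := Hc z; rewrite inE => /(_ Kz); lra.
Qed.

Lemma cvge0P (v : nat -> \bar R) : (forall j, (0 <= v j)%E) ->
  (forall e : R, 0 < e -> \forall j \near \oo, (v j <= e%:E)%E) ->
  v @ \oo --> 0%E.
Proof.
move=> v0 H; apply/fine_cvgP; split.
  have := H 1 ltr01; apply: filterS => j hj.
  by rewrite ge0_fin_numE // (le_lt_trans hj) // ltry.
apply/cvgrPdist_le => e e0; have := H e e0; apply: filterS => j hj.
rewrite /= sub0r normrN ger0_norm ?fine_ge0 //.
by rewrite -lee_fin fineK // ge0_fin_numE // (le_lt_trans hj) // ltry.
Qed.

Lemma cvge0P_inv (v : nat -> \bar R) : (forall j, (0 <= v j)%E) -> v @ \oo --> 0%E ->
  forall e : R, 0 < e -> \forall j \near \oo, (v j <= e%:E)%E.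
Proof.
move=> v0 /fine_cvgP[h1 /cvgrPdist_le h2] e e0.
near=> j.
have fj : v j \is a fin_num by near: j.
have hj : `|0 - fine (v j)| <= e by near: j; exact: h2.
rewrite -(fineK fj) lee_fin; move: hj.
by rewrite sub0r normrN ger0_norm ?fine_ge0.
Unshelve. all: end_near. Qed.

(** [F] comes within [e] of the supremum of the finite sums, so a family disjoint from it cannot add
    more than [e]. *)
Lemma summable_tail (I : eqType) (P : I -> Prop) (Y : I -> R) (M : R) : (forall i, 0 <= Y i) ->
  (forall l : seq I, uniq l -> (forall i, i \in l -> P i) -> \sum_(i <- l) Y i <= M) ->
  forall e, 0 < e -> exists F : seq I, [/\ uniq F, forall i, i \in F -> P i &
    forall l : seq I, uniq l -> (forall i, i \in l -> P i /\ i \notin F) ->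
    \sum_(i <- l) Y i <= e].
Proof.
move=> Y0 HM e e0.
pose S := [set s | exists F : seq I, [/\ uniq F, forall i, i \in F -> P i & s = \sum_(i <- F) Y i]].
have S0 : S 0 by exists [::]; rewrite big_nil.
have supS : has_sup S.
  split; first by exists 0.
  by exists M => s [F [uF PF ->]]; exact: HM.
have [s [F [uF PF ->]] hs] := sup_adherent e0 supS.
exists F; split => // l ul Pl.
have : S (\sum_(i <- F ++ l) Y i).
  exists (F ++ l); split => //.
    rewrite cat_uniq uF ul andbT; apply/hasPn => i il.
    by have [] := Pl i il.
  by move=> i; rewrite mem_cat => /orP[/PF//|/Pl[]].
move=> /(sup_upper_bound supS); rewrite big_cat /=; lra.
Qed.

End CompactDiscs.

(** * The Sobolev condition implies the vanishing conditions *)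

Section Vanishing.
Variable R : realType.
Local Notation C := R[i].
Implicit Types (f : C -> C) (j : bidx) (b x : R * R).

Lemma bergman_int_ge0 p f : (0 <= bergman_int p f)%E.
Proof.
rewrite /bergman_int mule_ge0 ?lee_fin ?invr_ge0 ?(ltW (pi_gt0 R)) //.
by apply: integral_ge0 => x _; rewrite lee_fin powR_ge0.
Qed.

Lemma integral_normAp p f : 0 < p -> inAp p f ->
  (\int[leb2m R]_(x in @discR2 R) (cabs (f (toC x)) `^ p)%:E = (pi * normAp p f `^ p)%:E)%E.
Proof.
move=> p0 [_ fin]; have pi0 := @pi_gt0 R; have b0 := bergman_int_ge0 p f.
have e : (normAp p f `^ p)%:E = bergman_int p f.
  rewrite /normAp -powRrM mulVf ?gt_eqF // powRr1 ?fine_ge0 //.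
  by rewrite fineK // ge0_fin_numE.
rewrite EFinM e /bergman_int muleA -EFinM divff ?gt_eqF // mul1e.
by [].
Qed.

Lemma near_all_seq (I : eqType) (F : seq I) (Q : nat -> I -> Prop) :
  (forall i, i \in F -> \forall m \near \oo, Q m i) ->
  \forall m \near \oo, forall i, i \in F -> Q m i.
Proof.
elim: F => [|i F IH] H; first by near=> m.
have h1 := H i (mem_head _ _).
have h2 := IH (fun (j : I) jF => H j (mem_behead (s := i :: F) jF)).
near=> m => i'; rewrite inE => /predU1P[->|jF]; first by near: m.
have h : forall i, i \in F -> Q m i by near: m.
exact: h.
Unshelve. all: end_near. Qed.

Lemma leb2_sub_disc (A : set (R * R)) : measurable A -> A `<=` @discR2 R ->
  (leb2m R A <= 4%:E)%E.
Proof.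
move=> mA AD; have -> : (4 : R) = (2 * 1) ^+ 2 by ring.
rewrite -(@leb2_sq2 R (0, 0)) //; apply: le_measure; rewrite ?inE //.
  exact: measurable_sq2.
move=> x /AD dx; apply/sq2P; rewrite /= !subr0.
have {}dx := ltW (dx : cabs (toC x) < 1).
by split; apply: le_trans dx; [exact: (cabs_Re (toC x)) | exact: (cabs_Im (toC x))].
Qed.

(** [enl] keeps the distance [dm R j / 4] from the circle, so the convergence is uniform on it. *)
Lemma integral_enl_small p (fs : nat -> C -> C) b j (e : R) : 0 < p -> 0 < e ->
  (forall m, holo (fs m)) -> ucc0 fs ->
  \forall m \near \oo,
    (\int[leb2m R]_(x in @discR2 R `&` enl b j) (cabs (fs m (toC x)) `^ p)%:E <= e%:E)%E.
Proof.
move=> p0 e0 hf ucc; have d0 := dm_gt0 R j; have mdisc := @measurable_discR2 R.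
have mDE : measurable (@discR2 R `&` enl b j) by apply: measurableI => //; exact: measurable_enl.
(* 4 is the area of the square around the disc. *)
pose h : R := (e / 4) `^ p^-1.
have h0 : 0 < h by rewrite powR_gt0 // divr_gt0.
have Kd : [set z : C | cabs z <= 1 - dm R j / 4] `<=` @disc R.
  by move=> z /=; rewrite /disc /=; lra.
have := ucc _ (@compact_cdisc R _) Kd h h0; apply: filterS => m Hm.
apply: (@le_trans _ _ (\int[leb2m R]_(x in @discR2 R `&` enl b j) (cst (e / 4)%:E) x)%E).
  apply: ge0_le_integral.
  - exact: mDE.
  - by move=> x _; rewrite lee_fin powR_ge0.
  - by apply/measurable_EFinP; apply: measurable_powR_holo; [exact: hf | exact: subIsetl].
  - exact: measurable_cst.
  - move=> x [dx [_ /= ex]]; rewrite lee_fin.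
    have -> : e / 4 = h `^ p by rewrite powRVK // divr_ge0 // ltW.
    rewrite ge0_ler_powR ?(ltW p0) ?nnegrE ?cabs_ge0 ?(ltW h0) //.
    by apply/ltW/Hm => /=; move: ex; lra.
rewrite integral_cst //.
have {2}-> : e = e / 4 * 4 by rewrite divfK.
rewrite [(e / 4 * 4)%:E]EFinM; apply: lee_wpmul2l; first by rewrite lee_fin divr_ge0 // ltW.
by apply: leb2_sub_disc => //; exact: subIsetl.
Qed.

Variables (n : nat) (u : nat -> C -> C) (p q : R) (mu : {measure set (R * R) -> \bar R}).
Hypotheses (q0 : 0 < q) (qp : q < p) (hu : forall k, (k <= n)%N -> holo (u k)).

Lemma sobolev_vanishing_carleson k : (k <= n)%N -> sobolev_carleson n u p q mu ->
  vanishing_carleson k p q mu (fun x => cabs (u k (toC x)) `^ q).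
Proof.
move=> kn sob fs [fA [M' fM]] ucc; have p0 := lt_trans q0 qp.
have mdisc := @measurable_discR2 R.
have hf m : holo (fs m) by case: (fA m).
have [B HB] := atom_mass_bound q0 qp hu sob.
(* Test points exist for nonempty boxes only; an empty box gets a dummy value. *)
have Hbp j : exists b, box (R := R) j !=set0 -> test_pt j b.
  have [/test_pt_exists[b tb]|h] := pselect (box (R := R) j !=set0); first by exists b.
  by exists (0, 0) => hb; case: (h hb).
have [bp tt] := choice Hbp.
pose c i j := atom_mass n u q mu (B + i) (bp j) j.
pose sg := p / (p - q).
pose X i j := dm R j ^+ 2 * (fine (c i j) / dm R j ^+ 2) `^ sg.
have HMi i : exists Mi, forall l : seq bidx, uniq l ->
    (forall j, j \in l -> box (R := R) j !=set0) ->
    (forall j, j \in l -> (c i j < +oo)%E) /\ \sum_(j <- l) X i j <= Mi.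
  have [Mi _ H] := HB (B + i)%N (leq_addr _ _); exists Mi => l ul Pl.
  by apply: H => // j /Pl/tt.
have [Mf HM] := choice HMi.
have c0 i j : (0 <= c i j)%E by apply: integral_ge0 => x _; rewrite lee_fin powR_ge0.
have cfin i j : box (R := R) j !=set0 -> c i j \is a fin_num.
  move=> Pj; rewrite ge0_fin_numE //.
  have [|H _] := HM i [:: j] isT; first by move=> j'; rewrite inE => /eqP ->.
  by apply: H; rewrite inE.
have d2 j : 0 < dm R j ^+ 2 by rewrite exprn_gt0 ?dm_gt0.
have X0 i j : 0 <= X i j by rewrite mulr_ge0 ?powR_ge0 // ltW.
pose Y j := \sum_(i < n.+1) X i j.
have Y0 j : 0 <= Y j by apply: sumr_ge0.
pose a j := \sum_(i < n.+1) fine (c i j).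
have a0 j : 0 <= a j by apply: sumr_ge0 => i _; rewrite fine_ge0.
have Ysum (l : seq bidx) : uniq l -> (forall j, j \in l -> box (R := R) j !=set0) ->
    \sum_(j <- l) Y j <= \sum_(i < n.+1) Mf i.
  by move=> ul Pl; rewrite exchange_big /=; apply: ler_sum => i _; case: (HM i l ul Pl).
have [K K0 HK] := @box_integral_le R n u p q mu q0 qp hu B k kn.
have [N0 N00 HN] := @enl_overlap R.
pose A0 : R := pi * M' `^ p.
have A00 : 0 <= A0 by rewrite mulr_ge0 ?powR_ge0 // ltW // pi_gt0.
have fint m : (\int[leb2m R]_(x in @discR2 R) (cabs (fs m (toC x)) `^ p)%:E <= A0%:E)%E.
  rewrite integral_normAp // lee_fin ler_wpM2l ?(ltW (pi_gt0 R)) //.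
  by rewrite ge0_ler_powR ?(ltW p0) ?nnegrE ?powR_ge0 // (le_trans _ (fM m)) // powR_ge0.
pose Ne m j := (\int[leb2m R]_(x in @discR2 R `&` enl (bp j) j) (cabs (fs m (toC x)) `^ p)%:E)%E.
have Ne0 m j : (0 <= Ne m j)%E by apply: integral_ge0 => x _; rewrite lee_fin powR_ge0.
have mf m : measurable_fun (@discR2 R) (fun x => cabs (fs m (toC x)) `^ p).
  by apply: measurable_powR_holo; [exact: hf | ].
have Nefin m j : Ne m j \is a fin_num.
  rewrite ge0_fin_numE //; apply: le_lt_trans (ltry A0); apply: le_trans (fint m).
  apply: ge0_integralS.
  - by apply: measurableI => //; exact: measurable_enl.
  - exact: mdisc.
  - exact: subIsetl.
  - exact: mf.
  - by move=> x _; exact: powR_ge0.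
pose N m j := fine (Ne m j).
have NE m j : Ne m j = (N m j)%:E by rewrite fineK.
have N0' m j : 0 <= N m j by rewrite fine_ge0.
have Nsum m (l : seq bidx) : uniq l -> (forall j, j \in l -> box (R := R) j !=set0) ->
    \sum_(j <- l) N m j <= N0 * A0.
  move=> ul Pl; rewrite -lee_fin -sumEFin.
  under eq_bigr do rewrite -NE.
  apply: (@le_trans _ _ (N0%:E * \int[leb2m R]_(x in @discR2 R) (cabs (fs m (toC x)) `^ p)%:E)%E).
    apply: (@overlap_integral R _ _ (leb2m R) _ l (fun j => enl (bp j) j) (@discR2 R)).
    - exact: mdisc.
    - by move=> j; exact: measurable_enl.
    - exact: mf.
    - by move=> x; exact: powR_ge0.
    - exact: ltW.
    - by apply: HN => // j /Pl/tt.
  by rewrite EFinM; apply: lee_wpmul2l; [rewrite lee_fin ltW | exact: fint].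
pose T m j := K * (N m j / dm R j ^+ 2) `^ (q / p) * a j.
have T0 m j : 0 <= T m j by rewrite !mulr_ge0 ?powR_ge0 // ltW.
have IT m j : box (R := R) j !=set0 -> (\int[mu]_(x in box j)
    (cabs (cderiv k (fs m) (toC x)) `^ q * cabs (u k (toC x)) `^ q)%:E <= (T m j)%:E)%E.
  move=> Pj; apply: le_trans (HK (fs m) j (bp j) (N m j) (hf m) (tt j Pj) (N0' m j) _) _.
    by rewrite -NE.
  rewrite /T [leRHS]EFinM /a -sumEFin; apply: lee_wpmul2l.
    by rewrite lee_fin mulr_ge0 ?powR_ge0 // ltW.
  by apply: lee_sum => i _; rewrite fineK // cfin.
have s0 : 0 < q / p by rewrite divr_gt0.
have s1 : q / p < 1 by rewrite ltr_pdivrMr // mul1r.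
pose Ce (e : R) := e `^ (- (q / p) / (1 - q / p)).
(* Young's inequality is applied to the densities, masses divided by [dm R j ^+ 2]; multiplying back
   gives [N m j] and the terms [X i j] of the convergent series. *)
have TY m j e : 0 < e -> T m j <= K * (n.+1%:R * e) * N m j + K * Ce e * Y j.
  move=> e0; have y0 : 0 <= N m j / dm R j ^+ 2 by rewrite divr_ge0 // ltW.
  apply: (@le_trans _ _ (K * \sum_(i < n.+1) (e * N m j + Ce e * X i j))); last first.
    rewrite big_split /= sumr_const card_ord -mulr_sumr -/(Y j) -mulr_natl.
    by rewrite le_eqVlt; apply/orP; left; apply/eqP; ring.
  rewrite /T -mulrA ler_wpM2l ?(ltW K0) // /a mulr_sumr; apply: ler_sum => i _.
  have z0 : 0 <= fine (c i j) / dm R j ^+ 2 by rewrite divr_ge0 ?fine_ge0 // ltW.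
  have := young_powR z0 y0 e0 s0 s1.
  have -> : 1 / (1 - q / p) = sg.
    by rewrite /sg; field; rewrite subr_eq0 !gt_eqF.
  rewrite -/(Ce e) => h; have := ler_wpM2l (ltW (d2 j)) h.
  have -> : dm R j ^+ 2 * (fine (c i j) / dm R j ^+ 2 * (N m j / dm R j ^+ 2) `^ (q / p)) =
      (N m j / dm R j ^+ 2) `^ (q / p) * fine (c i j).
    by rewrite mulrA [dm R j ^+ 2 * _]mulrC divfK ?gt_eqF // mulrC.
  move=> /le_trans; apply; rewrite mulrDr [dm R j ^+ 2 * (e * _)]mulrCA.
  rewrite [dm R j ^+ 2 * (N m j / _)]mulrC divfK ?gt_eqF // lerD2l.
  by rewrite mulrCA /X.
apply: cvge0P => [m|e e0].
  by apply: integral_ge0 => x _; rewrite lee_fin mulr_ge0 ?powR_ge0.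
(* The order of choice matters: [e1] makes the part with [N m j] small for all [m] at once, [e2]
   then absorbs the Young constant [Ce e1] in the tail of [Y], and only after [F] is fixed is [e3]
   reached on it for large [m]. Each part receives [e / 3]; the added 1 keeps denominators
   positive. *)
pose e1 := e / (3 * (K * n.+1%:R * (N0 * A0) + 1)).
have q10 : 0 <= K * n.+1%:R * (N0 * A0).
  exact: mulr_ge0 (mulr_ge0 (ltW K0) (ler0n _ _)) (mulr_ge0 (ltW N00) A00).
have e10 : 0 < e1 by rewrite divr_gt0 // mulr_gt0 // ltr_wpDl.
have q20 : 0 <= K * Ce e1 by rewrite mulr_ge0 ?powR_ge0 // ltW.
pose e2 := e / (3 * (K * Ce e1 + 1)).
have e20 : 0 < e2 by rewrite divr_gt0 // mulr_gt0 // ltr_wpDl.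
have [F [uF PF HF]] := summable_tail Y0 Ysum e20.
pose e3 := e / (3 * (size F).+1%:R).
have e30 : 0 < e3 by rewrite divr_gt0 // mulr_gt0.
have nearF : \forall m \near \oo, forall j, j \in F -> T m j <= e3.
  apply: near_all_seq => j jF.
  pose L := K * (dm R j ^+ 2)^-1 `^ (q / p) * a j.
  have L0 : 0 <= L by rewrite !mulr_ge0 ?powR_ge0 // ltW.
  have h0 : 0 < (e3 / (L + 1)) `^ (q / p)^-1 by rewrite powR_gt0 // divr_gt0 // ltr_wpDl.
  have := @integral_enl_small p fs (bp j) j _ p0 h0 hf ucc; apply: filterS => m.
  rewrite -/(Ne m j) NE lee_fin => hN.
  have -> : T m j = N m j `^ (q / p) * L.
    by rewrite /T powRM ?invr_ge0 ?(ltW (d2 j)) // /L; ring.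
  apply: (@le_trans _ _ (e3 / (L + 1) * L)).
    rewrite ler_wpM2r //.
    have -> : e3 / (L + 1) = ((e3 / (L + 1)) `^ (q / p)^-1) `^ (q / p).
      by rewrite powRVK // divr_ge0 // ?(ltW e30) // addr_ge0.
    by rewrite ge0_ler_powR ?(ltW s0) ?nnegrE ?powR_ge0.
  rewrite mulrAC ler_pdivrMr ?ltr_wpDl // ler_wpM2l ?(ltW e30) //.
  by rewrite lerDl.
apply: filterS nearF => m nF.
apply: (@countable_integral_bound R _ _ mu bidx (@box R)).
- exact: measurable_box.
- exact: box_uniq.
- by move=> x; split => [/box_cover//|[j /box_disc]].
- apply: measurable_funM; apply: measurable_powR_holo.
  + exact: (holo_cderiv (k := k) (hf m)).
  + by [].
  + exact: hu.
  + by [].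
- by move=> x; rewrite mulr_ge0 ?powR_ge0.
(* Empty boxes contribute nothing and are dropped, since the estimates require genuine test
   points. *)
move=> l ul; pose l1 := [seq j <- l | `[< box (R := R) j !=set0 >]].
have ul1 : uniq l1 by exact: filter_uniq.
have Pl1 j : j \in l1 -> box (R := R) j !=set0 by rewrite mem_filter => /andP[/asboolP].
apply: (@le_trans _ _ (\sum_(j <- l1) (T m j)%:E)%E).
  rewrite /l1 big_filter big_mkcond [leRHS]big_mkcond /=; apply: lee_sum => j _ /=.
  case: asboolP => [Pj|Pj]; first exact: IT.
  have -> : box (R := R) j = set0 by apply/eqP; apply/negPn/negP => /set0P.
  by rewrite integral_set0.
rewrite sumEFin lee_fin (bigID (mem F)) /= -[X in X + _]big_filter -[X in _ + X]big_filter.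
set lF := [seq j <- l1 | j \in F]; set lG := [seq j <- l1 | j \notin F].
have h1 : \sum_(j <- lF) T m j <= e / 3.
  apply: (@le_trans _ _ (\sum_(j <- F) T m j)).
    apply: uniq_sum_le => //; first exact: filter_uniq.
    by move=> j; rewrite mem_filter => /andP[].
  apply: (@le_trans _ _ (\sum_(j <- F) e3)).
    by rewrite big_seq [leRHS]big_seq; apply: ler_sum.
  rewrite big_const_seq count_predT iter_addr_0 -[e3 *+ _]mulr_natl.
  have -> : e / 3 = (size F).+1%:R * e3.
    have : (size F).+1%:R != 0 :> R by rewrite pnatr_eq0.
    by rewrite /e3; move: (size F).+1%:R => t t0; field.
  by rewrite ler_wpM2r ?(ltW e30) // ler_nat.
have GP j : j \in lG -> box (R := R) j !=set0 /\ j \notin F.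
  by rewrite mem_filter => /andP[jF /Pl1].
have uG : uniq lG by exact: filter_uniq.
have h2 : \sum_(j <- lG) T m j <= e / 3 + e / 3.
  apply: (@le_trans _ _ (\sum_(j <- lG) (K * (n.+1%:R * e1) * N m j + K * Ce e1 * Y j))).
    by apply: ler_sum => j _; exact: TY.
  rewrite big_split /= -!mulr_sumr; apply: lerD.
    apply: (@le_trans _ _ (K * (n.+1%:R * e1) * (N0 * A0))).
      rewrite ler_wpM2l ?(mulr_ge0 (ltW K0) (mulr_ge0 (ler0n _ _) (ltW e10))) //.
      by apply: Nsum => // j /GP[].
    have -> : K * (n.+1%:R * e1) * (N0 * A0) = e1 * (K * n.+1%:R * (N0 * A0)) by ring.
    rewrite /e1 mulrAC ler_pdivrMr ?mulr_gt0 ?ltr_wpDl //.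
    have -> : e / 3 * (3 * (K * n.+1%:R * (N0 * A0) + 1)) = e * (K * n.+1%:R * (N0 * A0) + 1).
      by field.
    by rewrite ler_wpM2l ?(ltW e0) // lerDl.
  apply: (@le_trans _ _ (K * Ce e1 * e2)).
    by rewrite ler_wpM2l //; apply: HF.
  have -> : K * Ce e1 * e2 = e2 * (K * Ce e1) by ring.
  rewrite /e2 mulrAC ler_pdivrMr ?mulr_gt0 ?ltr_wpDl //.
  have -> : e / 3 * (3 * (K * Ce e1 + 1)) = e * (K * Ce e1 + 1) by field.
  by rewrite ler_wpM2l ?(ltW e0) // lerDl.
by move: h1 h2; lra.
Qed.

End Vanishing.

(** * Scaling, and boundedness from vanishing *)

Section Homogeneity.
Variable R : realType.
Local Notation C := R[i].
Implicit Types (f : C -> C) (p q : R).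

(** Makes [holo_lin], [cderiv_lin] and [uDf_lin] available for scalar multiples. *)
Lemma mulZ_lin (c : C) f : (fun w => c * f w) = (fun w => \sum_(i <- [:: tt]) c * f w).
Proof. by apply: funext => w; rewrite big_seq1. Qed.

Lemma holoZ (c : C) f : holo f -> holo (fun w => c * f w).
Proof. by move=> hf; rewrite mulZ_lin;
  exact: (@holo_lin R unit [:: tt] (fun=> c) (fun=> f) (fun=> hf)). Qed.

Lemma cderivZ (c : C) f k z : holo f -> disc z ->
  cderiv k (fun w => c * f w) z = c * cderiv k f z.
Proof.
move=> hf dz; rewrite mulZ_lin.
have -> := @cderiv_lin R unit [:: tt] (fun=> c) (fun=> f) k z (fun=> hf) dz.
by rewrite big_seq1.
Qed.

Lemma uDfZ (c : C) f n u z : holo f -> disc z ->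
  uDf n u (fun w => c * f w) z = c * uDf n u f z.
Proof.
move=> hf dz; rewrite mulZ_lin.
have -> := @uDf_lin R unit [:: tt] (fun=> c) (fun=> f) n u z (fun=> hf) dz.
by rewrite big_seq1.
Qed.

Lemma bergman_intZ p (t : R) f : 0 <= t -> holo f ->
  bergman_int p (fun w => Complex t 0 * f w) = ((t `^ p)%:E * bergman_int p f)%E.
Proof.
move=> t0 hf; have mdisc := @measurable_discR2 R.
rewrite /bergman_int muleCA; congr (_ * _)%E.
transitivity (\int[leb2m R]_(x in @discR2 R) ((t `^ p)%:E * (cabs (f (toC x)) `^ p)%:E))%E.
  apply: eq_integral => x _.
  by rewrite cabsM cabs_real ger0_norm // powRM ?cabs_ge0.
rewrite ge0_integralZl_EFin ?powR_ge0 //.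
- by move=> x _; rewrite lee_fin powR_ge0.
- by apply/measurable_EFinP; apply: measurable_powR_holo; [exact: hf | ].
Qed.

Lemma inApZ p (t : R) f : 0 <= t -> inAp p f -> inAp p (fun w => Complex t 0 * f w).
Proof.
move=> t0 [hf fin]; split; first exact: holoZ.
rewrite bergman_intZ //; apply: lte_mul_pinfty => //; rewrite ?lee_fin ?powR_ge0 //.
Qed.

Lemma normApZ p (t : R) f : 0 < p -> 0 <= t -> inAp p f ->
  normAp p (fun w => Complex t 0 * f w) = t * normAp p f.
Proof.
move=> p0 t0 [hf fin]; have b0 := bergman_int_ge0 p f.
rewrite /normAp bergman_intZ // fineM // ?ge0_fin_numE //=.
by rewrite powRM ?powR_ge0 ?fine_ge0 // powRK.
Qed.

(** By [mean_Lp], on squares of half-side [(1 - r) / 4], the values on [|z| <= r] are at most a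
    fixed multiple of the norm. *)
Lemma ucc0_normAp p (gs : nat -> C -> C) : 0 < p -> (forall j, inAp p (gs j)) ->
  (forall j, normAp p (gs j) <= j.+1%:R^-1) -> ucc0 gs.
Proof.
move=> p0 gA gn K cK Kd eps e0; have pi0 := @pi_gt0 R.
have [r [r0 r1 Kr]] := compact_sub_disc cK Kd.
have [M M0 HM] := @mean_Lp R p p0.
pose h := (1 - r) / 4; have h0 : 0 < h by rewrite divr_gt0 // subr_gt0.
pose L := (M * pi / h ^+ 2) `^ p^-1.
have L0 : 0 < L by rewrite powR_gt0 // divr_gt0 ?exprn_gt0 // mulr_gt0.
have gz j z : K z -> cabs (gs j z) <= L * j.+1%:R^-1.
  move=> Kz; have [hg _] := gA j.
  pose x : R * R := (Re z, Im z); have zx : toC x = z by rewrite /toC /=; case: (z).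
  have h2 : 2 * h < 1 - cabs (toC x) by rewrite zx; have := Kr z Kz; rewrite /h; lra.
  have HA : (\int[leb2m R]_(x in sq2 x h) (cabs (gs j (toC x)) `^ p)%:E <=
      (pi * normAp p (gs j) `^ p)%:E)%E.
    rewrite -(integral_normAp p0 (gA j)); apply: ge0_integralS.
    - exact: measurable_sq2.
    - exact: measurable_discR2.
    - by move=> y ys; exact: sq2_disc ys h2.
    - by apply: measurable_powR_holo; [exact: hg | ].
    - by move=> y _; exact: powR_ge0.
  have := HM (gs j) x h _ hg h0 h2 HA; rewrite zx => H.
  rewrite -[leLHS](powRK p0) ?cabs_ge0 //.
  have -> : L * j.+1%:R^-1 = ((L * j.+1%:R^-1) `^ p) `^ p^-1.
    by rewrite powRK // mulr_ge0 ?(ltW L0).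
  rewrite ge0_ler_powR ?invr_ge0 ?(ltW p0) ?nnegrE ?powR_ge0 //.
  apply: le_trans H _.
  have c0 : 0 <= M * pi / h ^+ 2 by exact: divr_ge0 (mulr_ge0 (ltW M0) (ltW pi0)) (exprn_ge0 _ (ltW
    h0)).
  rewrite powRM ?(ltW L0) // /L powRVK //.
  have -> : M * (pi * normAp p (gs j) `^ p) / h ^+ 2 = (M * pi / h ^+ 2) * normAp p (gs j) `^ p by ring.
  by rewrite ler_wpM2l // ge0_ler_powR ?(ltW p0) ?nnegrE ?powR_ge0 // invr_ge0.
exists (Num.bound (L / eps)) => // j /= hj z Kz.
apply: le_lt_trans (gz j z Kz) _.
rewrite ltr_pdivrMr ?ltr0n // mulrC -ltr_pdivrMr //.
apply: lt_le_trans (archi_boundP _) _; first by rewrite divr_ge0 // ltW.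
by rewrite ler_nat (leq_trans hj).
Qed.

(** Without a bound there are functions with [Phi] large compared with the norm; rescaled, their
    norms tend to 0 while [Phi] stays at least 1, against vanishing. The functional is abstract so
    as to cover both kinds of Carleson condition. *)
Lemma vanishing_bounded p q (Phi : (C -> C) -> \bar R) : 0 < p -> 0 < q ->
  (forall f, (0 <= Phi f)%E) ->
  (forall (t : R) f, 0 < t -> inAp p f ->
    Phi (fun w => Complex t 0 * f w) = ((t `^ q)%:E * Phi f)%E) ->
  (forall fs, bounded_Ap p fs -> ucc0 fs -> Phi (fs j) @[j --> \oo] --> 0%E) ->
  exists M : R, 0 < M /\ forall f, inAp p f -> (Phi f <= (M * normAp p f `^ q)%:E)%E.
Proof.
move=> p0 q0 Phi0 PhiZ Phiv; apply: contrapT => nM.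
have H j : exists g, [/\ inAp p g, normAp p g <= j.+1%:R^-1 & (1 <= Phi g)%E].
  have [f [fA hf]] : exists f, inAp p f /\ ((j.+1%:R `^ q * normAp p f `^ q)%:E < Phi f)%E.
    apply: contrapT => nf; apply: nM; exists (j.+1%:R `^ q).
    split; first by rewrite powR_gt0.
    move=> f fA; rewrite leNgt; apply/negP => h; apply: nf; by exists f.
  have nf0 : 0 <= normAp p f := powR_ge0 _ _.
  (* The norm of [f] may be 0, so the divisor comes from [Phi f]: its q-th root if it is finite,
     otherwise any positive number above the required bound. *)
  have [s [s0 sn sP]] : exists s : R, [/\ 0 < s, j.+1%:R * normAp p f <= s & ((s `^ q)%:E <= Phi f)%E].
    move: hf; rewrite -powRM //; have := Phi0 f; case: (Phi f) => [P|_ _|//].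
      rewrite lee_fin lte_fin => P0 hP.
      have PP : 0 < P by apply: le_lt_trans hP; exact: powR_ge0.
      exists (P `^ q^-1); split; [by rewrite powR_gt0| |by rewrite powRVK].
      rewrite -[leLHS](powRK q0) ?mulr_ge0 //.
      by rewrite ge0_ler_powR ?invr_ge0 ?(ltW q0) ?nnegrE ?powR_ge0 // ltW.
    exists (j.+1%:R * normAp p f + 1); split;
      [by rewrite ltr_wpDl ?mulr_ge0|by rewrite lerDl|exact: leey].
  exists (fun w => Complex s^-1 0 * f w); split.
  - by apply: inApZ => //; rewrite invr_ge0 ltW.
  - rewrite normApZ ?invr_ge0 ?(ltW s0) // mulrC ler_pdivrMr // mulrC ler_pdivlMr ?ltr0n //.
    by rewrite mulrC.
  - rewrite PhiZ ?invr_gt0 //; apply: le_trans (lee_wpmul2l _ sP); last by rewrite lee_fin powR_ge0.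
    by rewrite -EFinM -powRM ?invr_ge0 ?(ltW s0) // mulVf ?gt_eqF // powR1.
have [gs Hgs] := choice H.
have gA j : inAp p (gs j) by case: (Hgs j).
have gn j : normAp p (gs j) <= j.+1%:R^-1 by case: (Hgs j).
have g1 j : (1 <= Phi (gs j))%E by case: (Hgs j).
have gb : bounded_Ap p gs.
  split=> //; exists 1 => j; apply: le_trans (gn j) _.
  by rewrite invf_le1 ?ler1n ?ltr0n.
have := Phiv gs gb (ucc0_normAp p0 gA gn).
move=> /(cvge0P_inv (fun j => Phi0 (gs j))) /(_ (1 / 2)).
rewrite divr_gt0 // => /(_ isT) [N _ /(_ N (leqnn N))] /= h.
have := le_trans (g1 N) h; rewrite lee_fin; lra.
Qed.

End Homogeneity.

(** * The remaining implications and the equivalence *)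

Section Equivalence.
Variables (R : realType) (n : nat) (p q : R) (u : nat -> R[i] -> R[i]).
Variable mu : {measure set (R * R) -> \bar R}.
Hypotheses (q0 : 0 < q) (qp : q < p) (hu : forall k, (k <= n)%N -> holo (u k)).

Let p0 : 0 < p := lt_trans q0 qp.
Let mdisc := @measurable_discR2 R.

Lemma measurable_cderiv_coef k f : (k <= n)%N -> holo f ->
  measurable_fun (@discR2 R)
    (fun x => (cabs (cderiv k f (toC x)) `^ q * cabs (u k (toC x)) `^ q)%:E).
Proof.
move=> kn hf; apply/measurable_EFinP; apply: measurable_funM.
  by apply: measurable_powR_holo; [exact: (holo_cderiv (k := k) hf) | ].
by apply: measurable_powR_holo; [exact: hu | ].
Qed.

Lemma measurable_uDf f : holo f ->
  measurable_fun (@discR2 R) (fun x => (cabs (uDf n u f (toC x)) `^ q)%:E).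
Proof.
move=> hf; apply/measurable_EFinP; apply: measurable_powR_holo; last by [].
exact: holo_uDf.
Qed.

(** The triangle inequality followed by [powR_sum_le], which makes the comparison valid for all
    [q > 0]. *)
Lemma uDf_integral_le : exists2 M : R, 0 < M & forall f, holo f ->
  (\int[mu]_(x in @discR2 R) (cabs (uDf n u f (toC x)) `^ q)%:E <=
   M%:E * \sum_(k < n.+1) \int[mu]_(x in @discR2 R)
     (cabs (cderiv k f (toC x)) `^ q * cabs (u k (toC x)) `^ q)%:E)%E.
Proof.
pose N := size (index_enum 'I_n.+1).
have N0 : (0 < N)%N by rewrite /N -[index_enum _]enumT size_enum_ord.
exists (N%:R `^ q); first by rewrite powR_gt0 ?ltr0n.
move=> f hf; pose F (k : 'I_n.+1) x := cabs (cderiv k f (toC x)) `^ q * cabs (u k (toC x)) `^ q.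
have F0 k x : 0 <= F k x by rewrite mulr_ge0 ?powR_ge0.
have mF k : measurable_fun (@discR2 R) (fun x => (F k x)%:E).
  by apply: measurable_cderiv_coef => //; rewrite -ltnS ltn_ord.
have mS : measurable_fun (@discR2 R) (fun x => \sum_(k < n.+1) (F k x)%:E)%E.
  exact: emeasurable_sum.
rewrite -ge0_integral_sum //; last by move=> k x _; rewrite lee_fin F0.
rewrite -ge0_integralZl_EFin ?powR_ge0 //; last first.
  by move=> x _; apply: sume_ge0 => k _; rewrite lee_fin F0.
apply: ge0_le_integral => //.
- by move=> x _; rewrite lee_fin powR_ge0.
- exact: measurable_uDf.
- exact: measurable_funeM.
- move=> x dx; rewrite sumEFin -EFinM lee_fin.
  have h := powR_sum_le (index_enum 'I_n.+1) q0
    (fun k : 'I_n.+1 => cabs_ge0 (u k (toC x) * cderiv k f (toC x))).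
  apply: (@le_trans _ _ ((\sum_(k < n.+1) cabs (u k (toC x) * cderiv k f (toC x))) `^ q)).
    rewrite ge0_ler_powR ?(ltW q0) ?nnegrE ?cabs_ge0 //.
      by apply: sumr_ge0 => k _; exact: cabs_ge0.
    exact: cabs_sum.
  apply: le_trans h _; rewrite -/N ler_wpM2l ?powR_ge0 //; apply: ler_sum => k _.
  by rewrite cabsM powRM ?cabs_ge0 // mulrC.
Qed.

Lemma vanishing_sobolev_of_carleson :
  (forall k, (k <= n)%N -> vanishing_carleson k p q mu (fun x => cabs (u k (toC x)) `^ q)) ->
  vanishing_sobolev_carleson n u p q mu.
Proof.
move=> V fs bfs ucc; have [M M0 HM] := uDf_integral_le.
have I0 k m : (0 <= \int[mu]_(x in @discR2 R)
    (cabs (cderiv k (fs m) (toC x)) `^ q * cabs (u k (toC x)) `^ q)%:E)%E.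
  by apply: integral_ge0 => x _; rewrite lee_fin mulr_ge0 ?powR_ge0.
apply: cvge0P => [m|e e0].
  by apply: integral_ge0 => x _; rewrite lee_fin powR_ge0.
pose e1 := e / (M * n.+1%:R).
have e10 : 0 < e1 by rewrite divr_gt0 // mulr_gt0.
have := @near_all_seq 'I_n.+1 (enum 'I_n.+1) (fun m k => (\int[mu]_(x in @discR2 R)
    (cabs (cderiv k (fs m) (toC x)) `^ q * cabs (u k (toC x)) `^ q)%:E <= e1%:E)%E).
case=> [k _|N _ HN].
  have kn : (k <= n)%N by rewrite -ltnS ltn_ord.
  exact: (cvge0P_inv (I0 k) (V k kn fs bfs ucc) e10).
exists N => // m /= Nm; have hf : holo (fs m) by case: bfs => /(_ m)[].
apply: le_trans (HM _ hf) _.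
apply: (@le_trans _ _ (M%:E * \sum_(k < n.+1) e1%:E)%E).
  apply: lee_wpmul2l; first by rewrite lee_fin ltW.
  by apply: lee_sum => k _; apply: HN => //; rewrite mem_enum.
rewrite sumEFin -EFinM lee_fin sumr_const card_ord -[e1 *+ _]mulr_natl mulrA.
by rewrite /e1 mulrC divfK // gt_eqF // mulr_gt0.
Qed.

Lemma sobolev_of_carleson :
  (forall k, (k <= n)%N -> carleson k p q mu (fun x => cabs (u k (toC x)) `^ q)) ->
  sobolev_carleson n u p q mu.
Proof.
move=> V; have [M M0 HM] := uDf_integral_le.
(* Choice needs a constant for every [k]; beyond [n] it is the dummy 1. *)
have H k : exists Ck : R, 0 < Ck /\ ((k <= n)%N -> forall f, inAp p f ->
    (\int[mu]_(x in @discR2 R)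
      (cabs (cderiv k f (toC x)) `^ q * cabs (u k (toC x)) `^ q)%:E
      <= (Ck * normAp p f `^ q)%:E)%E).
  have [kn|kn] := boolP (k <= n)%N; last by exists 1.
  by have [Ck [C0 HC]] := V k kn; exists Ck.
have [Ck HC] := choice H.
exists (M * \sum_(k < n.+1) Ck k); split.
  rewrite mulr_gt0 // big_ord_recl ltr_pwDl //; first by case: (HC 0%N).
  by apply: sumr_ge0 => k _; case: (HC (lift ord0 k)) => /ltW.
move=> f fA; have [hf _] := fA; apply: le_trans (HM f hf) _.
rewrite -mulrA EFinM; apply: lee_wpmul2l; first by rewrite lee_fin ltW.
rewrite mulr_suml -sumEFin; apply: lee_sum => k _.
have [_] := HC k; apply => //; by rewrite -ltnS ltn_ord.
Qed.

Lemma carleson_of_vanishing k : (k <= n)%N ->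
  vanishing_carleson k p q mu (fun x => cabs (u k (toC x)) `^ q) ->
  carleson k p q mu (fun x => cabs (u k (toC x)) `^ q).
Proof.
move=> kn V; apply: (vanishing_bounded p0 q0) V => [f|t f t0 [hf _]].
  by apply: integral_ge0 => x _; rewrite lee_fin mulr_ge0 ?powR_ge0.
rewrite -ge0_integralZl_EFin ?powR_ge0 //; last 2 first.
- by move=> x _; rewrite lee_fin mulr_ge0 ?powR_ge0.
- exact: measurable_cderiv_coef.
apply: eq_integral => x; rewrite inE => dx.
by rewrite cderivZ // cabsM cabs_real (gtr0_norm t0) powRM ?cabs_ge0 ?(ltW t0) // -EFinM mulrA.
Qed.

Lemma sobolev_of_vanishing :
  vanishing_sobolev_carleson n u p q mu -> sobolev_carleson n u p q mu.
Proof.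
move=> V; apply: (vanishing_bounded p0 q0) V => [f|t f t0 [hf _]].
  by apply: integral_ge0 => x _; rewrite lee_fin powR_ge0.
rewrite -ge0_integralZl_EFin ?powR_ge0 //; last 2 first.
- by move=> x _; rewrite lee_fin powR_ge0.
- exact: measurable_uDf.
apply: eq_integral => x; rewrite inE => dx.
by rewrite uDfZ // cabsM cabs_real (gtr0_norm t0) powRM ?cabs_ge0 ?(ltW t0).
Qed.

End Equivalence.

Theorem theorem1p2 (R : realType) (n : nat) (p q : R)
    (u : nat -> R[i] -> R[i]) (mu : {measure set (R * R) -> \bar R}) :
  (0 < n)%N -> 0 < q -> q < p ->
  (forall k, (k <= n)%N -> holo (u k)) ->
  [<-> sobolev_carleson n u p q mu;
       vanishing_sobolev_carleson n u p q mu;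
       forall k, (k <= n)%N ->
         carleson k p q mu (fun x => (cabs (u k (toC x))) `^ q);
       forall k, (k <= n)%N ->
         vanishing_carleson k p q mu (fun x => (cabs (u k (toC x))) `^ q)].
Proof.
move=> _ q0 qp hu.
have ad : sobolev_carleson n u p q mu -> forall k, (k <= n)%N ->
    vanishing_carleson k p q mu (fun x => cabs (u k (toC x)) `^ q).
  by move=> a k kn; exact: (sobolev_vanishing_carleson q0 qp hu kn a).
have db := @vanishing_sobolev_of_carleson R n p q u mu q0 hu.
have ba := sobolev_of_vanishing q0 qp hu.
have ca := @sobolev_of_carleson R n p q u mu q0 hu.
(* The cycle runs (a), (b), (c), (d), (a); its first three arrows pass through (a) => (d). *)
tfae.
- by move=> /ad/db.
- by move=> /ba/ad d k kn; apply: (carleson_of_vanishing q0 qp hu kn); exact: d.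
- by move=> /ca/ad.
- by move=> /db/ba.
Qed.
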